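(* Assume (A0)–(A3) as in the context, and let $N_t:=\max\{n\in\mathbb{N}:\tau_n\le t\}$. (i) If $-1<r\le1$ and (M$_p$) holds with some $p>2$, then for any $\varepsilon>0$, a.s., for all but finitely many $t$, $$t^{\frac{1+r}{2}}(\log t)^{-3-r-\varepsilon}\le N_t\le t^{\frac{1+r}{2}}(\log t)^{1+\varepsilon}.$$ (ii) If $r>1$ and (M$_p$) holds with some $p>1+r$, then a.s. $t^{-1}N_t\to 1/\mathbb{E}[\eta_1]\in(0,\infty)$ as $t\to\infty$.
   Context: $\mathbb{N}=\{1,2,\dots\}$. (A0): $\mathbb{S}$ is a locally finite (every bounded set meets it in finitely many points), unbounded subset of $[0,\infty)$ with $0\in\mathbb{S}$; $(X_t)_{t\in\mathbb{N}}$ is an $\mathbb{S}$-valued process adapted to a filtration $(\mathcal{F}_t)_{t\in\mathbb{N}}$ with $\mathbb{P}[X_1=0]=1$. (A1): for each $x,y\in\mathbb{S}$ there exist $m(x,y)\in\mathbb{N}$, $\varphi(x,y)>0$ with $\mathbb{P}[X_{t+m(X_t,y)}=y\mid\mathcal{F}_t]\ge\varphi(X_t,y)$ a.s. for all $t$. Write $\Delta_t:=X_{t+1}-X_t$. (A2): there are $c\in\mathbb{R}$, $s^2\in(0,\infty)$ with, as $X_t\to\infty$, $\mathbb{E}[\Delta_t\mid\mathcal{F}_t]=cX_t^{-1}+o(X_t^{-1}(\log X_t)^{-1})$ and $\mathbb{E}[\Delta_t^2\mid\mathcal{F}_t]=s^2+o((\log X_t)^{-1})$ a.s., where the implicit constants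 in $o(\cdot)$ are non-random and uniform in $t$ and in the sample point. Set $r:=-2c/s^2$. Excursions: $\tau_0:=1$, $\tau_n:=\min\{t>\tau_{n-1}:X_t=0\}$ ($\min\emptyset=\infty$), $\eta_n:=\tau_n-\tau_{n-1}$, $\mathcal{E}_n:=(X_t)_{\tau_{n-1}\le t\le\tau_n-1}$, $N:=\min\{n\in\mathbb{N}:\tau_n=\infty\}$. (A3): (a) on $\{N=\infty\}$, $(\mathcal{E}_n)_{n\in\mathbb{N}}$ is i.i.d.; (b) $\mathbb{P}[\eta_{n+1}<\infty\mid\tau_n<\infty]=\mathbb{P}[\eta_1<\infty]$ for all $n$. (M$_p$): there exist $\delta>0$, $C<\infty$ with $\mathbb{E}[|\Delta_t|^p\mid\mathcal{F}_t]\le C(1+X_t)^{p-2-\delta}$ a.s. for all $t$. *)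

(* Defs.v *)
From HB Require Import structures.
From mathcomp Require Import all_boot all_order all_algebra.
From mathcomp Require Import all_classical all_reals all_analysis.
From mathcomp Require Import measurable_realfun.
Set Implicit Arguments.
Unset Strict Implicit.
Unset Printing Implicit Defensive.
Import Order.TTheory GRing.Theory Num.Theory.
Import numFieldNormedType.Exports.
Local Open Scope classical_set_scope.
Local Open Scope ring_scope.

Section Defs.
Context {R : realType} {d : measure_display} {T : measurableType d}.

(** Time set is N = {1,2,...}; value at time 0 is never used. *)

Definition next_zero (X : nat -> T -> R) (w : T) (s : nat) : option nat :=
  match pselect (exists t, (s < t)%N && `[< X t w = 0 >]) with
  | left h => Some (ex_minn h)
  | right _ => None
  end.

(** tau_0 = 1, tau_n = min{t > tau_{n-1} : X_t = 0}; None encodes +infinity *)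
Fixpoint tau (X : nat -> T -> R) (w : T) (n : nat) : option nat :=
  match n with
  | 0 => Some 1%N
  | n'.+1 => obind (next_zero X w) (tau X w n')
  end.

Definition eta_n (X : nat -> T -> R) (n : nat) (w : T) : \bar R :=
  match tau X w n.-1, tau X w n with
  | Some a, Some b => ((b - a)%N%:R)%:E
  | _, _ => +oo%E
  end.

Definition excursion (X : nat -> T -> R) (n : nat) (w : T) : seq R :=
  match tau X w n.-1, tau X w n with
  | Some a, Some b => [seq X t w | t <- iota a (b - a)]
  | _, _ => [::]
  end.

Definition N_infinite (X : nat -> T -> R) : set T :=
  [set w | forall n, tau X w n <> None].

(** N_t = max{n in N : tau_n <= t}  (sup of the empty set is -oo) *)
Definition Ncount (X : nat -> T -> R) (t : nat) (w : T) : \bar R :=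
  ereal_sup [set (n%:R)%:E | n in
     [set n : nat | (1 <= n)%N /\ exists k, tau X w n = Some k /\ (k <= t)%N]].

(** Z is a version of the conditional expectation E[Y | G] of a
    nonnegative (extended) random variable Y (defining property). *)
Definition cexp_version (mu : {measure set T -> \bar R}) (G : set (set T))
    (Y Z : T -> \bar R) : Prop :=
  [/\ (forall B : set (\bar R), measurable B -> G (Z @^-1` B)),
      (forall w, (0 <= Z w)%E) &
      (forall A, G A -> (\int[mu]_(w in A) Y w = \int[mu]_(w in A) Z w)%E)].

Definition Delta (X : nat -> T -> R) (t : nat) (w : T) : R := X t.+1 w - X t w.

Definition A0 (mu : probability T R) (S : set R) (X : nat -> T -> R)
    (F : nat -> set (set T)) : Prop :=
  [/\ (forall M : R, finite_set (S `&` [set x | `|x| <= M])),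
      (forall M : R, exists2 x, S x & M < x),
      (forall x, S x -> 0 <= x) & S 0] /\
  [/\ (forall t, (1 <= t)%N -> sigma_algebra setT (F t) /\ F t `<=` measurable),
      (forall s t, (1 <= s)%N -> (s <= t)%N -> F s `<=` F t),
      (forall t w, (1 <= t)%N -> S (X t w)),
      (forall t (B : set R), (1 <= t)%N -> measurable B -> F t (X t @^-1` B)) &
      mu [set w | X 1%N w = 0] = 1%E].

Definition A1 (mu : probability T R) (S : set R) (X : nat -> T -> R)
    (F : nat -> set (set T)) : Prop :=
  exists (m : R -> R -> nat) (phi : R -> R -> R),
    (forall x y, S x -> S y -> (1 <= m x y)%N /\ 0 < phi x y) /\
    (forall y t, S y -> (1 <= t)%N ->
       exists Z, cexp_version mu (F t)
           (fun w => ((X (t + m (X t w) y)%N w == y)%:R)%:E) Z /\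
         {ae mu, forall w, ((phi (X t w) y)%:E <= Z w)%E}).

(** (A2) with constants c and s2; E[Delta|F] = E[Delta^+|F] - E[Delta^-|F] *)
Definition A2 (mu : probability T R) (X : nat -> T -> R)
    (F : nat -> set (set T)) (c s2 : R) : Prop :=
  0 < s2 /\
  (exists Zp Zn : nat -> T -> \bar R,
    (forall t, (1 <= t)%N ->
       cexp_version mu (F t) (fun w => (Num.max (Delta X t w) 0)%:E) (Zp t) /\
       cexp_version mu (F t) (fun w => (Num.max (- Delta X t w) 0)%:E) (Zn t)) /\
    (forall delta : R, 0 < delta -> exists x0 : R, forall t, (1 <= t)%N ->
       {ae mu, forall w, x0 <= X t w ->
          [/\ Zp t w \is a fin_num, Zn t w \is a fin_num &
            `|fine (Zp t w) - fine (Zn t w) - c / X t w|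
               <= delta / (X t w * ln (X t w))]})) /\
  (exists Z2 : nat -> T -> \bar R,
    (forall t, (1 <= t)%N ->
       cexp_version mu (F t) (fun w => (Delta X t w ^+ 2)%:E) (Z2 t)) /\
    (forall delta : R, 0 < delta -> exists x0 : R, forall t, (1 <= t)%N ->
       {ae mu, forall w, x0 <= X t w ->
          Z2 t w \is a fin_num /\
          `|fine (Z2 t w) - s2| <= delta / ln (X t w)})).

Definition A3 (mu : probability T R) (X : nat -> T -> R) : Prop :=
  let O := N_infinite X in
  (* (a) on {N = oo}, the excursions (E_n)_{n>=1} are i.i.d. *)
  ((forall n (B : set (seq R)), (1 <= n)%N ->
      measurable (excursion X n @^-1` B) -> measurable (excursion X 1 @^-1` B) ->
      mu (O `&` excursion X n @^-1` B) = mu (O `&` excursion X 1 @^-1` B)) /\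
   (forall (k : nat) (B : nat -> set (seq R)),
      (forall i, measurable (excursion X i.+1 @^-1` B i)) ->
      (mu (O `&` \bigcap_(i in `I_k) (excursion X i.+1 @^-1` B i))
         * \prod_(i < k) mu O
       = mu O * \prod_(i < k) mu (O `&` excursion X i.+1 @^-1` B i))%E)) /\
  (* (b) P[eta_{n+1} < oo | tau_n < oo] = P[eta_1 < oo] *)
  (forall n : nat,
     (mu ([set w | (eta_n X n.+1 w < +oo)%E] `&` [set w | tau X w n <> None])
      = mu [set w | (eta_n X 1 w < +oo)%E] * mu [set w | tau X w n <> None])%E).

Definition Mp (mu : probability T R) (X : nat -> T -> R)
    (F : nat -> set (set T)) (p : R) : Prop :=
  exists (delta C : R) (Z : nat -> T -> \bar R), 0 < delta /\
    forall t, (1 <= t)%N ->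
      cexp_version mu (F t) (fun w => (`|Delta X t w| `^ p)%:E) (Z t) /\
      {ae mu, forall w, (Z t w <= (C * (1 + X t w) `^ (p - 2 - delta))%:E)%E}.

End Defs.

(* Main.v *)
Require Import Defs.
From HB Require Import structures.
From mathcomp Require Import all_boot all_order all_algebra.
From mathcomp Require Import all_classical all_reals all_analysis.
From mathcomp Require Import measurable_realfun.
From mathcomp Require Import ring lra zify.
Set Implicit Arguments.
Unset Strict Implicit.
Unset Printing Implicit Defensive.
Import Order.TTheory GRing.Theory Num.Theory.
Import numFieldNormedType.Exports.
Local Open Scope classical_set_scope.
Local Open Scope ring_scope.

(** Let [g = 1 + r].  The function [x^g] is nearly harmonic for the process: by a
second-order Taylor expansion, with (M_p) controlling the large jumps, [x^g / log x]
is a supermartingale and [x^g log x] a submartingale away from a bounded set, and the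
time spent in a bounded set during one excursion has finite mean by (A1).  When
[g <= 2], stopping the supermartingale bounds the probability that an excursion
exceeds [y] by [y^-g log y] and the mean time spent before exceeding [y] by
[y^(2-g) log^2 y].  Stopping the submartingale shows that an excursion reaches [y]
with probability at least of order [1 / (y^g log y)], and from there a quadratic
function shows that it needs time of order [y^2] to come back, so that an excursion
lasts longer than [n] with probability at least of order [n^(-g/2) / log n].  Since
excursions are i.i.d., Borel-Cantelli along dyadic times gives both bounds of (i).
When [g > 2], [x^2] has negative drift, so excursions have finite mean length and (ii)
follows from Etemadi's proof of the strong law of large numbers, by inverting
[n |-> tau_n]. *)

Section SigmaAlgebra.
Context {T : Type} (G : set (set T)).
Hypothesis sG : sigma_algebra setT G.

Lemma sigma_algebraC A : G A -> G (~` A).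
Proof. by case: sG => _ h _ /h; rewrite setTD. Qed.

Lemma sigma_algebraT : G setT.
Proof. by case: sG => g0 _ _; rewrite -setC0; apply: sigma_algebraC. Qed.

Lemma sigma_algebra_capn (A : nat -> set T) :
  (forall n, G (A n)) -> G (\bigcap_n A n).
Proof.
move=> GA; rewrite -[X in G X]setCK setC_bigcap.
apply: sigma_algebraC; case: sG => _ _; apply => n.
exact: sigma_algebraC.
Qed.

Lemma sigma_algebraI A B : G A -> G B -> G (A `&` B).
Proof.
move=> GA GB; suff -> : A `&` B = \bigcap_n (if n is 0%N then A else B).
  by apply: sigma_algebra_capn => -[|n].
apply/seteqP; split => w; first by move=> [Aw Bw] -[|n] _.
by move=> h; split; [exact: (h 0%N) | exact: (h 1%N)].
Qed.

End SigmaAlgebra.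

Section Probability.
Context {R : realType} {d : measure_display} {T : measurableType d}.
Variable mu : probability T R.

Definition pr (A : set T) : R := fine (mu A).

Lemma mu_fin A : measurable A -> mu A \is a fin_num.
Proof. exact: fin_num_measure. Qed.

Lemma prE A : measurable A -> mu A = (pr A)%:E.
Proof. by move=> mA; rewrite /pr fineK // mu_fin. Qed.

Lemma integral_cstE A (k : R) : measurable A ->
  (\int[mu]_(w in A) k%:E = (k * pr A)%:E)%E.
Proof.
move=> mA; have := integral_cst mu mA k%:E; rewrite /cst => ->.
by rewrite EFinM; congr (_ * _)%E; exact: prE.
Qed.

Lemma pr_ge0 A : 0 <= pr A.
Proof. by rewrite /pr fine_ge0. Qed.

Lemma pr_le1 A : measurable A -> pr A <= 1.
Proof. by move=> mA; rewrite -lee_fin -prE // probability_le1. Qed.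

Lemma le_pr A B : measurable A -> measurable B -> A `<=` B -> pr A <= pr B.
Proof.
by move=> mA mB AB; rewrite -lee_fin -!prE //; apply: le_measure; rewrite ?inE.
Qed.

Lemma prD A B : measurable A -> measurable B -> B `<=` A ->
  pr (A `\` B) = pr A - pr B.
Proof.
move=> mA mB BA; apply: EFin_inj; rewrite EFinB -!prE //; last exact: measurableD.
by rewrite measureD ?setIidr// -ge0_fin_numE// mu_fin.
Qed.

Lemma prT : pr setT = 1.
Proof. by rewrite /pr probability_setT. Qed.

Lemma prC A : measurable A -> pr (~` A) = 1 - pr A.
Proof. by move=> mA; rewrite -setTD prD ?prT. Qed.

Lemma prU_le A B : measurable A -> measurable B -> pr (A `|` B) <= pr A + pr B.
Proof.
move=> mA mB; rewrite -lee_fin EFinD -!prE //; last exact: measurableU.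
exact: measureU2.
Qed.

Lemma pr_bigcup_lt_le (A : nat -> set T) n : (forall i, measurable (A i)) ->
  pr (\bigcup_(i in `I_n) A i) <= \sum_(i < n) pr (A i).
Proof.
move=> mA; elim: n => [|n IH].
  by rewrite II0 bigcup_set0 big_ord0 /pr measure0.
have mU m : measurable (\bigcup_(i in `I_m) A i).
  by apply: bigcup_measurable => i _.
have -> : `I_n.+1 = `I_n `|` [set n].
  apply/seteqP; split => i /=.
    by rewrite ltnS leq_eqVlt => /orP[/eqP|]; [right|left].
  by case=> [/leqW//|->].
rewrite bigcup_setU bigcup_set1 big_ord_recr /=.
by apply: (le_trans (prU_le _ _)) => //; rewrite lerD2r.
Qed.

Lemma pr_sum_disjoint_le (A : nat -> set T) (B : set T) n :
  (forall i, measurable (A i)) -> measurable B ->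
  (forall i, A i `<=` B) -> (forall i j w, A i w -> A j w -> i = j) ->
  \sum_(i < n) pr (A i) <= pr B.
Proof.
move=> mA mB AB dA.
have mU m : measurable (\bigcup_(i in `I_m) A i).
  by apply: bigcup_measurable => i _.
apply: (@le_trans _ _ (pr (\bigcup_(i in `I_n) A i))); last first.
  by apply: le_pr => // w [i _]; apply: AB.
elim: n => [|n IH]; first by rewrite big_ord0 pr_ge0.
rewrite big_ord_recr /= -lerBrDr (le_trans IH) //.
rewrite lerBrDr -lerBrDl -prD //; last first.
  by move=> w [i /= ltin Aiw]; exists i => //=; apply: leqW.
apply: le_pr => //; first exact: measurableD.
move=> w Anw; split; first by exists n => /=.
by move=> [i /= ltin Aiw]; have := dA _ _ _ Anw Aiw; lia.
Qed.

Lemma ae_pr1 A : measurable A -> pr A = 1 -> {ae mu, forall w, A w}.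
Proof.
move=> mA pA; exists (~` A); split => //; first exact: measurableC.
by rewrite prE ?prC ?pA ?subrr //; apply: measurableC.
Qed.

Lemma pr_ae_le A B : measurable A -> measurable B ->
  {ae mu, forall w, A w -> B w} -> pr A <= pr B.
Proof.
move=> mA mB [N [mN N0 hN]].
have pN : pr N = 0 by rewrite /pr N0.
apply: (@le_trans _ _ (pr (B `|` N))).
  apply: le_pr => //; first exact: measurableU.
  move=> w Aw; case: (pselect (B w)) => Bw; [by left|right].
  by apply: hN => /= h; apply: Bw; apply: h.
by apply: (le_trans (prU_le _ _)) => //; rewrite pN addr0.
Qed.

Lemma borel_cantelli_bound (A : nat -> set T) (K : R) :
  (forall n, measurable (A n)) ->
  (forall n, \sum_(k < n) pr (A k) <= K) ->
  {ae mu, forall w, exists n0, forall n, (n0 <= n)%N -> ~ A n w}.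
Proof.
move=> mA hK; exists (lim_sup_set A); split.
- apply: bigcapT_measurable => n; apply: bigcup_measurable => k _; exact: mA.
- apply: lim_sup_set_cvg0 => //.
  apply: (@le_lt_trans _ _ K%:E); last exact: ltry.
  apply: lime_le; first exact: is_cvg_ereal_nneg_natsum.
  apply: nearW => n; rewrite big_mkord.
  rewrite (eq_bigr (fun k : 'I_n => (pr (A k))%:E)) ?sumEFin ?lee_fin ?hK //.
  by move=> k _; exact: prE.
- move=> w /= h n _ /=; apply: contrapT => h2; apply: h; exists n => m nm Am.
  by apply: h2; exists m.
Qed.

End Probability.

Section ErealArithmetic.
Context {R : realType}.
Local Open Scope ereal_scope.

Lemma super_step (a' a s sg g h a0 sh : \bar R) :
  a' + g <= a + h -> a + s + sg <= a0 + sh -> a' + s + (sg + g) <= a0 + (sh + h).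
Proof.
move=> h1 h2; rewrite [sg + g]addeC addeACA (addeA a0).
apply: le_trans (leeD h2 (lexx h)).
by rewrite -(addeA a) [leRHS]addeAC; apply: leeD.
Qed.

Lemma sub_step (a' a s g a0 sg : \bar R) :
  a + g <= a' -> a0 + sg <= a + s -> a0 + (sg + g) <= a' + s.
Proof.
move=> h1 h2; rewrite addeA; apply: (le_trans (leeD h2 (lexx g))).
by rewrite addeAC; apply: leeD.
Qed.

End ErealArithmetic.

(** * Stopped processes and occupation times *)

Section Process.
Context {R : realType} {d : measure_display} {T : measurableType d}.
Variables (mu : probability T R) (S : set R) (X : nat -> T -> R)
  (F : nat -> set (set T)).
Hypothesis hA0 : A0 mu S X F.

Lemma locally_finite_countable : countable S.
Proof.
case: hA0 => -[fS _ _ _] _.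
have -> : S = \bigcup_n (S `&` [set x | `|x| <= n%:R]).
  apply/seteqP; split => [x Sx|x [n _ []]//].
  exists (Num.bound `|x|) => //; split => //=.
  by rewrite ltW // archi_boundP.
by apply: bigcup_countable => // n _; apply: finite_set_countable.
Qed.

Lemma state_in t w : (1 <= t)%N -> S (X t w).
Proof. by case: hA0 => _ [_ _ + _ _]; apply. Qed.

Lemma state_ge0 t w : (1 <= t)%N -> 0 <= X t w.
Proof. by move=> t1; case: hA0 => -[_ _ + _] _; apply; apply: state_in. Qed.

Lemma filtration_sigma t : (1 <= t)%N -> sigma_algebra setT (F t).
Proof. by case: hA0 => _ [+ _ _ _ _] => /[apply] -[]. Qed.

Lemma filtration_measurable t A : (1 <= t)%N -> F t A -> measurable A.
Proof. by case: hA0 => _ [+ _ _ _ _] => /[apply] -[_]; apply. Qed.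

Lemma filtration_mono s t A : (1 <= s)%N -> (s <= t)%N -> F s A -> F t A.
Proof. by case: hA0 => _ [_ + _ _ _] s1 st; apply. Qed.

(* The state space is countable, so no measurability condition is needed. *)
Lemma adapted_any t (B : set R) : (1 <= t)%N -> F t (X t @^-1` B).
Proof.
move=> t1; have -> : X t @^-1` B = X t @^-1` (B `&` S).
  apply/seteqP; split => w /=; last by case.
  by move=> ?; split => //; apply: state_in.
case: hA0 => _ [_ _ _ + _]; apply => //.
apply: countable_measurable => //; apply: sub_countable locally_finite_countable.
by apply: subset_card_le; apply: subIsetr.
Qed.

Lemma measurable_state_fun t d' (U : measurableType d') (g : R -> U) :
  (1 <= t)%N -> measurable_fun setT (g \o X t).
Proof.
move=> t1 _ B mB; rewrite setTI comp_preimage.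
exact: filtration_measurable (adapted_any _ t1).
Qed.

Lemma atom_integral_le t (A : set T) (G H : T -> \bar R) : (1 <= t)%N -> F t A ->
  measurable_fun A G -> measurable_fun A H ->
  (forall w, (0 <= G w)%E) -> (forall w, (0 <= H w)%E) ->
  (forall x, S x -> (\int[mu]_(w in A `&` X t @^-1` [set x]) G w <=
                     \int[mu]_(w in A `&` X t @^-1` [set x]) H w)%E) ->
  (\int[mu]_(w in A) G w <= \int[mu]_(w in A) H w)%E.
Proof.
move=> t1 FA mG mH G0 H0 le_at.
have [iota iota_inj] := elimT (countable_injP _) locally_finite_countable.
pose E n := A `&` X t @^-1` (iota @^-1` [set n]).
have EU : A = \bigcup_n E n.
  by apply/seteqP; split => [w Aw|w [n _ []]//]; exists (iota (X t w)).
have mE n : measurable (E n).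
  apply: measurableI; first exact: filtration_measurable FA.
  exact: filtration_measurable (adapted_any _ t1).
have tE : trivIset setT E.
  by move=> i j _ _ [w [[_ /= <-] [_ /= <-]]].
rewrite EU !ge0_integral_bigcup //; last 2 first.
- by rewrite -EU.
- by rewrite -EU.
apply: lee_nneseries => [n _ _|n _]; first exact: integral_ge0.
have [[x [Sx xn]]|nx] := pselect (exists x, S x /\ iota x = n).
  suff -> : E n = A `&` X t @^-1` [set x] by apply: le_at.
  apply/seteqP; split => w [Aw] /= h; split => //=; last by rewrite h.
  by apply: iota_inj; rewrite ?inE //; [apply: state_in|rewrite h xn].
suff -> : E n = set0 by rewrite !integral_set0.
rewrite -subset0 => w [_ /= h]; apply: nx; exists (X t w); split => //.
exact: state_in.
Qed.

Lemma integral_shrink t (V W : set T) (f : R -> R) : (1 <= t)%N ->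
  measurable V -> measurable W -> W `<=` V -> (forall x, 0 <= f x) ->
  (\int[mu]_(w in V) (f (X t w))%:E = \int[mu]_(w in W) (f (X t w))%:E +
     \int[mu]_(w in V `\` W) (f (X t w))%:E)%E.
Proof.
move=> t1 mV mW WV f0; rewrite -ge0_integral_setU //.
- by rewrite setDUK.
- exact: measurableD.
- apply: (@measurable_funTS _ _ _ _ _ (EFin \o f \o X t)).
  exact: (measurable_state_fun (EFin \o f)).
- by move=> w _; rewrite lee_fin.
- by apply/disj_setPS => w [Ww [_]].
Qed.

Section Lyapunov.
Variables (t0 : nat) (V : nat -> set T) (f : R -> R).
Hypotheses (t01 : (1 <= t0)%N) (FV : forall t, (t0 <= t)%N -> F t (V t))
  (VS : forall t, (t0 <= t)%N -> V t.+1 `<=` V t) (f0 : forall x, 0 <= f x).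

Let mV t : (t0 <= t)%N -> measurable (V t).
Proof. by move=> tt0; apply: filtration_measurable (FV tt0); lia. Qed.

(* The two sides of Dynkin's formula for the process stopped on leaving V. *)
Definition stopped_mean n : \bar R :=
  (\int[mu]_(w in V (t0 + n)%N) (f (X (t0 + n)%N w))%:E +
   \sum_(i < n) \int[mu]_(w in V (t0 + i)%N `\` V (t0 + i).+1)
      (f (X (t0 + i).+1 w))%:E)%E.

Lemma stopped_meanS n : stopped_mean n.+1 =
  (\int[mu]_(w in V (t0 + n)%N) (f (X (t0 + n).+1 w))%:E +
   \sum_(i < n) \int[mu]_(w in V (t0 + i)%N `\` V (t0 + i).+1)
      (f (X (t0 + i).+1 w))%:E)%E.
Proof.
rewrite /stopped_mean big_ord_recr /= addnS.
rewrite (@integral_shrink (t0 + n).+1 (V (t0 + n)%N) (V (t0 + n).+1)) //.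
- by rewrite -[RHS]addeA; congr adde; exact: addeC.
- by apply: mV; lia.
- by apply: mV; lia.
- by apply: VS; lia.
Qed.

Lemma stopped_mean_super (g h : nat -> \bar R) n :
  (forall i, (\int[mu]_(w in V (t0 + i)%N) (f (X (t0 + i).+1 w))%:E + g i
      <= \int[mu]_(w in V (t0 + i)%N) (f (X (t0 + i)%N w))%:E + h i)%E) ->
  (stopped_mean n + \sum_(i < n) g i
   <= \int[mu]_(w in V t0) (f (X t0 w))%:E + \sum_(i < n) h i)%E.
Proof.
move=> hd; elim: n => [|n IH].
  by rewrite /stopped_mean !big_ord0 !adde0 addn0.
rewrite stopped_meanS !big_ord_recr /=.
exact: super_step (hd n) IH.
Qed.

Lemma stopped_mean_sub (g : nat -> \bar R) n :
  (forall i, (\int[mu]_(w in V (t0 + i)%N) (f (X (t0 + i)%N w))%:E + g i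
      <= \int[mu]_(w in V (t0 + i)%N) (f (X (t0 + i).+1 w))%:E)%E) ->
  (\int[mu]_(w in V t0) (f (X t0 w))%:E + \sum_(i < n) g i
   <= stopped_mean n)%E.
Proof.
move=> hd; elim: n => [|n IH].
  by rewrite /stopped_mean !big_ord0 !adde0 addn0.
rewrite stopped_meanS big_ord_recr /=.
exact: sub_step (hd n) IH.
Qed.

End Lyapunov.

Definition alive (t : nat) : set T :=
  [set w | forall s, (2 <= s <= t)%N -> X s w <> 0].

Lemma filtration_stay t0 t (Q : nat -> set R) : (1 <= t0)%N -> (1 <= t)%N ->
  F t [set w | forall s, (t0 <= s <= t)%N -> Q s (X s w)].
Proof.
move=> t01 t1.
pose B n := if (t0 <= n <= t)%N then X n @^-1` Q n else setT.
have -> : [set w | forall s, (t0 <= s <= t)%N -> Q s (X s w)] = \bigcap_n B n.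
  apply/seteqP; split => w h s.
    by move=> _; rewrite /B; case: ifP => // /h.
  by move=> hs; have := h s I; rewrite /B hs.
apply: sigma_algebra_capn => [|n]; first exact: filtration_sigma.
rewrite /B; case: ifP => [/andP[n0 nt]|_]; last first.
  by apply: sigma_algebraT; apply: filtration_sigma.
by apply: (@filtration_mono n) => //; [lia|apply: adapted_any; lia].
Qed.

Lemma filtration_alive t : (1 <= t)%N -> F t (alive t).
Proof. exact: (@filtration_stay 2 t (fun _ => [set x | x <> 0])). Qed.

Lemma measurable_alive t : measurable (alive t).
Proof.
case: t => [|t]; last by apply: filtration_measurable (filtration_alive _).
have -> : alive 0 = setT; last exact: measurableT.
by apply/seteqP; split => // w _ s; lia.
Qed.

Lemma alive_le s t : (s <= t)%N -> alive t `<=` alive s.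
Proof. by move=> st w h q hq; apply: h; lia. Qed.

Lemma cexp_measurable t A (Y Z : T -> \bar R) : (1 <= t)%N -> F t A ->
  cexp_version mu (F t) Y Z -> measurable_fun A Z.
Proof.
move=> t1 FA [mZ _ _] _ B mB; apply: measurableI.
  exact: filtration_measurable FA.
exact: filtration_measurable (mZ _ mB).
Qed.

Lemma cexp_ub t A (Y Z : T -> \bar R) (k : R) : (1 <= t)%N -> F t A -> 0 <= k ->
  cexp_version mu (F t) Y Z -> {ae mu, forall w, A w -> (Z w <= k%:E)%E} ->
  (\int[mu]_(w in A) Y w <= (k * pr mu A)%:E)%E.
Proof.
move=> t1 FA k0 cY le_Zk; have mA := filtration_measurable t1 FA.
have mZ := cexp_measurable t1 FA cY.
case: cY => _ Z0 ->//; rewrite -integral_cstE //.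
by apply: ae_ge0_le_integral => // w _; rewrite lee_fin.
Qed.

Lemma cexp_lb t A (Y Z : T -> \bar R) (k : R) : (1 <= t)%N -> F t A -> 0 <= k ->
  cexp_version mu (F t) Y Z -> {ae mu, forall w, A w -> (k%:E <= Z w)%E} ->
  ((k * pr mu A)%:E <= \int[mu]_(w in A) Y w)%E.
Proof.
move=> t1 FA k0 cY le_Zk; have mA := filtration_measurable t1 FA.
have mZ := cexp_measurable t1 FA cY.
case: cY => _ Z0 ->//; rewrite -integral_cstE //.
by apply: ae_ge0_le_integral => // w _; rewrite lee_fin.
Qed.

Lemma integral_indicator (A : set T) (P : T -> bool) : measurable A ->
  measurable [set w | P w] ->
  (\int[mu]_(w in A) ((P w)%:R : R)%:E = (pr mu (A `&` [set w | P w]))%:E)%E.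
Proof.
move=> mA mP; rewrite -prE; last exact: measurableI.
rewrite setIC -integral_indic //; apply: eq_integral => w _.
by rewrite indicE mem_setE.
Qed.

Lemma atom_pr_le t (A B C : set T) (e : R) : (1 <= t)%N -> F t A -> 0 <= e ->
  measurable B -> measurable C ->
  (forall x, S x -> e * pr mu (A `&` X t @^-1` [set x] `&` B) <=
                    pr mu (A `&` X t @^-1` [set x] `&` C)) ->
  e * pr mu (A `&` B) <= pr mu (A `&` C).
Proof.
move=> t1 FA e0 mB mC h; have mA := filtration_measurable t1 FA.
have eint D E : measurable D -> measurable E ->
  ((pr mu (D `&` E))%:E = \int[mu]_(w in D) (\1_E w)%:E)%E.
  by move=> mD mE; rewrite -prE; [rewrite integral_indic // setIC|exact: measurableI].
have mind (D E : set T) : measurable E -> measurable_fun D (fun w => (\1_E w : R)%:E).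
  move=> mE; apply: (@measurable_funTS _ _ _ _ _ (EFin \o \1_E)).
  by apply/measurable_EFinP; apply: measurable_indic.
have eintZ D E : measurable D -> measurable E ->
  ((e * pr mu (D `&` E))%:E = \int[mu]_(w in D) (e%:E * (\1_E w)%:E))%E.
  move=> mD mE; rewrite EFinM eint // ge0_integralZl //.
  exact: mind.
rewrite -lee_fin eintZ // eint //; apply: (@atom_integral_le t) => //.
- by apply: measurable_funeM; apply: mind.
- exact: mind.
- by move=> w; rewrite mule_ge0 //.
- move=> x Sx.
  have mAx : measurable (A `&` X t @^-1` [set x]).
    by apply: measurableI => //; apply: filtration_measurable (adapted_any _ t1).
  by rewrite -eintZ // -eint // lee_fin h.
Qed.

Lemma A1_atom : A1 mu S X F -> exists (m : R -> R -> nat) (phi : R -> R -> R),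
  (forall x y, S x -> S y -> (1 <= m x y)%N /\ 0 < phi x y) /\
  forall x y t A, S x -> S y -> (1 <= t)%N -> F t A ->
   A `<=` X t @^-1` [set x] ->
   phi x y * pr mu A <= pr mu (A `&` X (t + m x y)%N @^-1` [set y]).
Proof.
move=> [m [phi [mphi h]]]; exists m, phi; split=> //.
move=> x y t A Sx Sy t1 FA AX; have mA := filtration_measurable t1 FA.
have [m1 phi0] := mphi x y Sx Sy.
have [Z [cZ leZ]] := h y t Sy t1.
have := cexp_lb (k := phi x y) t1 FA (ltW phi0) cZ.
rewrite -lee_fin => /(_ _)/le_trans; apply.
  by apply: filterS leZ => w /[swap] Aw; rewrite (AX _ Aw).
have <- : [set w | X (t + m x y)%N w == y] = X (t + m x y)%N @^-1` [set y].
  by apply/seteqP; split => w /= /eqP.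
rewrite -integral_indicator //.
  rewrite le_eqVlt; apply/orP; left; apply/eqP.
  by apply: eq_integral => w; rewrite inE => /AX ->.
rewrite (_ : [set w | _] = X (t + m x y)%N @^-1` [set y]); last first.
  by apply/seteqP; split => w /= /eqP.
by apply: filtration_measurable (adapted_any _ _); lia.
Qed.

Lemma finite_pos_lb (A : set R) (g : R -> R) : finite_set A ->
  (forall x, A x -> 0 < g x) -> exists e : R, 0 < e /\ forall x, A x -> e <= g x.
Proof.
move=> /finite_seqP[s ->]; elim: s => [|a s IH] h; first by exists 1.
have [x xs|e [e0 he]] := IH; first by apply: h; rewrite /= inE xs orbT.
exists (Num.min e (g a)); split => [|x].
  by rewrite lt_min e0 h //= mem_head.
rewrite /= inE => /orP[/eqP ->|xs]; first by rewrite ge_min lexx orbT.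
by rewrite ge_min he.
Qed.

Lemma finite_nat_ub (A : set R) (g : R -> nat) : finite_set A ->
  exists m, forall x, A x -> (g x <= m)%N.
Proof.
move=> /finite_seqP[s ->]; elim: s => [|a s [m hm]]; first by exists 0%N.
exists (maxn m (g a)) => x; rewrite /= inE => /orP[/eqP ->|xs].
  exact: leq_maxr.
by rewrite leq_max hm.
Qed.

(* Each visit to the finite set leads to 0 within m steps with probability at
   least e, and P(alive t) - P(alive (t + m)) telescopes. *)
Lemma occupation_bound (hA1 : A1 mu S X F) (x0 : R) : exists K : R, forall n,
  \sum_(i < n) pr mu (alive i.+1 `&` X i.+1 @^-1` [set x | x < x0]) <= K.
Proof.
have [m [phi [mphi h]]] := A1_atom hA1.
case: (hA0) => -[Sfin _ Sge0 S0] _.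
pose B := S `&` [set x | x < x0].
have fB : finite_set B.
  apply: sub_finite_set (Sfin x0) => x [Sx xx0].
  by split => //=; rewrite ger0_norm ?Sge0 // ltW.
have [e [e0 he]] : exists e : R, 0 < e /\ forall x, B x -> e <= phi x 0.
  by apply: finite_pos_lb => // x [Sx _]; case: (mphi x 0 Sx S0).
have [M hM] := finite_nat_ub (m^~ 0) fB.
have step t : (1 <= t)%N -> e * pr mu (alive t `&` X t @^-1` [set x | x < x0])
    <= pr mu (alive t) - pr mu (alive (t + M)%N).
  move=> t1; have FA := filtration_alive t1.
  have mA := @measurable_alive.
  have mX s C : (1 <= s)%N -> measurable (X s @^-1` C).
    by move=> s1; apply: filtration_measurable (adapted_any _ s1).
  rewrite -prD; [|exact: mA..|by apply: alive_le; lia].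
  rewrite setDE; apply: (@atom_pr_le t) => //.
  - exact: ltW.
  - exact: mX.
  - exact/measurableC.
  move=> x Sx.
  have [xx0|xx0] := ltP x x0; last first.
    rewrite (_ : _ `&` _ `&` _ = set0); last first.
      by rewrite -subset0 => w [[_ /= ->] /=]; rewrite ltNge xx0.
    by rewrite {1}/pr measure0 mulr0 pr_ge0.
  have FAx : F t (alive t `&` X t @^-1` [set x]).
    by apply: sigma_algebraI => //; [exact: filtration_sigma|exact: adapted_any].
  have := h x 0 t _ Sx S0 t1 FAx (@subIsetr _ _ _).
  have [m1 phi0] := mphi x 0 Sx S0.
  have mx : (m x 0%R <= M)%N by apply: hM.
  move=> hx; apply: (@le_trans _ _ (phi x 0 * pr mu (alive t `&` X t @^-1` [set x]))).
    apply: ler_pM; rewrite ?pr_ge0 ?(ltW e0) ?he //; apply: le_pr.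
    - by apply: measurableI; [apply: measurableI => //|]; exact: mX.
    - by apply: measurableI => //; exact: mX.
    - exact: subIsetl.
  apply: (le_trans hx); apply: le_pr.
  - by apply: measurableI; [apply: measurableI => //|]; apply: mX; lia.
  - by apply: measurableI; [apply: measurableI => //; exact: mX|exact/measurableC].
  - move=> w [h1 /= h2]; split => // al; apply: (al (t + m x 0%R)%N) h2; lia.
pose a t := pr mu (alive t.+1).
have tele n k : \sum_(i < n) (a i - a (i + k)%N) <= k%:R.
  elim: k => [|k IH]; first by rewrite big1 // => i _; rewrite addn0 subrr.
  rewrite (eq_bigr (fun i : 'I_n =>
    (a i - a (i + k)%N) + (a (i + k)%N - a (i + k.+1)%N))); last first.
    by move=> i _; rewrite addrA subrK.
  rewrite big_split /= -natr1 lerD //.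
  have -> : \sum_(i < n) (a (i + k)%N - a (i + k.+1)%N) = a k - a (n + k)%N.
    elim: n {IH} => [|n IH]; first by rewrite big_ord0 add0n subrr.
    by rewrite big_ord_recr /= IH addnS addSn addrA subrK.
  have : a k <= 1 by apply: pr_le1; exact: measurable_alive.
  have : 0 <= a (n + k)%N by apply: pr_ge0.
  lra.
exists (M%:R / e) => n; rewrite ler_pdivlMr // mulrC mulr_sumr.
by apply: le_trans (tele n M); apply: ler_sum => i _; apply: step.
Qed.

End Process.

Section RealPowers.
Context {R : realType}.

Lemma powR_add (x a b : R) : 0 < x -> x `^ (a + b) = x `^ a * x `^ b.
Proof. by move=> x0; rewrite powRD //; apply/implyP => _; rewrite gt_eqF. Qed.

Lemma maxr_posneg (k : R) : Num.max k 0 - Num.max (- k) 0 = k.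
Proof. by rewrite /Num.max; do 2!case: ifP; lra. Qed.

Lemma powR_neg (x a : R) : 0 < x -> x `^ (- a) * x `^ a = 1.
Proof. by move=> x0; rewrite -powR_add // addNr powRr0. Qed.

Lemma expR_ge_pow (x : R) n : 0 <= x -> (x / n.+1%:R) ^+ n.+1 <= expR x.
Proof.
move=> x0; have -> : expR x = expR (x / n.+1%:R) ^+ n.+1.
  by rewrite -expRM_natl mulrCA divff ?mulr1 // pnatr_eq0.
apply: lerXn2r; rewrite ?nnegrE ?expR_ge0 ?divr_ge0 //.
by apply: le_trans (expR_ge1Dx _); rewrite lerDr.
Qed.

Lemma ln_powR_small (a b e : R) : 0 < b -> 0 < e ->
  exists x0 : R, forall x, x0 <= x -> ln x `^ a <= e * x `^ b.
Proof.
move=> b0 e0; pose n := Num.bound `|a|.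
pose K := e * (b / n.+1%:R) ^+ n.+1.
have K0 : 0 < K by rewrite mulr_gt0 // exprn_gt0 // divr_gt0.
exists (expR (1 + K^-1)) => x hx.
have x0 : 0 < x by apply: lt_le_trans hx; apply: expR_gt0.
have hu : 1 + K^-1 <= ln x by rewrite -ler_expR lnK.
set u := ln x in hu *.
have Kinv : 0 < K^-1 by rewrite invr_gt0.
have u1 : 1 <= u by lra.
have hb : (b / n.+1%:R) ^+ n.+1 * u ^+ n.+1 <= x `^ b.
  rewrite -exprMn (_ : b / n.+1%:R * u = (b * u) / n.+1%:R); last by rewrite mulrAC.
  rewrite /powR gt_eqF // -/u; apply: expR_ge_pow; apply: mulr_ge0; lra.
apply: (@le_trans _ _ (u ^+ n)).
  rewrite -powR_mulrn; last lra.
  apply: ler_powR => //; apply: (le_trans (ler_norm _)).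
  by rewrite ltW // archi_boundP.
apply: le_trans (ler_wpM2l (ltW e0) hb).
rewrite mulrA -/K exprS mulrA -[leLHS]mul1r ler_wpM2r //; first by apply: exprn_ge0; lra.
rewrite -(mulfV (lt0r_neq0 K0)) ler_wpM2l //; lra.
Qed.

End RealPowers.

(** * Moments of the increments *)

Section Moments.
Context {R : realType} {d : measure_display} {T : measurableType d}.
Variables (mu : probability T R) (S : set R) (X : nat -> T -> R)
  (F : nat -> set (set T)).
Hypothesis hA0 : A0 mu S X F.
Implicit Types (t : nat) (A : set T).

Lemma measurable_Delta t : (1 <= t)%N -> measurable_fun setT (Delta X t).
Proof.
by move=> t1; apply: measurable_funB; apply: (measurable_state_fun hA0 id); lia.
Qed.

Lemma measurable_Delta_comp t (g : R -> R) A : (1 <= t)%N -> measurable_fun setT g ->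
  measurable_fun A (fun w => (g (Delta X t w))%:E).
Proof.
move=> t1 mg; apply: measurableT_comp => //; apply: measurable_funTS.
by apply: measurableT_comp mg _; apply: measurable_Delta.
Qed.

Lemma measurable_norm_powR (p : R) : measurable_fun setT (fun y : R => `|y| `^ p).
Proof.
apply: (@measurableT_comp _ _ _ _ _ _ (fun y : R => y `^ p)).
  exact: measurable_powR.
exact: normr_measurable.
Qed.

Definition jump_tail (q x : R) : R := if q < `|x| then x ^+ 2 else 0.

Lemma measurable_jump_tail q : measurable_fun setT (jump_tail q).
Proof.
apply: measurable_fun_ifT.
- by apply: measurable_fun_ltr => //; apply: normr_measurable.
- exact: exprn_measurable.
- exact: measurable_cst.
Qed.

Lemma jump_tail_ge0 q x : 0 <= jump_tail q x.
Proof. by rewrite /jump_tail; case: ifP => // _; rewrite sqr_ge0. Qed.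

Lemma jump_tail_le q x : jump_tail q x <= x ^+ 2.
Proof. by rewrite /jump_tail; case: ifP => // _; rewrite sqr_ge0. Qed.

Lemma jump_tail_powR (q x p : R) : 0 < q -> 2 <= p ->
  jump_tail q x <= q `^ (2 - p) * `|x| `^ p.
Proof.
move=> q0 p2; rewrite /jump_tail; case: ifP => [qx|_]; last first.
  by rewrite mulr_ge0 // powR_ge0.
have x0 : 0 < `|x| by apply: lt_trans qx.
have -> : x ^+ 2 = `|x| `^ (2 - p) * `|x| `^ p.
  rewrite -powRD; last by apply/implyP => _; rewrite gt_eqF.
  by rewrite subrK powR_mulrn ?normr_ge0 // real_normK ?num_real.
apply: ler_wpM2r; first exact: powR_ge0.
rewrite /powR !gt_eqF // ler_expR; apply: ler_wnM2l; first lra.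
by rewrite ler_ln ?posrE // ltW.
Qed.

Lemma Mp_jump_tail (p : R) : 2 < p -> Mp mu X F p -> forall e : R, 0 < e ->
  exists x0 : R, forall x t A, x0 <= x -> S x -> (1 <= t)%N -> F t A ->
    A `<=` X t @^-1` [set x] ->
    (\int[mu]_(w in A) (jump_tail (x / ln x ^+ 2) (Delta X t w))%:E
     <= (e / ln x ^+ 2 * pr mu A)%:E)%E.
Proof.
move=> p2 [dl [C [Z [dl0 hM]]]] e e0.
pose K := (`|C| + 1) * 2 `^ (p - 2).
have K0 : 0 < K by rewrite mulr_gt0 ?powR_gt0 // ltr_wpDl.
have eK0 : 0 < e / K by rewrite divr_gt0.
have [x1 hx1] := ln_powR_small (2 * (p - 2) + 2) dl0 eK0.
exists (Num.max x1 (expR 1)) => x t A; rewrite ge_max => /andP[xx1 xe] Sx t1 FA AX.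
have [cZ leZ] := hM t t1.
have mA := filtration_measurable hA0 t1 FA.
have x1' : 1 <= x by apply: le_trans xe; rewrite -[leLHS]expR0 ler_expR.
have x0 : 0 < x by apply: lt_le_trans x1'.
have L1 : 1 <= ln x by rewrite -ler_expR lnK.
have L0 : 0 < ln x by apply: lt_le_trans L1.
set q := x / ln x ^+ 2.
have q0 : 0 < q by rewrite divr_gt0 // exprn_gt0.
have B0 : 0 <= (`|C| + 1) * (1 + x) `^ (p - 2 - dl).
  by rewrite mulr_ge0 ?powR_ge0 // addr_ge0.
have iB : (\int[mu]_(w in A) (`|Delta X t w| `^ p)%:E <=
   ((`|C| + 1) * (1 + x) `^ (p - 2 - dl) * pr mu A)%:E)%E.
  apply: (cexp_ub hA0 t1 FA B0 cZ).
  apply: filterS leZ => w /[swap] Aw; rewrite (AX _ Aw) => /le_trans; apply.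
  by rewrite lee_fin ler_wpM2r ?powR_ge0 // (le_trans (ler_norm _)) // lerDl ler01.
apply: (@le_trans _ _ (\int[mu]_(w in A)
   ((q `^ (2 - p))%:E * (`|Delta X t w| `^ p)%:E))%E).
  apply: ge0_le_integral => //.
  - by move=> w _; rewrite lee_fin jump_tail_ge0.
  - by apply: measurable_Delta_comp => //; exact: measurable_jump_tail.
  - apply: measurable_funeM; apply: (@measurable_Delta_comp t (fun y => `|y| `^ p)) => //.
    exact: measurable_norm_powR.
  - by move=> w _; rewrite -EFinM lee_fin jump_tail_powR // ltW.
rewrite ge0_integralZl //; last first.
- by rewrite lee_fin powR_ge0.
- apply: (@measurable_Delta_comp t (fun y => `|y| `^ p)) => //.
  exact: measurable_norm_powR.
apply: (le_trans (lee_wpmul2l _ iB)); first by rewrite lee_fin powR_ge0.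
rewrite -EFinM lee_fin mulrA ler_wpM2r ?pr_ge0 //.
have h1 : (1 + x) `^ (p - 2 - dl) <= 2 `^ (p - 2) * x `^ (p - 2) * x `^ (- dl).
  rewrite powR_add; last lra.
  apply: ler_pM; rewrite ?powR_ge0 //.
    by rewrite -powRM ?(ltW x0) //; apply: ge0_ler_powR; rewrite ?nnegrE; lra.
  rewrite /powR !gt_eqF //; last lra.
  rewrite ler_expR; apply: ler_wnM2l; first lra.
  by rewrite ler_ln ?posrE; lra.
have h2 : q `^ (2 - p) = x `^ (2 - p) * ln x `^ (2 * (p - 2)).
  rewrite /q powRM ?(ltW x0) ?invr_ge0 ?exprn_ge0 ?(ltW L0) //.
  congr (_ * _); rewrite -powR_mulrn ?(ltW L0) // -powR_inv1 ?powR_ge0 //.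
  by rewrite -!powRrM; congr (_ `^ _); lra.
rewrite h2; have {hx1} := hx1 _ xx1.
rewrite (powR_add (2 * (p - 2)) 2 L0).
rewrite powR_mulrn ?(ltW L0) // => hx1.
have xpp : x `^ (2 - p) * x `^ (p - 2) = 1.
  by rewrite -(opprB p 2) powR_neg.
have xdd : x `^ dl * x `^ (- dl) = 1.
  by rewrite mulrC powR_neg.
rewrite ler_pdivlMr ?exprn_gt0 //.
apply: (@le_trans _ _ (K * x `^ (- dl) * (ln x `^ (2 * (p - 2)) * ln x ^+ 2))); last first.
  apply: (@le_trans _ _ (K * x `^ (- dl) * (e / K * x `^ dl))).
    by rewrite ler_wpM2l // mulr_ge0 ?powR_ge0 // ltW.
  rewrite [leLHS](_ : _ = e * (K / K) * (x `^ dl * x `^ (- dl))); last by ring.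
  by rewrite xdd divff ?gt_eqF // !mulr1.
apply: (@le_trans _ _ (x `^ (2 - p) * ln x `^ (2 * (p - 2)) *
   ((`|C| + 1) * (2 `^ (p - 2) * x `^ (p - 2) * x `^ (- dl))) * ln x ^+ 2)).
  rewrite ler_wpM2r ?sqr_ge0 // ler_wpM2l ?mulr_ge0 ?powR_ge0 //.
  by rewrite ler_wpM2l // addr_ge0.
rewrite [leLHS](_ : _ = (x `^ (2 - p) * x `^ (p - 2)) *
  (K * x `^ (- dl) * (ln x `^ (2 * (p - 2)) * ln x ^+ 2))); last by rewrite /K; ring.
by rewrite xpp mul1r.
Qed.

Lemma Mp_bounded (p x0 : R) : 2 < p -> Mp mu X F p ->
  exists K : R, 0 <= K /\ forall x t A, x <= x0 -> S x -> (1 <= t)%N -> F t A ->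
    A `<=` X t @^-1` [set x] ->
    (\int[mu]_(w in A) (Delta X t w ^+ 2)%:E <= (K * pr mu A)%:E)%E.
Proof.
move=> p2 [dl [C [Z [dl0 hM]]]].
exists (1 + `|C| * (1 + `|x0|) `^ (p - 2)); split.
  by rewrite addr_ge0 // mulr_ge0 // powR_ge0.
move=> x t A xx0 Sx t1 FA AX; have [cZ leZ] := hM t t1.
have mA := filtration_measurable hA0 t1 FA.
have xge0 : 0 <= x by case: hA0 => -[_ _ + _] _; apply.
have nx0 := ler_norm x0.
have iB : (\int[mu]_(w in A) (`|Delta X t w| `^ p)%:E <=
   (`|C| * (1 + `|x0|) `^ (p - 2) * pr mu A)%:E)%E.
  apply: (cexp_ub hA0 t1 FA _ cZ); first by rewrite mulr_ge0 // powR_ge0.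
  apply: filterS leZ => w /[swap] Aw; rewrite (AX _ Aw) => /le_trans; apply.
  rewrite lee_fin; apply: (@le_trans _ _ (`|C| * (1 + x) `^ (p - 2 - dl))).
    by rewrite ler_wpM2r ?powR_ge0 // ler_norm.
  apply: ler_wpM2l => //; apply: (@le_trans _ _ ((1 + x) `^ (p - 2))).
    by apply: ler_powR; lra.
  by apply: ge0_ler_powR; rewrite ?nnegrE; lra.
apply: (@le_trans _ _ (\int[mu]_(w in A) (1 + (`|Delta X t w| `^ p)%:E))%E).
  apply: ge0_le_integral => //.
  - by move=> w _; rewrite lee_fin sqr_ge0.
  - by apply: (@measurable_Delta_comp t (fun y => y ^+ 2)) => //; exact: exprn_measurable.
  - apply: emeasurable_funD => //.
    apply: (@measurable_Delta_comp t (fun y => `|y| `^ p)) => //.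
    exact: measurable_norm_powR.
  - move=> w _; rewrite -EFinD lee_fin -(real_normK (num_real _)).
    set y := `|_|; have y0 : 0 <= y by rewrite normr_ge0.
    have [y1|y1] := leP y 1.
      by rewrite -[leLHS]addr0 lerD ?powR_ge0 // exprn_ile1.
    rewrite -[leLHS]add0r lerD // -powR_mulrn //; apply: ler_powR; lra.
rewrite ge0_integralD //.
- by rewrite (@integral_cstE _ _ _ mu A 1) // mulrDl EFinD leeD.
- apply: (@measurable_Delta_comp t (fun y => `|y| `^ p)) => //.
  exact: measurable_norm_powR.
Qed.

End Moments.

Section Drift.
Context {R : realType} {d : measure_display} {T : measurableType d}.
Variables (mu : probability T R) (S : set R) (X : nat -> T -> R)
  (F : nat -> set (set T)).
Hypothesis hA0 : A0 mu S X F.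
Implicit Types (t : nat) (A : set T) (c e x : R).

Definition sq_integrable t A :=
  mu.-integrable A (fun w => (Delta X t w ^+ 2)%:E).

Lemma sq_integrable_bound t A (K : R) : (1 <= t)%N -> measurable A ->
  (\int[mu]_(w in A) (Delta X t w ^+ 2)%:E <= K%:E)%E -> sq_integrable t A.
Proof.
move=> t1 mA leK; apply/integrableP; split.
  by apply: (@measurable_Delta_comp _ _ _ _ _ _ _ hA0 t (fun y => y ^+ 2)) => //;
    exact: exprn_measurable.
apply: le_lt_trans (ltry K); apply: le_trans leK.
rewrite le_eqVlt; apply/orP; left; apply/eqP; apply: eq_integral => w _.
by rewrite /= ger0_norm // sqr_ge0.
Qed.

Lemma Delta_integrable t A : (1 <= t)%N -> measurable A -> sq_integrable t A ->
  mu.-integrable A (EFin \o Delta X t).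
Proof.
move=> t1 mA i2.
apply: (@le_integrable _ _ _ _ _ mA _ (fun w => 1 + (Delta X t w ^+ 2)%:E)%E).
- by apply: (@measurable_Delta_comp _ _ _ _ _ _ _ hA0 t id).
- move=> w _; rewrite /= lee_fin [leRHS]ger0_norm ?addr_ge0 ?sqr_ge0 //.
  rewrite -(real_normK (num_real (Delta X t w))).
  by set y := `|_|; have := sqr_ge0 (y - 1 / 2); nra.
- by apply: integrableD => //; apply: finite_measure_integrable_cst.
Qed.

Lemma jump_tail_integrable t A q : (1 <= t)%N -> measurable A -> sq_integrable t A ->
  mu.-integrable A (EFin \o jump_tail q \o Delta X t).
Proof.
move=> t1 mA i2; apply: le_integrable i2 => //.
- apply: (@measurable_Delta_comp _ _ _ _ _ _ _ hA0 t (jump_tail q)) => //.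
  exact: measurable_jump_tail.
- move=> w _; rewrite /= lee_fin !ger0_norm ?sqr_ge0 ?jump_tail_ge0 //.
  exact: jump_tail_le.
Qed.

Lemma cexp_diff_ub t A (Yp Yn Zp Zn : T -> \bar R) (k : R) : (1 <= t)%N -> F t A ->
  cexp_version mu (F t) Yp Zp -> cexp_version mu (F t) Yn Zn ->
  {ae mu, forall w, A w -> [/\ Zp w \is a fin_num, Zn w \is a fin_num &
     fine (Zp w) - fine (Zn w) <= k]} ->
  (\int[mu]_(w in A) Yp w + (Num.max (- k) 0 * pr mu A)%:E
   <= \int[mu]_(w in A) Yn w + (Num.max k 0 * pr mu A)%:E)%E.
Proof.
move=> t1 FA cp cn h; have mA := filtration_measurable hA0 t1 FA.
have mp := cexp_measurable hA0 t1 FA cp; have mn := cexp_measurable hA0 t1 FA cn.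
case: cp => _ p0 ->//; case: cn => _ n0 ->//.
have k0 (y : R) : 0 <= Num.max y 0 by rewrite le_max lexx orbT.
rewrite -!integral_cstE // -!ge0_integralD //; try by move=> w _; rewrite lee_fin.
apply: ae_ge0_le_integral => //.
- by move=> w _; rewrite adde_ge0 // lee_fin.
- exact: emeasurable_funD.
- by move=> w _; rewrite adde_ge0 // lee_fin.
- exact: emeasurable_funD.
apply: filterS h => w h Aw; have [fp fn le_k] := h Aw.
rewrite -(fineK fp) -(fineK fn) -!EFinD lee_fin.
by move: le_k; rewrite /Num.max; do 2!case: ifP; lra.
Qed.

Lemma Rintegral_posneg t A : (1 <= t)%N -> measurable A -> sq_integrable t A ->
  exists ip in_ : R,
  [/\ (\int[mu]_(w in A) (Num.max (Delta X t w) 0)%:E = ip%:E)%E,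
      (\int[mu]_(w in A) (Num.max (- Delta X t w) 0)%:E = in_%:E)%E &
      (\int[mu]_(w in A) Delta X t w) = ip - in_].
Proof.
move=> t1 mA i2; have i1 := Delta_integrable t1 mA i2.
have ep : (\int[mu]_(w in A) (Num.max (Delta X t w) 0)%:E =
   \int[mu]_(w in A) (EFin \o Delta X t)^\+ w)%E.
  by apply: eq_integral => w _; rewrite funeposE /= EFin_max.
have en : (\int[mu]_(w in A) (Num.max (- Delta X t w) 0)%:E =
   \int[mu]_(w in A) (EFin \o Delta X t)^\- w)%E.
  by apply: eq_integral => w _; rewrite funenegE /= EFin_max.
have fp := integrable_pos_fin_num mA i1; have fn := integrable_neg_fin_num mA i1.
exists (fine (\int[mu]_(w in A) (EFin \o Delta X t)^\+ w)%E),
  (fine (\int[mu]_(w in A) (EFin \o Delta X t)^\- w)%E); split.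
- by rewrite ep fineK.
- by rewrite en fineK.
- by rewrite /Rintegral integralE fineB.
Qed.

Definition atom_moments t A c (s2 : R) e x : Prop :=
  [/\ sq_integrable t A,
   `|(\int[mu]_(w in A) Delta X t w) - c / x * pr mu A| <= e / (x * ln x) * pr mu A,
   `|(\int[mu]_(w in A) (Delta X t w ^+ 2)) - s2 * pr mu A| <= e / ln x * pr mu A &
   (\int[mu]_(w in A) jump_tail (x / ln x ^+ 2) (Delta X t w))
     <= e / ln x ^+ 2 * pr mu A].

Lemma A2_first_two c (s2 : R) : A2 mu X F c s2 -> forall e, 0 < e ->
  exists x0 : R, forall x t A, x0 <= x -> S x -> (1 <= t)%N -> F t A ->
    A `<=` X t @^-1` [set x] ->
    [/\ sq_integrable t A,
   `|(\int[mu]_(w in A) Delta X t w) - c / x * pr mu A| <= e / (x * ln x) * pr mu A &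
   `|(\int[mu]_(w in A) (Delta X t w ^+ 2)) - s2 * pr mu A| <= e / ln x * pr mu A].
Proof.
move=> [s20 [[Zp [Zn [cZ hZ]]] [Z2 [c2 h2]]]] e e0.
have [x1 hx1] := hZ e e0; have [x2 hx2] := h2 e e0.
exists (Num.max (Num.max x1 x2) (expR 1)) => x t A.
rewrite !ge_max => /andP[/andP[xx1 xx2] xe] Sx t1 FA AX.
have mA := filtration_measurable hA0 t1 FA.
have x0 : 0 < x by apply: lt_le_trans xe; apply: expR_gt0.
have L1 : 1 <= ln x by rewrite -ler_expR lnK.
have eL0 : 0 < e / ln x by rewrite divr_gt0 //; lra.
have ub2 : (\int[mu]_(w in A) (Delta X t w ^+ 2)%:E <=
    ((s2 + e / ln x) * pr mu A)%:E)%E.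
  apply: (cexp_ub hA0 t1 FA _ (c2 t t1)); first lra.
  apply: filterS (hx2 t t1) => w /[swap] Aw; rewrite (AX _ Aw) => /(_ xx2)[fz].
  by rewrite -{2}(fineK fz) lee_fin ler_norml => /andP[]; lra.
have i2 := sq_integrable_bound t1 mA ub2.
have lb2 : (((s2 - e / ln x) * pr mu A)%:E <=
   \int[mu]_(w in A) (Delta X t w ^+ 2)%:E)%E.
  have k0 : 0 <= Num.max (s2 - e / ln x) 0 by rewrite le_max lexx orbT.
  apply: (@le_trans _ _ (Num.max (s2 - e / ln x) 0 * pr mu A)%:E).
    by rewrite lee_fin ler_wpM2r ?pr_ge0 // le_max lexx.
  apply: (cexp_lb hA0 t1 FA k0 (c2 t t1)).
  have Z20 : forall w, (0 <= Z2 t w)%E by case: (c2 t t1).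
  apply: filterS (hx2 t t1) => w /[swap] Aw; rewrite (AX _ Aw) => /(_ xx2)[fz].
  have := Z20 w; rewrite -(fineK fz) !lee_fin ler_norml ge_max => -> /andP[].
  by rewrite andbT fineK //; lra.
split => //.
- have [cp cn] := cZ t t1; have [ip [in_ [ep en ->]]] := Rintegral_posneg t1 mA i2.
  have aeA := hx1 t t1.
  have h1 : {ae mu, forall w, A w -> [/\ Zp t w \is a fin_num, Zn t w \is a fin_num &
     fine (Zp t w) - fine (Zn t w) <= c / x + e / (x * ln x)]}.
    apply: filterS aeA => w /[swap] Aw; rewrite (AX _ Aw) => /(_ xx1)[fp fn].
    by rewrite ler_norml => /andP[h1 h3]; split => //; lra.
  have h3 : {ae mu, forall w, A w -> [/\ Zn t w \is a fin_num, Zp t w \is a fin_num &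
     fine (Zn t w) - fine (Zp t w) <= - (c / x - e / (x * ln x))]}.
    apply: filterS aeA => w /[swap] Aw; rewrite (AX _ Aw) => /(_ xx1)[fp fn].
    by rewrite ler_norml => /andP[h2' h3]; split => //; lra.
  have := cexp_diff_ub t1 FA cp cn h1; have := cexp_diff_ub t1 FA cn cp h3.
  rewrite ep en -!EFinD !lee_fin opprK => i3 i1.
  have mx (k : R) : Num.max k 0 * pr mu A - Num.max (- k) 0 * pr mu A = k * pr mu A.
    by rewrite -mulrBl maxr_posneg.
  have e1 := mx (c / x + e / (x * ln x)); have e2 := mx (c / x - e / (x * ln x)).
  by rewrite ler_norml; apply/andP; split; move: i1 i3 e1 e2; rewrite !mulrDl !mulNr; lra.
- have fi : (\int[mu]_(w in A) (Delta X t w ^+ 2)%:E)%E \is a fin_num.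
    exact: integrable_fin_num.
  move: ub2 lb2; rewrite -(fineK fi) !lee_fin -/(Rintegral _ _ _) => ub2 lb2.
  by rewrite ler_norml; apply/andP; split; lra.
Qed.

Lemma large_moments c (s2 p : R) : A2 mu X F c s2 -> 2 < p -> Mp mu X F p ->
  forall e, 0 < e -> exists x0 : R, forall x t A, x0 <= x -> S x -> (1 <= t)%N ->
    F t A -> A `<=` X t @^-1` [set x] -> atom_moments t A c s2 e x.
Proof.
move=> hA2 p2 hM e e0; have [x1 h1] := A2_first_two hA2 e0.
have [x2 h2] := Mp_jump_tail hA0 p2 hM e0.
exists (Num.max x1 x2) => x t A; rewrite ge_max => /andP[xx1 xx2] Sx t1 FA AX.
have [i2 m1 m2] := h1 _ _ _ xx1 Sx t1 FA AX; split => //.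
have mA := filtration_measurable hA0 t1 FA.
have := h2 _ _ _ xx2 Sx t1 FA AX.
by rewrite -(fineK (integrable_fin_num mA (jump_tail_integrable _ t1 mA i2))) lee_fin.
Qed.

Lemma integral_jump_poly t A (a0 a1 a2 a3 q : R) : (1 <= t)%N -> measurable A ->
  sq_integrable t A ->
  let g w := a0 + a1 * Delta X t w + a2 * Delta X t w ^+ 2
             + a3 * jump_tail q (Delta X t w) in
  mu.-integrable A (EFin \o g) /\
  (\int[mu]_(w in A) (EFin \o g) w =
   (a0 * pr mu A + a1 * (\int[mu]_(w in A) Delta X t w) +
    a2 * (\int[mu]_(w in A) (Delta X t w ^+ 2)) +
    a3 * (\int[mu]_(w in A) jump_tail q (Delta X t w)))%:E)%E.
Proof.
move=> t1 mA i2 g.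
have i1 := Delta_integrable t1 mA i2.
have i3 := jump_tail_integrable q t1 mA i2.
have i0 : mu.-integrable A (EFin \o cst a0) by apply: finite_measure_integrable_cst.
have j1 : mu.-integrable A (fun w => a1%:E * (Delta X t w)%:E)%E by apply: integrableZl.
have j2 : mu.-integrable A (fun w => a2%:E * (Delta X t w ^+ 2)%:E)%E by apply: integrableZl.
have j3 : mu.-integrable A (fun w => a3%:E * (jump_tail q (Delta X t w))%:E)%E.
  exact: integrableZl.
have k1 : mu.-integrable A (fun w => a0%:E + a1%:E * (Delta X t w)%:E)%E.
  exact: integrableD.
have k2 : mu.-integrable A (fun w => a0%:E + a1%:E * (Delta X t w)%:E +
  a2%:E * (Delta X t w ^+ 2)%:E)%E by apply: integrableD.
have k3 : mu.-integrable A (fun w => a0%:E + a1%:E * (Delta X t w)%:E +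
  a2%:E * (Delta X t w ^+ 2)%:E + a3%:E * (jump_tail q (Delta X t w))%:E)%E.
  exact: integrableD.
have -> : EFin \o g = (fun w => a0%:E + a1%:E * (Delta X t w)%:E +
  a2%:E * (Delta X t w ^+ 2)%:E + a3%:E * (jump_tail q (Delta X t w))%:E)%E.
  by apply/funext => w; rewrite /g /= !EFinD !EFinM.
split => //.
rewrite integralD // integralD // integralD // integral_cstE //.
have z (a : R) (h : T -> R) : mu.-integrable A (EFin \o h) ->
    (\int[mu]_(x in A) (a%:E * (h x)%:E) = (a * \int[mu]_(w in A) h w)%:E)%E.
  move=> ih; rewrite integralZl // EFinM /Rintegral fineK //.
  exact: integrable_fin_num.
by rewrite !z // !EFinD.
Qed.

Lemma drift_le t A c (s2 : R) e x (a0 a1 a2 a3 : R) (f : R -> R) :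
  (1 <= t)%N -> F t A -> A `<=` X t @^-1` [set x] -> 0 < x -> 0 <= a3 ->
  atom_moments t A c s2 e x -> (forall y, 0 <= f y) ->
  (forall y, - x <= y -> f (x + y) <= a0 + a1 * y + a2 * y ^+ 2
      + a3 * jump_tail (x / ln x ^+ 2) y) ->
  (\int[mu]_(w in A) (f (X t.+1 w))%:E <= ((a0 + a1 * (c / x) + a2 * s2
     + (`|a1| / x + `|a2| + a3 / ln x) * (e / ln x)) * pr mu A)%:E)%E.
Proof.
move=> t1 FA AX x0 a30 [i2 m1 m2 m3] f0 le_f.
have mA := filtration_measurable hA0 t1 FA.
have [ig eg] := integral_jump_poly a0 a1 a2 a3 (x / ln x ^+ 2) t1 mA i2.
apply: (@le_trans _ _ (\int[mu]_(w in A) (a0 + a1 * Delta X t w +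
    a2 * Delta X t w ^+ 2 + a3 * jump_tail (x / ln x ^+ 2) (Delta X t w))%:E)%E).
  apply: ge0_le_integral => //.
  - by move=> w _; rewrite lee_fin.
  - apply: (@measurable_funTS _ _ _ _ _ (EFin \o f \o X t.+1)).
    exact: (measurable_state_fun hA0 (EFin \o f)).
  - exact: measurable_int ig.
  - move=> w Aw; rewrite lee_fin.
    have -> : X t.+1 w = x + Delta X t w.
      by rewrite /Delta (AX _ Aw) addrC subrK.
    apply: le_f; rewrite /Delta (AX _ Aw) lerBrDr addNr.
    exact: (state_ge0 hA0).
rewrite eg lee_fin.
set P := pr mu A in m1 m2 m3 *; set E1 := Rintegral _ _ _ in m1 *.
set E2 := Rintegral _ _ _ in m2 *; set E3 := Rintegral _ _ _ in m3 *.
have b1 : a1 * E1 <= a1 * (c / x * P) + `|a1| * (e / (x * ln x) * P).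
  rewrite -lerBlDl -mulrBr (le_trans (ler_norm _)) // normrM ler_wpM2l //.
have b2 : a2 * E2 <= a2 * (s2 * P) + `|a2| * (e / ln x * P).
  rewrite -lerBlDl -mulrBr (le_trans (ler_norm _)) // normrM ler_wpM2l //.
have b3 : a3 * E3 <= a3 * (e / ln x ^+ 2 * P) by rewrite ler_wpM2l.
have -> : (a0 + a1 * (c / x) + a2 * s2 + (`|a1| / x + `|a2| + a3 / ln x) * (e / ln x)) * P =
  a0 * P + (a1 * (c / x * P) + `|a1| * (e / (x * ln x) * P)) +
  (a2 * (s2 * P) + `|a2| * (e / ln x * P)) + a3 * (e / ln x ^+ 2 * P).
  by rewrite expr2 !invfM; ring.
lra.
Qed.

Lemma drift_ge t A c (s2 : R) e x (a0 a1 a2 a3 : R) (f : R -> R) :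
  (1 <= t)%N -> F t A -> A `<=` X t @^-1` [set x] -> 0 < x -> 0 <= a3 ->
  atom_moments t A c s2 e x -> (forall y, 0 <= f y) ->
  (forall y, - x <= y -> a0 + a1 * y + a2 * y ^+ 2
      - a3 * jump_tail (x / ln x ^+ 2) y <= f (x + y)) ->
  (((a0 + a1 * (c / x) + a2 * s2 - (`|a1| / x + `|a2| + a3 / ln x) * (e / ln x))
      * pr mu A)%:E <= \int[mu]_(w in A) (f (X t.+1 w))%:E)%E.
Proof.
move=> t1 FA AX x0 a30 [i2 m1 m2 m3] f0 le_f.
have mA := filtration_measurable hA0 t1 FA.
have [ig eg] := integral_jump_poly a0 a1 a2 (- a3) (x / ln x ^+ 2) t1 mA i2.
apply: (@le_trans _ _ (\int[mu]_(w in A) (a0 + a1 * Delta X t w +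
    a2 * Delta X t w ^+ 2 + - a3 * jump_tail (x / ln x ^+ 2) (Delta X t w))%:E)%E);
    last first.
  have mg := measurable_int mu ig.
  set g := (fun w => a0 + a1 * Delta X t w +
    a2 * Delta X t w ^+ 2 + - a3 * jump_tail (x / ln x ^+ 2) (Delta X t w)) in mg *.
  apply: (@le_trans _ _ (\int[mu]_(w in A) (EFin \o g)^\+ w)%E).
    rewrite -/(EFin \o g).
    rewrite integralE; apply: geeDl.
    by rewrite oppe_le0 integral_ge0.
  apply: ge0_le_integral => //.
  - exact: measurable_funepos.
  - apply: (@measurable_funTS _ _ _ _ _ (EFin \o f \o X t.+1)).
    exact: (measurable_state_fun hA0 (EFin \o f)).
  - move=> w Aw; rewrite funeposE ge_max; apply/andP; split; rewrite lee_fin // /g.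
    have -> : X t.+1 w = x + Delta X t w.
      by rewrite /Delta (AX _ Aw) addrC subrK.
    rewrite mulNr; apply: le_f; rewrite /Delta (AX _ Aw) lerBrDr addNr.
    exact: (state_ge0 hA0).
rewrite eg lee_fin.
set P := pr mu A in m1 m2 m3 *; set E1 := Rintegral _ _ _ in m1 *.
set E2 := Rintegral _ _ _ in m2 *; set E3 := Rintegral _ _ _ in m3 *.
have b1 : - (`|a1| * (e / (x * ln x) * P)) <= a1 * E1 - a1 * (c / x * P).
  rewrite -mulrBr lerNl (le_trans (ler_norm _)) // normrN normrM ler_wpM2l //.
have b2 : - (`|a2| * (e / ln x * P)) <= a2 * E2 - a2 * (s2 * P).
  rewrite -mulrBr lerNl (le_trans (ler_norm _)) // normrN normrM ler_wpM2l //.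
have b3 : a3 * E3 <= a3 * (e / ln x ^+ 2 * P) by rewrite ler_wpM2l.
have -> : (a0 + a1 * (c / x) + a2 * s2 - (`|a1| / x + `|a2| + a3 / ln x) * (e / ln x)) * P =
  a0 * P + (a1 * (c / x * P) - `|a1| * (e / (x * ln x) * P)) +
  (a2 * (s2 * P) - `|a2| * (e / ln x * P)) - a3 * (e / ln x ^+ 2 * P).
  by rewrite expr2 !invfM; ring.
lra.
Qed.

End Drift.

(** * The Lyapunov functions *)

Section Taylor.
Context {R : realType}.
Implicit Types (g u v w x y : R).

Lemma derive_bound (g dg : R -> R) (M rho : R) n :
  g 0 = 0 -> (forall x, is_derive x 1 g (dg x)) -> 0 <= M ->
  (forall x, `|x| <= rho -> `|dg x| <= M * `|x| ^+ n) ->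
  forall x, `|x| <= rho -> `|g x| <= M * `|x| ^+ n.+1.
Proof.
move=> g0 dgP M0 hdg x hx.
have cg (a b : R) : {within `[a, b], continuous g}.
  apply: derivable_within_continuous => z _; exact: ex_derive.
have main (c : R) : `|c| <= `|x| -> `|dg c * x| <= M * `|x| ^+ n.+1.
  move=> cx; rewrite normrM exprSr mulrA ler_wpM2r //.
  apply: (le_trans (hdg _ (le_trans cx hx))).
  by rewrite ler_wpM2l // lerXn2r ?nnegrE.
have [x0|x0|->] := ltgtP x 0; last by rewrite g0 !normr0 expr0n /= mulr0.
- have [c] := MVT x0 (fun z _ => dgP z) (cg _ _).
  rewrite in_itv /= => /andP[c1 c2]; rewrite g0 !sub0r mulrN => /eqP.
  rewrite eqr_opp => /eqP ->; apply: main.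
  by rewrite !ltr0_norm //; lra.
- have [c] := MVT x0 (fun z _ => dgP z) (cg _ _).
  rewrite in_itv /= => /andP[c1 c2]; rewrite g0 !subr0 => ->; apply: main.
  by rewrite !gtr0_norm //; lra.
Qed.

Lemma expR_taylor1 w : `|w| <= 2 -> `|expR w - 1| <= expR 2 * `|w|.
Proof.
move=> hw; rewrite -[X in _ * X]expr1.
apply: (@derive_bound (fun x => expR x - 1) expR _ 2) => //.
- by rewrite expR0 subrr.
- by move=> x; apply: is_derive_eq; rewrite /GRing.scale /= subr0.
- move=> x; rewrite ler_norml => /andP[_ x2].
  by rewrite expr0 mulr1 ger0_norm ?expR_ge0 // ler_expR.
Qed.

Lemma expR_taylor2 w : `|w| <= 2 -> `|expR w - 1 - w| <= expR 2 * `|w| ^+ 2.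
Proof.
move=> hw; apply: (@derive_bound (fun x => expR x - 1 - x) (fun x => expR x - 1) _ 2) => //.
- by rewrite expR0 subr0 subrr.
- move=> x; apply: is_derive_eq; rewrite /GRing.scale /= ; lra.
- by move=> x /expR_taylor1.
Qed.

Lemma expR_taylor3 w : `|w| <= 2 ->
  `|expR w - 1 - w - w ^+ 2 / 2| <= expR 2 * `|w| ^+ 3.
Proof.
move=> hw; apply: (@derive_bound (fun x => expR x - 1 - x - x ^+ 2 / 2)
  (fun x => expR x - 1 - x) _ 2) => //.
- by rewrite expR0 expr0n /= mul0r !subr0 subrr.
- move=> x; apply: is_derive_eq; rewrite /GRing.scale /= ; lra.
- by move=> x /expR_taylor2.
Qed.

Lemma ln1D_bound u : `|u| <= 1 / 2 -> `|ln (1 + u)| <= 2 * `|u|.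
Proof.
move=> hu; have [h1 h2] : - (1 / 2) <= u /\ u <= 1 / 2.
  by move: hu; rewrite ler_norml => /andP.
have up : ln (1 + u) <= u by apply: le_ln1Dx; lra.
have lo : - (2 * `|u|) <= ln (1 + u).
  have p0 : 0 < 1 + u by lra.
  have : ln (1 + ((1 + u)^-1 - 1)) <= (1 + u)^-1 - 1.
    by apply: le_ln1Dx; rewrite ltrBrDr addNr invr_gt0.
  rewrite addrC subrK lnV ?posrE // => h.
  have : (1 + u)^-1 - 1 <= 2 * `|u|.
    rewrite (_ : (1 + u)^-1 - 1 = - u / (1 + u)); last by field; rewrite gt_eqF.
    rewrite ler_pdivrMr //; have := ler_norm (- u); rewrite normrN.
    have := normr_ge0 u; nra.
  lra.
rewrite ler_norml lo /=; have := ler_norm u; have := normr_ge0 u; lra.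
Qed.

Lemma powR_1D g u : -1 < u -> (1 + u) `^ g = expR (g * ln (1 + u)).
Proof. by move=> u1; rewrite /powR gt_eqF //; lra. Qed.

Lemma taylor_pow : exists2 C : R, 0 < C & forall g u, 0 < g <= 2 -> `|u| <= 1 / 2 ->
  [/\ `|(1 + u) `^ g - (1 + g * u + g * (g - 1) / 2 * u ^+ 2)| <= C * `|u| ^+ 3,
      `|(1 + u) `^ g * ln (1 + u) - (u + (2 * g - 1) / 2 * u ^+ 2)| <= C * `|u| ^+ 3
    & (1 + u) `^ g <= C].
Proof.
have K0 : 0 < expR 2 :> R by apply: expR_gt0.
have K1 : 1 <= expR 2 :> R by rewrite -[leLHS]expR0 ler_expR.
set K : R := expR 2 in K0 K1.
exists (200 * K) => [|g u /andP[g0 g2] hu]; first by rewrite mulr_gt0 ?ltr0n.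
have q2 : `|g * (g - 1) / 2| <= 1 by rewrite ler_norml; apply/andP; split; nra.
have q1 : `|(2 * g - 1) / 2| <= 2 by rewrite ler_norml; apply/andP; split; lra.
have [u1 u2] : - (1 / 2) <= u /\ u <= 1 / 2 by move: hu; rewrite ler_norml => /andP.
have hv := ln1D_bound hu.
have um1 : -1 < u by lra.
rewrite !powR_1D //; set v := ln (1 + u) in hv *.
have uE : u = expR v - 1 by rewrite lnK ?posrE; lra.
have a0 := normr_ge0 u; have b0 := normr_ge0 v.
set a := `|u| in hu hv a0 *; set b := `|v| in hv b0.
have gv : `|g * v| <= 2 * b by rewrite normrM (gtr0_norm g0) -/b; nra.
have v2 : `|v| <= 2 by rewrite -/b; lra.
have gv2 : `|g * v| <= 2 by lra.
have b3 : b ^+ 3 <= 8 * a ^+ 3.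
  rewrite (_ : 8 * a ^+ 3 = (2 * a) ^+ 3); last by ring.
  by rewrite lerXn2r ?nnegrE //; lra.
have b2 : b ^+ 2 <= 4 * a ^+ 2.
  rewrite (_ : 4 * a ^+ 2 = (2 * a) ^+ 2); last by ring.
  by rewrite lerXn2r ?nnegrE //; lra.
have gv3 : `|g * v| ^+ 3 <= 64 * a ^+ 3.
  apply: (@le_trans _ _ ((2 * b) ^+ 3)); first by rewrite lerXn2r ?nnegrE //; lra.
  rewrite exprMn; lra.
have gvs : `|g * v| ^+ 2 <= 16 * a ^+ 2.
  apply: (@le_trans _ _ ((2 * b) ^+ 2)); first by rewrite lerXn2r ?nnegrE //; lra.
  rewrite exprMn; lra.
have a3 : 0 <= a ^+ 3 by rewrite exprn_ge0.
have a2 : 0 <= a ^+ 2 by rewrite exprn_ge0.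
have r1 : `|expR (g * v) - 1 - g * v - (g * v) ^+ 2 / 2| <= 64 * K * a ^+ 3.
  apply: (le_trans (expR_taylor3 gv2)); rewrite -/K.
  by rewrite (mulrC 64) -mulrA ler_wpM2l // ltW.
have r2 : `|u - v - v ^+ 2 / 2| <= 8 * K * a ^+ 3.
  rewrite uE; apply: (le_trans (expR_taylor3 v2)); rewrite -/K -/b.
  by rewrite (mulrC 8) -mulrA ler_wpM2l // ltW.
have r3 : `|u ^+ 2 - v ^+ 2| <= 12 * K * a ^+ 3.
  rewrite subr_sqr normrM; have d1 : `|u - v| <= 4 * K * a ^+ 2.
    rewrite {1}uE; apply: (le_trans (expR_taylor2 v2)); rewrite -/K -/b.
    by rewrite (mulrC 4) -mulrA ler_wpM2l // ltW.
  have d2 : `|u + v| <= 3 * a by apply: (le_trans (ler_normD _ _)); rewrite -/a -/b; lra.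
  rewrite (_ : 12 * K * a ^+ 3 = (4 * K * a ^+ 2) * (3 * a)); last by ring.
  by apply: ler_pM.
have Ka3 : 0 <= K * a ^+ 3 by rewrite mulr_ge0 // ltW.
split.
- rewrite (_ : _ - _ = (expR (g * v) - 1 - g * v - (g * v) ^+ 2 / 2)
    - g * (u - v - v ^+ 2 / 2) - g * (g - 1) / 2 * (u ^+ 2 - v ^+ 2)); last by field.
  apply: (le_trans (ler_normB _ _)); apply: (@le_trans _ _
    (64 * K * a ^+ 3 + 2 * (8 * K * a ^+ 3) + 1 * (12 * K * a ^+ 3))).
    apply: lerD; last by rewrite normrM; apply: ler_pM.
    apply: (le_trans (ler_normB _ _)); apply: lerD => //.
    by rewrite normrM (gtr0_norm g0); apply: ler_pM => //; move: g0 g2; clear; lra.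
  move: Ka3; clear; lra.
- rewrite (_ : _ - _ = v * (expR (g * v) - 1 - g * v)
    - (u - v - v ^+ 2 / 2) - (2 * g - 1) / 2 * (u ^+ 2 - v ^+ 2)); last by field.
  apply: (le_trans (ler_normB _ _)); apply: (@le_trans _ _
    (32 * K * a ^+ 3 + 8 * K * a ^+ 3 + 2 * (12 * K * a ^+ 3))).
    apply: lerD; last by rewrite normrM; apply: ler_pM.
    apply: (le_trans (ler_normB _ _)); apply: lerD => //.
    rewrite normrM -/b (_ : 32 * K * a ^+ 3 = (2 * a) * (K * (16 * a ^+ 2))); last by ring.
    apply: ler_pM => //; apply: (le_trans (expR_taylor2 gv2)).
    by rewrite ler_wpM2l // ltW.
  move: Ka3; clear; lra.
- apply: (@le_trans _ _ K); last by move: K0; clear; lra.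
  by rewrite /K ler_expR; move: gv2; rewrite ler_norml => /andP[].
Qed.

Lemma powR_ge1_le_sq g x : g <= 2 -> 1 <= x -> x `^ g <= x ^+ 2.
Proof.
by move=> g2 x1; rewrite -powR_mulrn; [apply: ler_powR|lra].
Qed.


End Taylor.

Section LyapunovFunctions.
Context {R : realType}.
Implicit Types (g u v w x y : R).

Definition fminus g x : R := x `^ g / Num.max (ln x) 1.
Definition fplus g x : R := x `^ g * Num.max (ln x) 1.

Lemma max_ln_ge1 x : 1 <= Num.max (ln x) 1.
Proof. by rewrite le_max lexx orbT. Qed.

Lemma fminus_ge0 g x : 0 <= fminus g x.
Proof. by rewrite divr_ge0 ?powR_ge0 // (le_trans ler01) // max_ln_ge1. Qed.

Lemma fplus_ge0 g x : 0 <= fplus g x.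
Proof. by rewrite mulr_ge0 ?powR_ge0 // (le_trans ler01) // max_ln_ge1. Qed.

Lemma fminus_le_powR g x : fminus g x <= x `^ g.
Proof.
rewrite ler_pdivrMr; last by rewrite (lt_le_trans ltr01) // max_ln_ge1.
by rewrite ler_peMr ?powR_ge0 // max_ln_ge1.
Qed.

Lemma le_fplus g x z : 0 < g -> 0 <= x -> x <= z -> fplus g x <= fplus g z.
Proof.
move=> g0 x0 xz; rewrite le_eqVlt in x0; case/orP: x0 => [/eqP<-|x0].
  by rewrite {1}/fplus powR0 ?gt_eqF // mul0r fplus_ge0.
apply: ler_pM; rewrite ?powR_ge0 ?(le_trans ler01 (max_ln_ge1 _)) //.
  by apply: ge0_ler_powR; rewrite ?nnegrE; lra.
rewrite ge_max max_ln_ge1 andbT le_max ler_ln ?posrE ?xz //; lra.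
Qed.

Lemma expR2_ge4 : 4 <= expR 2 :> R.
Proof.
have e1 : 2 <= expR 1 :> R by apply: le_trans (expR_ge1Dx _); lra.
rewrite (_ : 2 = 1 + 1) // expRD; nra.
Qed.

Lemma expR1_le_half : expR 1 <= expR 2 / 2 :> R.
Proof.
have e1 : 2 <= expR 1 :> R by apply: le_trans (expR_ge1Dx _); lra.
have -> : expR 2 = expR 1 * expR 1 :> R by rewrite -expRD.
nra.
Qed.

Lemma near_point x y : expR 2 <= x -> `|y / x| <= 1 / 2 ->
  [/\ 0 < x + y, x + y = x * (1 + y / x),
      Num.max (ln (x + y)) 1 = ln x + ln (1 + y / x) &
      forall g, (x + y) `^ g = x `^ g * (1 + y / x) `^ g].
Proof.
move=> hx hu; have e4 := expR2_ge4; have e12 := expR1_le_half.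
have x0 : 0 < x by lra.
have [u1 u2] : - (1 / 2) <= y / x /\ y / x <= 1 / 2.
  by move: hu; rewrite ler_norml => /andP.
have E : x + y = x * (1 + y / x) by field; rewrite gt_eqF.
have p1 : 0 < 1 + y / x by lra.
split => //.
- by rewrite E mulr_gt0.
- rewrite -lnM ?posrE // -E; apply/max_idPl.
  rewrite -ler_expR lnK ?posrE; last by rewrite E mulr_gt0.
  by rewrite E; nra.
- by move=> g; rewrite E powRM //; lra.
Qed.

Lemma far_point g x y : 0 < g <= 2 -> 0 < x -> - x <= y -> 1 / 2 < `|y / x| ->
  (x + y) `^ g <= x `^ g * (9 * (y / x) ^+ 2).
Proof.
move=> /andP[g0 g2] x0 hy hu; have E : x + y = x * (1 + y / x) by field; rewrite gt_eqF.
have u1 : - 1 <= y / x by rewrite ler_pdivlMr // mulN1r.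
rewrite E powRM; [|lra..]; rewrite ler_wpM2l ?powR_ge0 //.
apply: (@le_trans _ _ ((1 + `|y / x|) `^ g)).
  by apply: ge0_ler_powR; rewrite ?nnegrE; have := ler_norm (y / x); lra.
apply: (@le_trans _ _ ((1 + `|y / x|) ^+ 2)); first by apply: powR_ge1_le_sq; lra.
rewrite -(real_normK (num_real (y / x))); move: (`|y / x|) hu => a ha; nra.
Qed.

Lemma cube_split (L u x y : R) : u = y / x -> 0 < x -> 2 <= L -> `|u| <= 1 / 2 ->
  `|u| ^+ 3 <= u ^+ 2 / L ^+ 2 + jump_tail (x / L ^+ 2) y / x ^+ 2.
Proof.
move=> uE x0 L2 hu; have L0 : 0 < L ^+ 2 by rewrite exprn_gt0; lra.
have ux : `|y| = `|u| * x by rewrite uE normrM normfV (gtr0_norm x0) divfK // gt_eqF.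
have u2 : u ^+ 2 = `|u| ^+ 2 by rewrite real_normK ?num_real.
rewrite /jump_tail; case: ifP => [_|/negbT]; last first.
  rewrite -leNgt ux ler_pdivlMr // mul0r addr0 u2 => h.
  have a0 := normr_ge0 u; move: (`|u|) a0 h {u2 ux hu uE} => a a0 h.
  rewrite ler_pdivlMr // exprS; have : a * L ^+ 2 <= 1 by nra.
  by have := sqr_ge0 a; nra.
rewrite (_ : y ^+ 2 / x ^+ 2 = u ^+ 2); last by rewrite uE expr_div_n.
apply: ler_wpDl; first by rewrite divr_ge0 ?sqr_ge0 // ltW.
by rewrite u2 exprS; have := sqr_ge0 `|u|; nra.
Qed.

Lemma jump_tail_far (L x y : R) : 0 < x -> 2 <= L -> 1 / 2 < `|y / x| ->
  jump_tail (x / L ^+ 2) y / x ^+ 2 = (y / x) ^+ 2.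
Proof.
move=> x0 L2; rewrite normrM normfV (gtr0_norm x0) ltr_pdivlMr // => h.
rewrite /jump_tail ifT ?expr_div_n //; apply: le_lt_trans h.
rewrite ler_pdivrMr ?exprn_gt0 //; last lra.
rewrite mulrAC ler_peMl //; first exact: ltW.
have : 2 ^+ 2 <= L ^+ 2 by rewrite lerXn2r ?nnegrE //; lra.
lra.
Qed.

Lemma fminus_expand g : 0 < g <= 2 -> exists2 C : R, 0 < C &
  forall x y, expR 2 <= x -> - x <= y -> let L := ln x in let u := y / x in
  is_true (fminus g (x + y) <= x `^ g *
   ((1 + g * u + g * (g - 1) / 2 * u ^+ 2 - (u + (2 * g - 1) / 2 * u ^+ 2) / L
     + C * u ^+ 2 / L ^+ 2) / L + C * (jump_tail (x / L ^+ 2) y / x ^+ 2))).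
Proof.
move=> hg; have [g0 g2] := andP hg; have [C0 C00 hC0] := @taylor_pow R; exists (10 * C0 + 20) => [|x y hx hy L u].
  by lra.
have e4 := expR2_ge4; have x0 : 0 < x by lra.
have L2 : 2 <= L by rewrite -ler_expR lnK ?posrE.
have Li : 0 < L^-1 <= 1 / 2.
  apply/andP; split; first by rewrite invr_gt0; lra.
  by rewrite div1r lef_pV2 ?posrE //; lra.
have jt0 : 0 <= jump_tail (x / L ^+ 2) y / x ^+ 2.
  by rewrite divr_ge0 ?jump_tail_ge0 ?sqr_ge0.
have LiE : L * L^-1 = 1 by rewrite mulfV // gt_eqF //; lra.
have u20 := sqr_ge0 u.
have [hu|hu] := leP `|u| (1 / 2); last first.
  apply: (le_trans (fminus_le_powR _ _)); apply: (le_trans (far_point hg x0 hy hu)).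
  rewrite ler_wpM2l ?powR_ge0 // jump_tail_far // -/u; clearbody u L.
  clear -g0 g2 C00 L2 Li u20 hu.
  have nu : `|u| ^+ 2 = u ^+ 2 by rewrite real_normK ?num_real.
  have au : `|u| <= 2 * u ^+ 2 by rewrite -nu; nra.
  have [au1 au2] : - `|u| <= u /\ u <= `|u| by rewrite ler_norm lerNl -normrN ler_norm.
  have o1 : 1 <= 4 * u ^+ 2 by rewrite -nu; nra.
  have p1 : - (9 * u ^+ 2) <= 1 + g * u + g * (g - 1) / 2 * u ^+ 2
     - (u + (2 * g - 1) / 2 * u ^+ 2) / L + (10 * C0 + 20) * u ^+ 2 / L ^+ 2.
    have t1 : - (4 * u ^+ 2) <= g * u by nra.
    have t2 : - u ^+ 2 <= g * (g - 1) / 2 * u ^+ 2.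
      by rewrite -[leLHS]mulN1r ler_wpM2r //; nra.
    have t3 : (u + (2 * g - 1) / 2 * u ^+ 2) / L <= 4 * u ^+ 2.
      have s1 : u + (2 * g - 1) / 2 * u ^+ 2 <= 4 * u ^+ 2.
        have : (2 * g - 1) / 2 * u ^+ 2 <= 2 * u ^+ 2 by rewrite ler_wpM2r //; lra.
        lra.
      apply: (@le_trans _ _ (4 * u ^+ 2 / L)); first by rewrite ler_wpM2r //; lra.
      have : 0 <= 4 * u ^+ 2 by lra.
      nra.
    have t4 : 0 <= (10 * C0 + 20) * u ^+ 2 / L ^+ 2.
      by rewrite divr_ge0 ?sqr_ge0 // mulr_ge0 //; lra.
    lra.
  have p2 : - (9 * u ^+ 2) <= - (9 * u ^+ 2) / L.
    have : 0 <= 9 * u ^+ 2 by lra.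
    by rewrite mulNr lerN2; nra.
  have p3 := ler_wpM2r (_ : 0 <= L^-1) p1.
  have := p3 _ => /(_ _)/(le_trans p2) p4.
  have {p4} := p4 (ltW (proj1 (andP Li))).
  have : 0 <= C0 * u ^+ 2 by rewrite mulr_ge0 // ltW.
  lra.
have [xy0 _ mx pw] := near_point hx hu.
have [tA tB tC] := hC0 g u hg hu.
have vb := ln1D_bound hu.
rewrite /fminus mx -/L pw -[leLHS]mulrA ler_wpM2l ?powR_ge0 //.
set A := (1 + y / x) `^ g; set v := ln (1 + y / x).
rewrite -/u -/A -/v in tA tB tC vb.
have c3 := cube_split (erefl u) x0 L2 hu.
have A0 : 0 <= A by rewrite powR_ge0.
have v1 : `|v| <= 1 by lra.
have [v1a v1b] : - 1 <= v /\ v <= 1 by move: v1; rewrite ler_norml => /andP.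
set J := jump_tail _ _ / _ in jt0 c3 *; clearbody J A v u L.
clear -C00 L2 Li LiE tA tB tC vb A0 v1a v1b jt0 c3.
have v2 : v ^+ 2 <= 4 * u ^+ 2.
  rewrite -(real_normK (num_real v)) -(real_normK (num_real u)).
  by move: vb (normr_ge0 v); clear; nra.
pose i := L^-1; have iE : L^-1 = i by [].
have [i0 i2] : 0 < i /\ i <= 1 / 2 by apply/andP.
clearbody i.
have s1 : A / (L + v) <= (A - A * v * i + 2 * A * v ^+ 2 * i ^+ 2) * i.
  rewrite ler_pdivrMr; last by move: L2 v1a; clear; lra.
  have -> : (A - A * v * i + 2 * A * v ^+ 2 * i ^+ 2) * i * (L + v) =
     A * ((1 - v * i + 2 * (v * i) ^+ 2) * (L * i + v * i)) by ring.
  rewrite -iE LiE iE -{1}(mulr1 A) ler_wpM2l //.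
  have vi : - (1 / 2) <= v * i by move: v1a i0 i2; clear; nra.
  by move: (v * i) vi; clear => s hs; have := sqr_ge0 s; nra.
apply: (le_trans s1); rewrite iE.
have tA1 : A <= 1 + g * u + g * (g - 1) / 2 * u ^+ 2 + C0 * `|u| ^+ 3.
  by move: tA; clear; rewrite ler_norml => /andP[]; lra.
have tB1 : u + (2 * g - 1) / 2 * u ^+ 2 - C0 * `|u| ^+ 3 <= A * v.
  by move: tB; clear; rewrite ler_norml => /andP[]; lra.
have i2E : L ^- 2 = i ^+ 2 by rewrite -exprVn iE.
rewrite i2E; rewrite i2E in c3.
have c4 : C0 * `|u| ^+ 3 <= C0 * (u ^+ 2 * i ^+ 2) + C0 * J.
  by rewrite -mulrDr ler_wpM2l // ltW.
have c5 : 2 * A * v ^+ 2 * i ^+ 2 <= 8 * (C0 * (u ^+ 2 * i ^+ 2)).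
  rewrite (_ : 8 * _ = 2 * C0 * (4 * u ^+ 2) * i ^+ 2); last by ring.
  rewrite ler_wpM2r ?sqr_ge0 //; apply: ler_pM; rewrite ?sqr_ge0 //; move: tC A0; clear; lra.
set c := C0 * `|u| ^+ 3 in tA1 tB1 c4.
have c0 : 0 <= c by rewrite mulr_ge0 ?exprn_ge0 // ltW.
set U := C0 * (u ^+ 2 * i ^+ 2) in c4 c5.
have ui0 : 0 <= u ^+ 2 * i ^+ 2 by apply: mulr_ge0; apply: sqr_ge0.
have U0 : 0 <= U by apply: mulr_ge0 => //; apply: ltW.
have CJ0 : 0 <= C0 * J by rewrite mulr_ge0 // ltW.
have main : A - A * v * i + 2 * A * v ^+ 2 * i ^+ 2 <=
  1 + g * u + g * (g - 1) / 2 * u ^+ 2 - (u + (2 * g - 1) / 2 * u ^+ 2) * i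
  + 10 * U + 2 * (C0 * J).
  have : (u + (2 * g - 1) / 2 * u ^+ 2 - c) * i <= A * v * i by rewrite ler_wpM2r // ltW.
  have : c * i <= c / 2 by rewrite ler_wpM2l //; move: i2; clear; lra.
  move: tA1 c4 c5 U0 CJ0 c0; clear; lra.
have := ler_wpM2r (ltW i0) main => /le_trans; apply.
rewrite -subr_ge0.
rewrite (_ : _ - _ = 20 * (u ^+ 2 * i ^+ 2) * i + (20 * J + 10 * (C0 * J) - 2 * (C0 * J) * i)); last first.
  by rewrite /U; ring.
have : 0 <= 20 * (u ^+ 2 * i ^+ 2) * i by apply: mulr_ge0; [apply: mulr_ge0|exact: ltW].
have : C0 * J * i <= C0 * J * (1 / 2) by rewrite ler_wpM2l.
move: jt0 CJ0; clear; lra.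
Qed.

Lemma fplus_expand g : 0 < g <= 2 -> exists2 C : R, 0 < C &
  forall x y Y, expR 2 <= x -> x <= Y -> - x <= y ->
  let L := ln x in let u := y / x in
  is_true (x `^ g * (L * (1 + g * u + g * (g - 1) / 2 * u ^+ 2)
     + (u + (2 * g - 1) / 2 * u ^+ 2) - C * u ^+ 2 / L
     - C * L * (jump_tail (x / L ^+ 2) y / x ^+ 2))
  <= Num.min (fplus g (x + y)) (fplus g (2 * Y))).
Proof.
move=> hg; have [g0 g2] := andP hg; have [C0 C00 hC0] := @taylor_pow R.
exists (2 * C0 + 20) => [|x y Y hx xY hy L u]; first lra.
have e4 := expR2_ge4; have x0 : 0 < x by lra.
have L2 : 2 <= L by rewrite -ler_expR lnK ?posrE.
have Li : 0 < L^-1 by rewrite invr_gt0; lra.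
have jt0 : 0 <= jump_tail (x / L ^+ 2) y / x ^+ 2.
  by rewrite divr_ge0 ?jump_tail_ge0 ?sqr_ge0.
have u20 := sqr_ge0 u.
have uL0 : 0 <= u ^+ 2 / L by rewrite divr_ge0 //; lra.
have [hu|hu] := leP `|u| (1 / 2); last first.
  apply: (@le_trans _ _ 0); last by rewrite le_min !fplus_ge0.
  rewrite -(mulr0 (x `^ g)) ler_wpM2l ?powR_ge0 // jump_tail_far // -/u; clearbody u L.
  clear -g0 g2 C00 L2 Li u20 uL0 hu.
  have nu : `|u| ^+ 2 = u ^+ 2 by rewrite real_normK ?num_real.
  have au : `|u| <= 2 * u ^+ 2 by rewrite -nu; nra.
  have au2 : u <= `|u| by rewrite ler_norm.
  have o1 : 1 <= 4 * u ^+ 2 by rewrite -nu; nra.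
  have t1 : g * u <= 4 * u ^+ 2 by nra.
  have t2 : g * (g - 1) / 2 * u ^+ 2 <= u ^+ 2.
    by rewrite -[leRHS]mul1r ler_wpM2r //; nra.
  have t3 : (2 * g - 1) / 2 * u ^+ 2 <= 2 * u ^+ 2 by rewrite ler_wpM2r //; lra.
  have t4 : L * (1 + g * u + g * (g - 1) / 2 * u ^+ 2) <= L * (9 * u ^+ 2).
    by rewrite ler_wpM2l //; lra.
  have t5 : 4 * u ^+ 2 <= L * (2 * u ^+ 2) by nra.
  have t6 : 0 <= C0 * u ^+ 2 / L by rewrite -mulrA mulr_ge0 // ltW.
  have t7 : 0 <= C0 * (L * u ^+ 2) by apply: mulr_ge0; [lra|apply: mulr_ge0; lra].
  have -> : (2 * C0 + 20) * u ^+ 2 / L = 2 * (C0 * u ^+ 2 / L) + 20 * (u ^+ 2 / L) by ring.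
  have -> : (2 * C0 + 20) * L * u ^+ 2 = 2 * (C0 * (L * u ^+ 2)) + 20 * (L * u ^+ 2) by ring.
  have t8 : 0 <= L * u ^+ 2 by rewrite mulr_ge0 //; lra.
  lra.
have [xy0 E mx pw] := near_point hx hu.
have [tA tB tC] := hC0 g u hg hu.
have u1 : u <= 1 / 2 by apply: le_trans (ler_norm _) hu.
have -> : Num.min (fplus g (x + y)) (fplus g (2 * Y)) = fplus g (x + y).
  apply/min_idPl/le_fplus => //; first exact: ltW.
  by rewrite E -/u; nra.
rewrite /fplus mx -/L pw -[leRHS]mulrA ler_wpM2l ?powR_ge0 //.
set A := (1 + y / x) `^ g; set v := ln (1 + y / x).
rewrite -/u -/A -/v in tA tB.
have c3 := cube_split (erefl u) x0 L2 hu.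
set J := jump_tail _ _ / _ in jt0 c3 *; clearbody J A v u L.
clear -C00 L2 Li u20 uL0 tA tB jt0 c3.
have tA1 : 1 + g * u + g * (g - 1) / 2 * u ^+ 2 - C0 * `|u| ^+ 3 <= A.
  by move: tA; clear; rewrite ler_norml => /andP[]; lra.
have tB1 : u + (2 * g - 1) / 2 * u ^+ 2 - C0 * `|u| ^+ 3 <= A * v.
  by move: tB; clear; rewrite ler_norml => /andP[]; lra.
set c := C0 * `|u| ^+ 3 in tA1 tB1.
have c0 : 0 <= c by rewrite mulr_ge0 ?exprn_ge0 // ltW.
have c4 : L * c <= C0 * (u ^+ 2 / L) + C0 * (L * J).
  rewrite -mulrDr /c mulrCA ler_wpM2l //; first exact: ltW.
  rewrite (_ : u ^+ 2 / L + L * J = L * (u ^+ 2 / L ^+ 2 + J)); last first.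
    by field; rewrite gt_eqF //; lra.
  by rewrite ler_wpM2l //; lra.
have t1 : L * (1 + g * u + g * (g - 1) / 2 * u ^+ 2 - c) <= L * A.
  by rewrite ler_wpM2l //; lra.
have t2 : c <= L * c by nra.
have LJ0 : 0 <= L * J by rewrite mulr_ge0 //; lra.
rewrite [leRHS]mulrDr (mulrC A L).
have -> : (2 * C0 + 20) * u ^+ 2 / L = 2 * (C0 * (u ^+ 2 / L)) + 20 * (u ^+ 2 / L) by ring.
have -> : (2 * C0 + 20) * L * J = 2 * (C0 * (L * J)) + 20 * (L * J) by ring.
move: t1; rewrite mulrBr; lra.
Qed.

End LyapunovFunctions.

Section DriftArith.
Context {R : realType}.
Implicit Types (g i W C e L : R).

Lemma fminus_drift_arith g i W C e (s2 : R) : 0 < i <= 1 / 2 -> 0 < g <= 2 -> 0 < W ->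
  0 < C -> 0 < s2 -> 0 < e -> C * i <= g / 8 -> (6 + 2 * C) * e <= s2 * g / 8 ->
  let q := g * (g - 1) / 2 - (2 * g - 1) / 2 * i + C * i ^+ 2 in
  is_true (W * i * (g - i) * (- (g - 1) * s2 / 2) + W * i * q * s2
    + (`|W * i * (g - i)| + `|W * i * q| + C * W * i) * (e * i)
    <= - (s2 * g / 4) * (W * i ^+ 2)).
Proof.
move=> /andP[i0 i2] /andP[g0 g2] W0 C0 s0 e0 Ci Ce q.
have Wi0 : 0 < W * i by rewrite mulr_gt0.
have n1 : `|W * i * (g - i)| <= W * i * 3.
  rewrite normrM gtr0_norm // ler_wpM2l //; first exact: ltW.
  by rewrite ler_norml; apply/andP; split; lra.
have ii0 : 0 <= i ^+ 2 by rewrite sqr_ge0.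
have ii1 : i ^+ 2 <= 1 by nra.
have Cii : 0 <= C * i ^+ 2 <= C.
  apply/andP; split; first by rewrite mulr_ge0 // ltW.
  by rewrite -[leRHS]mulr1 ler_wpM2l // ltW.
have qb : - 3 <= q <= 3 + C by rewrite /q; apply/andP; split; nra.
have n2 : `|W * i * q| <= W * i * (3 + C).
  rewrite normrM gtr0_norm // ler_wpM2l //; first exact: ltW.
  by rewrite ler_norml; apply/andP; split; lra.
have ei0 : 0 <= e * i by rewrite mulr_ge0 // ltW.
apply: (@le_trans _ _ (W * i * (g - i) * (- (g - 1) * s2 / 2) + W * i * q * s2 +
   (W * i * 3 + W * i * (3 + C) + C * W * i) * (e * i))).
  by rewrite lerD2l ler_wpM2r //; lra.
have -> : W * i * (g - i) * (- (g - 1) * s2 / 2) + W * i * q * s2 +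
   (W * i * 3 + W * i * (3 + C) + C * W * i) * (e * i) =
   (- (s2 * g / 2) + s2 * (C * i) + (6 + 2 * C) * e) * (W * i ^+ 2).
  by rewrite /q; field.
have WI : 0 <= W * i ^+ 2 by apply: mulr_ge0 => //; apply: ltW.
rewrite ler_wpM2r //.
have : s2 * (C * i) <= s2 * (g / 8) by rewrite ler_wpM2l // ltW.
lra.
Qed.

Lemma fplus_drift_arith g i L W C e (s2 : R) : 0 < i <= 1 / 2 -> L * i = 1 -> 0 < g <= 2 ->
  0 < W -> 0 < C -> 0 < s2 -> 0 < e -> C * i <= g / 8 -> (8 + 2 * C) * e <= s2 * g / 8 ->
  let q := L * (g * (g - 1) / 2) + (2 * g - 1) / 2 - C * i in
  is_true (s2 * g / 4 * W <=
    W * (L * g + 1) * (- (g - 1) * s2 / 2) + W * q * s2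
    - (`|W * (L * g + 1)| + `|W * q| + C * L * W * i) * (e * i)).
Proof.
move=> /andP[i0 i2] Li /andP[g0 g2] W0 C0 s0 e0 Ci Ce q.
have L0 : 0 < L by rewrite -(pmulr_lgt0 _ i0) Li.
have L2 : 2 <= L by nra.
have n1 : `|W * (L * g + 1)| <= W * (3 * L).
  rewrite normrM gtr0_norm // ler_wpM2l //; first exact: ltW.
  by rewrite ler_norml; apply/andP; split; nra.
have Ci0 : 0 <= C * i by rewrite mulr_ge0 // ltW.
have g1 : - 1 <= g * (g - 1) / 2 <= 1 by apply/andP; split; nra.
have [g1a g1b] := andP g1.
have q1 : - L <= L * (g * (g - 1) / 2) by nra.
have q2 : L * (g * (g - 1) / 2) <= L by nra.
have n2 : `|W * q| <= W * (3 * L).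
  rewrite normrM gtr0_norm // ler_wpM2l //; first exact: ltW.
  by rewrite /q ler_norml; apply/andP; split; lra.
have ei0 : 0 <= e * i by rewrite mulr_ge0 // ltW.
apply: (@le_trans _ _ (W * (L * g + 1) * (- (g - 1) * s2 / 2) + W * q * s2 -
   (W * (3 * L) + W * (3 * L) + C * L * W * 1) * (e * i))); last first.
  rewrite lerD2l lerN2 ler_wpM2r // lerD //; first exact: lerD.
  rewrite ler_wpM2l //; last lra.
  by rewrite !mulr_ge0 // ltW.
have -> : W * (L * g + 1) * (- (g - 1) * s2 / 2) + W * q * s2 -
   (W * (3 * L) + W * (3 * L) + C * L * W * 1) * (e * i) =
   (s2 * g / 2 - s2 * (C * i) - (6 + C) * e * (L * i)) * W.
  by rewrite /q; field.
rewrite Li mulr1 ler_wpM2r //; first exact: ltW.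
have : s2 * (C * i) <= s2 * (g / 8) by rewrite ler_wpM2l // ltW.
have : 0 <= C * e by rewrite mulr_ge0 // ltW.
lra.
Qed.

End DriftArith.

(** * Drift estimates *)

Section AtomDrift.
Context {R : realType} {d : measure_display} {T : measurableType d}.
Variables (mu : probability T R) (S : set R) (X : nat -> T -> R)
  (F : nat -> set (set T)).
Hypothesis hA0 : A0 mu S X F.
Implicit Types (t : nat) (A : set T) (x y : R).

(* [a] is at least (at most) the conditional mean of [f (X t.+1)] given
   [X t = x], uniformly over [t] and over the sigma-algebra [F t]. *)
Definition mean_ub (f : R -> R) x (a : R) := forall t A, (1 <= t)%N -> F t A ->
  A `<=` X t @^-1` [set x] ->
  (\int[mu]_(w in A) (f (X t.+1 w))%:E <= (a * pr mu A)%:E)%E.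

Definition mean_lb (f : R -> R) x (a : R) := forall t A, (1 <= t)%N -> F t A ->
  A `<=` X t @^-1` [set x] ->
  ((a * pr mu A)%:E <= \int[mu]_(w in A) (f (X t.+1 w))%:E)%E.

Variables (c s2 p : R).
Hypotheses (hA2 : A2 mu X F c s2) (p2 : 2 < p) (hM : Mp mu X F p).

Let s20 : 0 < s2. Proof. by case: hA2. Qed.

Lemma drift_bound_setup (e M : R) : 0 < e -> exists x0 : R, forall x, x0 <= x -> S x ->
  [/\ expR 2 <= x, 0 < x, M <= ln x, 0 < (ln x)^-1 <= 1 / 2 &
   forall t A, (1 <= t)%N -> F t A -> A `<=` X t @^-1` [set x] ->
     atom_moments mu X t A c s2 e x].
Proof.
move=> e0; have [x1 h1] := large_moments hA0 hA2 p2 hM e0.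
exists (Num.max x1 (expR (Num.max M 2))) => x; rewrite ge_max => /andP[xx1 xM] Sx.
have x0 : 0 < x by apply: lt_le_trans xM; apply: expR_gt0.
have : Num.max M 2 <= ln x by rewrite -ler_expR lnK.
rewrite ge_max => /andP[ML L2]; split => //.
- by rewrite -[leRHS]lnK ?posrE // ler_expR.
- apply/andP; split; first by rewrite invr_gt0; lra.
  by rewrite div1r lef_pV2 ?posrE; lra.
- by move=> t A t1 FA AX; apply: h1.
Qed.

Variable g : R.
Hypothesis hg : 0 < g.
Hypothesis cE : c = - (g - 1) * s2 / 2.

Lemma fminus_drift : g <= 2 -> exists2 x0 : R, 1 < x0 & forall x, x0 <= x -> S x ->
  mean_ub (fminus g) x (fminus g x - s2 * g / 4 * (x `^ (g - 2) / ln x ^+ 2)).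
Proof.
move=> g2; have hg2 : 0 < g <= 2 by rewrite hg.
have [C C0 hC] := fminus_expand hg2.
pose e := s2 * g / 8 / (6 + 2 * C).
have e0 : 0 < e by rewrite /e !divr_gt0 ?mulr_gt0 //; lra.
have [x0 hx0] := drift_bound_setup (8 * C / g) e0.
exists (Num.max x0 2) => [|x]; first by rewrite lt_max; apply/orP; right; lra.
rewrite ge_max => /andP[xx0 _] Sx t A t1 FA AX.
have [xe xp Lbig Li hm] := hx0 x xx0 Sx; have {}hm := hm t A t1 FA AX.
have [i0 i2] := andP Li.
have L0 : 0 < ln x by rewrite -invr_gt0.
have L1 : 1 <= ln x by rewrite -ler_expR lnK ?posrE //; apply: le_trans xe; rewrite ler_expR; lra.
have LiE : ln x * (ln x)^-1 = 1 by rewrite mulfV // gt_eqF.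
pose P := x `^ g; pose W := x `^ (g - 2); pose i := (ln x)^-1.
have WE : W = P / x ^+ 2.
  rewrite /W /P powR_add // (_ : x `^ (- 2) = x ^- 2) // -powR_mulrn ?(ltW xp) //.
  by rewrite -powRN.
have W0 : 0 < W by rewrite powR_gt0.
pose q := g * (g - 1) / 2 - (2 * g - 1) / 2 * i + C * i ^+ 2.
have fx : fminus g x = P * i.
  by rewrite /fminus (_ : Num.max (ln x) 1 = ln x) //; apply/max_idPl.
apply: (le_trans (drift_le (a0 := P * i) (a1 := W * i * (g - i) * x)
  (a2 := W * i * q) (a3 := C * W) hA0 t1 FA AX xp _ hm (fminus_ge0 g) _)).
- by rewrite mulr_ge0 // ltW.
- move=> y hy; apply: (le_trans (hC x y xe hy)).
  rewrite -/P le_eqVlt; apply/orP; left; apply/eqP; rewrite /q WE /i.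
  by field; rewrite !gt_eqF.
rewrite lee_fin ler_wpM2r ?pr_ge0 //.
have Ci : C * i <= g / 8.
  rewrite /i ler_pdivrMr //; move: Lbig; rewrite ler_pdivrMr //; lra.
have Ce : (6 + 2 * C) * e <= s2 * g / 8.
  by rewrite /e mulrC divfK // gt_eqF //; lra.
have main := fminus_drift_arith Li hg2 W0 C0 s20 e0 Ci Ce.
cbv zeta in main; rewrite -/i -/q in main.
rewrite fx cE (normrM _ x) (gtr0_norm xp).
rewrite (_ : W / ln x ^+ 2 = W * i ^+ 2); last by rewrite -exprVn.
have xn : x != 0 by rewrite gt_eqF.
rewrite (_ : P * i + W * i * (g - i) * x * (- (g - 1) * s2 / 2 / x) + _ + _ =
  P * i + (W * i * (g - i) * (- (g - 1) * s2 / 2) + W * i * q * s2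
    + (`|W * i * (g - i)| + `|W * i * q| + C * W * i) * (e * i))); last first.
  by rewrite mulfK // /i; field; rewrite xn gt_eqF.
by rewrite lerD2l -mulNr.
Qed.

Lemma fplus_drift : g <= 2 -> exists2 x0 : R, 1 < x0 & forall x Y, x0 <= x -> x <= Y -> S x ->
  mean_lb (fun z => Num.min (fplus g z) (fplus g (2 * Y))) x
    (fplus g x + s2 * g / 4 * x `^ (g - 2)).
Proof.
move=> g2; have hg2 : 0 < g <= 2 by rewrite hg.
have [C C0 hC] := fplus_expand hg2.
pose e := s2 * g / 8 / (8 + 2 * C).
have e0 : 0 < e by rewrite /e !divr_gt0 ?mulr_gt0 //; lra.
have [x0 hx0] := drift_bound_setup (8 * C / g) e0.
exists (Num.max x0 2) => [|x Y]; first by rewrite lt_max; apply/orP; right; lra.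
rewrite ge_max => /andP[xx0 _] xY Sx t A t1 FA AX.
have [xe xp Lbig Li hm] := hx0 x xx0 Sx; have {}hm := hm t A t1 FA AX.
have [i0 i2] := andP Li.
have L0 : 0 < ln x by rewrite -invr_gt0.
have L1 : 1 <= ln x by rewrite -ler_expR lnK ?posrE //; apply: le_trans xe; rewrite ler_expR; lra.
have LiE : ln x * (ln x)^-1 = 1 by rewrite mulfV // gt_eqF.
pose P := x `^ g; pose W := x `^ (g - 2); pose i := (ln x)^-1; pose L := ln x.
have WE : W = P / x ^+ 2.
  rewrite /W /P powR_add // (_ : x `^ (- 2) = x ^- 2) // -powR_mulrn ?(ltW xp) //.
  by rewrite -powRN.
have W0 : 0 < W by rewrite powR_gt0.
pose q := L * (g * (g - 1) / 2) + (2 * g - 1) / 2 - C * i.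
have fx : fplus g x = P * L.
  by rewrite /fplus (_ : Num.max (ln x) 1 = ln x) //; apply/max_idPl.
apply: (le_trans _ (drift_ge
  (f := fun z => Num.min (fplus g z) (fplus g (2 * Y))) (a0 := P * L) (a1 := W * (L * g + 1) * x)
  (a2 := W * q) (a3 := C * L * W) hA0 t1 FA AX xp _ hm _ _)); first last.
- move=> y hy; apply: (le_trans _ (hC x y Y xe xY hy)).
  rewrite -/P le_eqVlt; apply/orP; left; apply/eqP; rewrite /q WE /i /L.
  by field; rewrite !gt_eqF.
- by move=> z; rewrite le_min !fplus_ge0.
- by rewrite !mulr_ge0 // ltW.
rewrite lee_fin ler_wpM2r ?pr_ge0 //.
have Ci : C * i <= g / 8.
  rewrite /i ler_pdivrMr //; move: Lbig; rewrite ler_pdivrMr //; lra.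
have Ce : (8 + 2 * C) * e <= s2 * g / 8.
  by rewrite /e mulrC divfK // gt_eqF //; lra.
have main := fplus_drift_arith Li LiE hg2 W0 C0 s20 e0 Ci Ce.
cbv zeta in main; rewrite -/i -/L -/q in main.
rewrite fx cE (normrM _ x) (gtr0_norm xp).
have xn : x != 0 by rewrite gt_eqF.
rewrite [leRHS](_ : _ =
  P * L + (W * (L * g + 1) * (- (g - 1) * s2 / 2) + W * q * s2
    - (`|W * (L * g + 1)| + `|W * q| + C * L * W * i) * (e * i))); last first.
  by rewrite mulfK // /i /L; field; rewrite xn gt_eqF.
by rewrite lerD2l.
Qed.

Lemma square_drift : 2 < g -> exists2 x0 : R, 1 < x0 & forall x, x0 <= x -> S x ->
  mean_ub (fun z => z ^+ 2) x (x ^+ 2 - (g - 2) * s2 / 2).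
Proof.
move=> g2; pose e := (g - 2) * s2 / 6.
have e0 : 0 < e by rewrite /e !mulr_gt0 //; lra.
have [x0 hx0] := drift_bound_setup 1 e0.
exists (Num.max x0 2) => [|x]; first by rewrite lt_max; apply/orP; right; lra.
rewrite ge_max => /andP[xx0 _] Sx t A t1 FA AX.
have [xe xp L1 Li hm] := hx0 x xx0 Sx; have {}hm := hm t A t1 FA AX.
have [i0 i2] := andP Li.
apply: (le_trans (drift_le (a0 := x ^+ 2) (a1 := 2 * x)
  (a2 := 1) (a3 := 0) hA0 t1 FA AX xp _ hm (@sqr_ge0 _) _)) => //.
  by move=> y _; rewrite mul0r addr0 mul1r sqrrD mulr_natl mulrnAl.
rewrite lee_fin ler_wpM2r ?pr_ge0 // normr1 mul0r addr0 cE.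
have xn : x != 0 by rewrite gt_eqF.
rewrite gtr0_norm ?mulr_gt0 // mulfK //.
rewrite (_ : 2 * x * (- (g - 1) * s2 / 2 / x) = - (g - 1) * s2); last by field.
have : e / ln x <= e by rewrite ler_pdivrMr ?ler_peMr //; lra.
rewrite {2}/e; lra.
Qed.

Lemma dip_drift : exists2 K : R, 0 < K & exists2 x0 : R, 1 < x0 & forall x (Y : R), x0 <= x ->
  Y / 2 <= x -> S x ->
  mean_ub (fun z => Num.max (Y - z) 0 ^+ 2) x (Num.max (Y - x) 0 ^+ 2 + K).
Proof.
exists (2 * `|c| + s2 + 3); first by have := s20; have := normr_ge0 c; lra.
have [x0 hx0] := drift_bound_setup 1 (@ltr01 R).
exists (Num.max x0 2) => [|x Y]; first by rewrite lt_max; apply/orP; right; lra.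
rewrite ge_max => /andP[xx0 _] xY Sx t A t1 FA AX.
have [xe xp L1 Li hm] := hx0 x xx0 Sx; have {}hm := hm t A t1 FA AX.
set b := Num.max (Y - x) 0.
have b0 : 0 <= b by rewrite le_max lexx orbT.
have bY : Y - x <= b by rewrite le_max lexx.
have bx : b <= x by rewrite ge_max (ltW xp) andbT; lra.
apply: (le_trans (drift_le (f := fun z => Num.max (Y - z) 0 ^+ 2) (a0 := b ^+ 2) (a1 := - 2 * b)
  (a2 := 1) (a3 := 0) hA0 t1 FA AX xp _ hm (fun z => sqr_ge0 _) _)) => //.
  move=> y _; rewrite mul0r addr0 mul1r.
  have [h|h] := leP (Y - (x + y)) 0.
    by rewrite expr0n /= [leRHS](_ : _ = (b - y) ^+ 2) ?sqr_ge0 //; ring.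
  rewrite [leRHS](_ : _ = (b - y) ^+ 2); last by ring.
  by rewrite lerXn2r ?nnegrE; lra.
rewrite lee_fin ler_wpM2r ?pr_ge0 // normr1 mul0r addr0 mul1r.
rewrite normrM normrN (ger0_norm b0) ger0_norm //.
have bx1 : b / x <= 1 by rewrite ler_pdivrMr ?mul1r.
have bx0 : 0 <= b / x by rewrite divr_ge0 // ltW.
have l1 : 1 / ln x <= 1 by rewrite ler_pdivrMr ?mul1r; lra.
have l0 : 0 < 1 / ln x by rewrite div1r; case/andP: Li.
have c1 : - 2 * b * (c / x) <= 2 * `|c|.
  rewrite (_ : - 2 * b * (c / x) = 2 * (- c * (b / x))); last by ring.
  rewrite ler_wpM2l //; apply: (@le_trans _ _ (`|c| * (b / x))).
    by rewrite ler_wpM2r // -normrN ler_norm.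
  by rewrite -[leRHS]mulr1 ler_wpM2l.
have c2 : (2 * b / x + 1) * (1 / ln x) <= 3.
  rewrite -[leRHS]mulr1; apply: ler_pM => //.
  - by rewrite -mulrA; lra.
  - exact: ltW.
  - by rewrite -mulrA; lra.
lra.
Qed.

Lemma bounded_mean (f : R -> R) (x0 : R) : (forall z, 0 <= f z) ->
  (forall z : R, 0 <= z -> f z <= 1 + z ^+ 2) -> exists2 K : R, 0 <= K &
  forall x, x < x0 -> S x -> mean_ub f x K.
Proof.
move=> f0 hf; have [K [K0 hK]] := Mp_bounded hA0 x0 p2 hM.
exists (1 + 2 * x0 ^+ 2 + 2 * K); first by have := sqr_ge0 x0; lra.
move=> x xx0 Sx t A t1 FA AX; have mA := filtration_measurable hA0 t1 FA.
have b2 := hK x t A (ltW xx0) Sx t1 FA AX.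
have xge0 : 0 <= x by case: hA0 => -[_ _ + _] _; apply.
have i2 := sq_integrable_bound hA0 t1 mA b2.
have [ig eg] := integral_jump_poly hA0 (1 + 2 * x ^+ 2) 0 2 0 0 t1 mA i2.
apply: (@le_trans _ _ (\int[mu]_(w in A) (1 + 2 * x ^+ 2 + 0 * Delta X t w +
    2 * Delta X t w ^+ 2 + 0 * jump_tail 0 (Delta X t w))%:E)%E).
  apply: ge0_le_integral => //.
  - by move=> w _; rewrite lee_fin.
  - apply: (@measurable_funTS _ _ _ _ _ (EFin \o f \o X t.+1)).
    exact: (measurable_state_fun hA0 (EFin \o f)).
  - exact: measurable_int ig.
  - move=> w Aw; rewrite lee_fin !mul0r !addr0.
    have E : X t.+1 w = x + Delta X t w by rewrite /Delta (AX _ Aw) addrC subrK.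
    apply: (le_trans (hf _ _)); first exact: (state_ge0 hA0).
    by rewrite E; have := sqr_ge0 (x - Delta X t w); nra.
rewrite eg lee_fin !mul0r !addr0.
have : \int[mu]_(w in A) Delta X t w ^+ 2 <= K * pr mu A.
  by rewrite -lee_fin /Rintegral fineK //; exact: (integrable_fin_num mA i2).
have : x ^+ 2 * pr mu A <= x0 ^+ 2 * pr mu A.
  by rewrite ler_wpM2r ?pr_ge0 // lerXn2r ?nnegrE; lra.
lra.
Qed.

End AtomDrift.

(** * Estimates for one excursion *)

Section Estimates.
Context {R : realType} {d : measure_display} {T : measurableType d}.
Variables (mu : probability T R) (S : set R) (X : nat -> T -> R)
  (F : nat -> set (set T)).
Hypothesis hA0 : A0 mu S X F.
Implicit Types (t n : nat) (A : set T) (x y : R).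

Let mX t (f : R -> R) A : (1 <= t)%N -> measurable_fun A (fun w => (f (X t w))%:E).
Proof.
move=> t1; apply: (@measurable_funTS _ _ _ _ _ (EFin \o f \o X t)).
exact: (measurable_state_fun hA0 (EFin \o f)).
Qed.

Let mXp t (B : set R) : (1 <= t)%N -> measurable (X t @^-1` B).
Proof. by move=> t1; exact: (filtration_measurable hA0 t1 (adapted_any hA0 _ t1)). Qed.

Lemma mean_ub_le (f : R -> R) x (a b : R) : a <= b ->
  mean_ub mu X F f x a -> mean_ub mu X F f x b.
Proof.
move=> ab h t A t1 FA AX; apply: (le_trans (h t A t1 FA AX)).
by rewrite lee_fin ler_wpM2r // pr_ge0.
Qed.

Lemma mean_ub_integral t A (f G H : R -> R) : (1 <= t)%N -> F t A ->
  (forall x, 0 <= f x) -> (forall x, 0 <= G x) -> (forall x, 0 <= H x) ->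
  (forall w, A w ->
     mean_ub mu X F f (X t w) (f (X t w) + H (X t w) - G (X t w))) ->
  (\int[mu]_(w in A) (f (X t.+1 w))%:E + \int[mu]_(w in A) (G (X t w))%:E
   <= \int[mu]_(w in A) (f (X t w))%:E + \int[mu]_(w in A) (H (X t w))%:E)%E.
Proof.
move=> t1 FA f0 G0 H0 h; have mA := filtration_measurable hA0 t1 FA.
rewrite -!ge0_integralD //; try exact: mX.
all: try by move=> w _; rewrite lee_fin.
apply: (atom_integral_le hA0 t1 FA).
- by apply: emeasurable_funD; apply: mX.
- by apply: emeasurable_funD; apply: mX.
- by move=> w; rewrite adde_ge0 // lee_fin.
- by move=> w; rewrite adde_ge0 // lee_fin.
move=> x Sx; set A' := A `&` _.
have FA' : F t A'.
  by apply: sigma_algebraI => //; [exact: (filtration_sigma hA0)|exact: (adapted_any hA0)].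
have mA' := filtration_measurable hA0 t1 FA'.
case: (eqVneq A' set0) => [A'0|/set0P[w0 A'w0]]; first by rewrite A'0 !integral_set0.
rewrite !ge0_integralD //; try exact: mX.
all: try by move=> w _; rewrite lee_fin.
have cE (q : R -> R) : (\int[mu]_(w in A') (q (X t w))%:E = (q x * pr mu A')%:E)%E.
  rewrite -integral_cstE //; apply: eq_integral => w; rewrite inE => -[_ /= ->] //.
rewrite !cE; case: A'w0 => Aw0 Xw0.
have := h w0 Aw0; rewrite Xw0 => /(_ t A' t1 FA' (@subIsetr _ _ _)) hx.
apply: (le_trans (leeD hx (lexx _))).
by rewrite -!EFinD lee_fin -!mulrDl ler_wpM2r ?pr_ge0 // subrK.
Qed.

Lemma mean_lb_integral t A (f : R -> R) (k : R) : (1 <= t)%N -> F t A ->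
  (forall x, 0 <= f x) -> 0 <= k ->
  (forall w, A w -> mean_lb mu X F f (X t w) (f (X t w) + k)) ->
  (\int[mu]_(w in A) (f (X t w))%:E + (k * pr mu A)%:E
   <= \int[mu]_(w in A) (f (X t.+1 w))%:E)%E.
Proof.
move=> t1 FA f0 k0 h; have mA := filtration_measurable hA0 t1 FA.
rewrite -integral_cstE // -ge0_integralD //; try exact: mX.
all: try by move=> w _; rewrite lee_fin.
apply: (atom_integral_le hA0 t1 FA).
- by apply: emeasurable_funD => //; apply: mX.
- exact: mX.
- by move=> w; rewrite adde_ge0 // lee_fin.
- by move=> w; rewrite lee_fin.
move=> x Sx; set A' := A `&` _.
have FA' : F t A'.
  by apply: sigma_algebraI => //; [exact: (filtration_sigma hA0)|exact: (adapted_any hA0)].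
have mA' := filtration_measurable hA0 t1 FA'.
case: (eqVneq A' set0) => [A'0|/set0P[w0 A'w0]]; first by rewrite A'0 !integral_set0.
case: A'w0 => Aw0 Xw0.
have := h w0 Aw0; rewrite Xw0 => /(_ t A' t1 FA' (@subIsetr _ _ _)); apply: le_trans.
rewrite -integral_cstE //; rewrite le_eqVlt; apply/orP; left; apply/eqP.
by apply: eq_integral => w; rewrite inE => -[_ /= ->]; rewrite EFinD.
Qed.

Definition stay_below y t := alive X t `&` [set w | forall s, (1 <= s <= t)%N -> X s w <= y].

Definition overshoot y t := stay_below y t `&` X t.+1 @^-1` [set x | y < x].

Lemma filtration_stay_below y t : (1 <= t)%N -> F t (stay_below y t).
Proof.
move=> t1; apply: sigma_algebraI; first exact: (filtration_sigma hA0).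
  exact: (filtration_alive hA0).
exact: (@filtration_stay _ _ _ _ _ _ _ hA0 1 t (fun _ => [set x | x <= y])).
Qed.

Lemma measurable_stay_below y t : (1 <= t)%N -> measurable (stay_below y t).
Proof. by move=> t1; exact: (filtration_measurable hA0 t1 (filtration_stay_below y t1)). Qed.

Lemma measurable_overshoot y t : (1 <= t)%N -> measurable (overshoot y t).
Proof. by move=> t1; apply: measurableI; [exact: measurable_stay_below|exact: mXp]. Qed.

Lemma stay_belowS y t : stay_below y t.+1 `<=` stay_below y t.
Proof.
move=> w [al h]; split; first by apply: alive_le al; lia.
by move=> s hs; apply: h; lia.
Qed.

Lemma start_ae : {ae mu, forall w, X 1%N w = 0}.
Proof.
have mS : measurable [set w | X 1%N w = 0] by apply: (mXp [set 0]).
apply: ae_pr1 => //; rewrite /pr.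
by case: hA0 => _ [_ _ _ _ ->].
Qed.

Lemma excursion_bound (f : R -> R) (x0 y k K fy Kocc : R) :
  (forall x, 0 <= f x) -> 0 <= k -> 0 <= K -> 0 <= fy ->
  (forall x, x0 <= x <= y -> S x -> mean_ub mu X F f x (f x - k)) ->
  (forall x, x < x0 -> S x -> mean_ub mu X F f x (f x + K)) ->
  (forall n, \sum_(i < n) pr mu (alive X i.+1 `&` X i.+1 @^-1` [set x | x < x0]) <= Kocc) ->
  (forall x, y < x -> fy <= f x) ->
  forall n, k * (\sum_(i < n) pr mu (stay_below y i.+1))
    + fy * (\sum_(i < n) pr mu (overshoot y i.+1)) <= f 0 + (K + k) * Kocc.
Proof.
move=> f0 k0 K0 fy0 hbig hsmall hocc hfy n.
pose V := stay_below y.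
pose gg i := (k * pr mu (V i.+1))%:E.
pose hh i := ((K + k) * pr mu (alive X i.+1 `&` X i.+1 @^-1` [set x | x < x0]))%:E.
have step i : (\int[mu]_(w in V (1 + i)%N) (f (X (1 + i).+1 w))%:E + gg i
      <= \int[mu]_(w in V (1 + i)%N) (f (X (1 + i)%N w))%:E + hh i)%E.
  have t1 : (1 <= 1 + i)%N by lia.
  have FV := filtration_stay_below y t1.
  pose H x := if x < x0 then K + k else 0.
  have H0 x : 0 <= H x by rewrite /H; case: ifP => // _; lra.
  have := @mean_ub_integral (1 + i)%N (V (1 + i)%N) f (fun=> k) H t1 FV f0 (fun=> k0) H0.
  rewrite integral_cstE; last exact: measurable_stay_below.
  move=> /(_ _)/le_trans; apply.
    move=> w Vw; rewrite /H; case: ifPn => [h|].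
      apply: mean_ub_le (hsmall _ h (state_in hA0 _ t1)); lra.
    rewrite -leNgt => h; rewrite addr0; apply: hbig (state_in hA0 _ t1).
    by rewrite h; case: Vw => _; apply; lia.
  apply: leeD => //; rewrite /hh.
  have mB : measurable (V (1 + i)%N `&` X (1 + i)%N @^-1` [set x | x < x0]).
    by apply: measurableI; [exact: measurable_stay_below|exact: mXp].
  have -> : (\int[mu]_(w in V (1 + i)%N) (H (X (1 + i)%N w))%:E =
    ((K + k) * pr mu (V (1 + i)%N `&` X (1 + i)%N @^-1` [set x | x < x0]))%:E)%E.
    rewrite (integral_shrink hA0 t1 _ mB (@subIsetl _ _ _) H0) ?addr0;
      last exact: measurable_stay_below.
    rewrite -integral_cstE // [X in (_ + X)%E]integral0_eq ?adde0.
      by apply: eq_integral => w; rewrite inE /H => -[_ /= ->].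
    move=> w [Vw nB]; rewrite /H; case: ifPn => // h.
    by exfalso; apply: nB; split.
  rewrite lee_fin ler_wpM2l ?addr_ge0 //; apply: le_pr => //.
    by apply: measurableI; [exact: (measurable_alive hA0)|exact: mXp].
  by move=> w [[al _] hx].
have main := @stopped_mean_super _ _ _ mu S X F hA0 1 V f isT
  (fun t ht => filtration_stay_below y ht) (fun t _ => @stay_belowS y t) f0 gg hh n step.
have init : (\int[mu]_(w in V 1%N) (f (X 1%N w))%:E <= (f 0)%:E)%E.
  apply: (@le_trans _ _ (f 0 * pr mu (V 1%N))%:E); last first.
    by rewrite lee_fin ler_piMr // pr_le1 //; exact: measurable_stay_below.
  rewrite -integral_cstE; last exact: measurable_stay_below.
  apply: ae_ge0_le_integral => //.
  - exact: measurable_stay_below.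
  - by move=> w _; rewrite lee_fin.
  - exact: mX.
  - by move=> w _; rewrite lee_fin.
  - by apply: filterS start_ae => w -> _.
have := le_trans main (leeD init (lexx _)) => {}main.
have exit i : ((fy * pr mu (overshoot y i.+1))%:E <=
   \int[mu]_(w in V (1 + i)%N `\` V (1 + i).+1) (f (X (1 + i).+1 w))%:E)%E.
  have mD : measurable (V (1 + i)%N `\` V (1 + i).+1).
    by apply: measurableD; apply: measurable_stay_below.
  rewrite -integral_cstE; last exact: measurable_overshoot.
  apply: (@le_trans _ _ (\int[mu]_(w in overshoot y i.+1) (f (X (1 + i).+1 w))%:E)%E).
    apply: ge0_le_integral => //.
    - exact: measurable_overshoot.
    - exact: mX.
    - by move=> w [_ /= h]; rewrite lee_fin hfy.
  apply: ge0_subset_integral => //.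
  - exact: measurable_overshoot.
  - exact: mX.
  - by move=> w _; rewrite lee_fin.
  - move=> w [h1 /= h2]; split => // -[_] /(_ (1 + i).+1) h3.
    by have := h3 _; rewrite leNgt h2 => /(_ ltac:(lia)).
rewrite -lee_fin EFinD addeC.
apply: (@le_trans _ _ (stopped_mean mu X 1 V f n + \sum_(i < n) gg i)%E).
  apply: leeD; last by rewrite /gg sumEFin mulr_sumr.
  rewrite mulr_sumr -sumEFin /stopped_mean; apply: (@le_trans _ _
    (\sum_(i < n) \int[mu]_(w in V (1 + i)%N `\` V (1 + i).+1) (f (X (1 + i).+1 w))%:E)%E).
    by apply: lee_sum => i _; apply: exit.
  by apply: leeDr; apply: integral_ge0 => w _; rewrite lee_fin.
apply: (le_trans main); rewrite /hh sumEFin -EFinD lee_fin lerD2l -mulr_sumr.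
by rewrite ler_wpM2l ?addr_ge0.
Qed.

Lemma alive_split y n : 0 <= y ->
  pr mu (alive X n.+1) <= pr mu (stay_below y n.+1)
    + \sum_(i < n) pr mu (overshoot y i.+1).
Proof.
move=> y0; pose E n := alive X n.+1 `\` stay_below y n.+1.
have mE m : measurable (E m).
  by apply: measurableD; [exact: (measurable_alive hA0)|exact: measurable_stay_below].
rewrite -lerBlDl -prD; first last.
- by move=> w [].
- exact: measurable_stay_below.
- exact: (measurable_alive hA0).
rewrite -/(E n); elim: n => [|n IH].
  rewrite big_ord0; apply: (@le_trans _ _ (pr mu set0)); last by rewrite /pr measure0.
  apply: pr_ae_le => //; apply: filterS start_ae => w Xw [_ []]; split.
    by move=> s; lia.
  by move=> s hs; rewrite (_ : s = 1%N) ?Xw //; lia.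
rewrite big_ord_recr /=; apply: le_trans (lerD IH (lexx _)).
apply: le_trans (prU_le _ _ _) => //; last exact: measurable_overshoot.
apply: le_pr => //; first by apply: measurableU => //; exact: measurable_overshoot.
move=> w [al ns]; have al' : alive X n.+1 w by apply: alive_le al.
have [sb|nsb] := pselect (stay_below y n.+1 w); [right|by left].
split => //=; rewrite ltNge; apply/negP => le_y; apply: ns; split => // s hs.
have [|h] := leqP s n.+1; first by move=> h; case: sb => _; apply; lia.
by rewrite (_ : s = n.+2) //; lia.
Qed.

Definition recurrent := forall e : R, 0 < e -> exists n, pr mu (alive X n.+1) <= e.

Lemma decreasing_sum_bound (a : nat -> R) (K : R) n :
  (forall i, a i.+1 <= a i) -> (\sum_(i < n.+1) a i <= K) -> n.+1%:R * a n <= K.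
Proof.
move=> ha; apply: le_trans.
have hij i j : (i <= j)%N -> a j <= a i.
  by elim: j => [|j IH]; rewrite ?leqn0; [move=> /eqP->|rewrite leq_eqVlt => /orP[/eqP->//|/IH]; apply: le_trans].
rewrite -[n.+1 in leLHS]card_ord -sumr_const mulr_suml ler_sum // => i _.
by rewrite mul1r hij // -ltnS.
Qed.

End Estimates.

Section Recurrence.
Context {R : realType} {d : measure_display} {T : measurableType d}.
Variables (mu : probability T R) (S : set R) (X : nat -> T -> R)
  (F : nat -> set (set T)).
Hypotheses (hA0 : A0 mu S X F) (hA1 : A1 mu S X F).
Variables (c s2 p : R).
Hypotheses (hA2 : A2 mu X F c s2) (p2 : 2 < p) (hM : Mp mu X F p).
Variable g : R.
Hypotheses (g0 : 0 < g) (cE : c = - (g - 1) * s2 / 2).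
Implicit Types (n : nat) (x y : R).

Let s20 : 0 < s2. Proof. by case: hA2. Qed.

Lemma le_fminus x y : 1 <= ln y -> 1 / g <= ln y -> 0 < y -> y <= x ->
  fminus g y <= fminus g x.
Proof.
move=> L1 Lg y0 yx; have x0 : 0 < x by apply: lt_le_trans yx.
have Lyx : ln y <= ln x by rewrite ler_ln.
rewrite /fminus (max_idPl L1) (max_idPl (le_trans L1 Lyx)).
rewrite ler_pdivrMr; last lra.
rewrite mulrAC ler_pdivlMr; last lra.
have lnx : ln x = ln y + ln (x / y) by rewrite -lnM ?posrE ?divr_gt0 // mulrC divfK // gt_eqF.
have xg : x `^ g = y `^ g * expR (g * ln (x / y)).
  have xy : x = y * (x / y) by rewrite mulrC divfK // gt_eqF.
  rewrite {1}xy powRM ?(ltW y0) ?(ltW (divr_gt0 x0 y0)) //; congr (_ * _).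
  by rewrite /powR gt_eqF // divr_gt0.
rewrite xg -mulrA ler_wpM2l ?powR_ge0 // lnx.
have l0 : 0 <= ln (x / y) by rewrite ln_ge0 // ler_pdivlMr ?mul1r.
have e1 := expR_ge1Dx (g * ln (x / y)).
have gL : 1 <= g * ln y by move: Lg; rewrite ler_pdivrMr // mulrC.
apply: (@le_trans _ _ ((1 + g * ln (x / y)) * ln y)); last by rewrite ler_wpM2r //; lra.
rewrite mulrDl mul1r lerD2l mulrAC; nra.
Qed.

Lemma null_estimates : g <= 2 -> exists2 K : R, 0 < K & exists2 y0 : R, 1 <= y0 &
  forall y n, y0 <= y ->
    \sum_(i < n) pr mu (stay_below X y i.+1) <= K * (y `^ (2 - g) * ln y ^+ 2) /\
    \sum_(i < n) pr mu (overshoot X y i.+1) <= K * (ln y * y `^ (- g)).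
Proof.
move=> g2; have [x0 x01 hbig] := fminus_drift hA0 hA2 p2 hM g0 cE g2.
have fb z : 0 <= z -> fminus g z <= 1 + z ^+ 2.
  move=> z0; apply: (le_trans (fminus_le_powR _ _)).
  have [z1|z1] := leP z 1.
    rewrite -[leLHS]addr0 lerD ?sqr_ge0 //; apply: (@le_trans _ _ (1 `^ g)).
      by apply: ge0_ler_powR; rewrite ?nnegrE ?(ltW g0).
    by rewrite powR1.
  by rewrite -[leLHS]add0r lerD // powR_ge1_le_sq // ltW.
have [K K0 hsmall] := bounded_mean hA0 p2 hM x0 (@fminus_ge0 R g) fb.
have [Kocc hocc] := occupation_bound hA0 hA1 x0.
have Kocc0 : 0 <= Kocc by have := hocc 0%N; rewrite big_ord0.
pose k0 := s2 * g / 4; have k00 : 0 < k0 by rewrite /k0 !mulr_gt0.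
pose K1 := (K + k0) * Kocc + 1.
have Kk0 : 0 <= (K + k0) * Kocc by apply: mulr_ge0 => //; lra.
have K10 : 0 < K1 by rewrite /K1; lra.
exists (K1 + K1 / k0); first by rewrite addr_gt0 // divr_gt0.
exists (Num.max x0 (expR (1 + 1 / g))).
  by rewrite le_max (ltW x01).
move=> y n; rewrite ge_max => /andP[yx0 ye].
have y1 : 1 < y by lra.
have y0 : 0 < y by lra.
have ig0 : 0 < 1 / g by rewrite divr_gt0.
have Lg : 1 + 1 / g <= ln y by rewrite -ler_expR lnK ?posrE.
have L1 : 1 <= ln y by lra.
have L0 : 0 < ln y by lra.
pose k := k0 * (y `^ (g - 2) / ln y ^+ 2).
have w0 : 0 < y `^ (g - 2) / ln y ^+ 2 by rewrite divr_gt0 ?powR_gt0 ?exprn_gt0.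
have w1 : y `^ (g - 2) / ln y ^+ 2 <= 1.
  rewrite ler_pdivrMr ?exprn_gt0 // mul1r; apply: (@le_trans _ _ 1).
    by rewrite -[leRHS](powRr0 y); apply: ler_powR; lra.
  by rewrite exprn_ege1.
have k0' : 0 < k by rewrite mulr_gt0.
have kk0 : k <= k0 by rewrite /k -[leRHS]mulr1 ler_wpM2l // ltW.
have fyE : fminus g y = y `^ g / ln y by rewrite /fminus (max_idPl L1).
have fy0 : 0 < fminus g y by rewrite fyE divr_gt0 ?powR_gt0.
have main := @excursion_bound _ _ _ mu S X F hA0 (fminus g) x0 y k K (fminus g y) Kocc
  (@fminus_ge0 R g) (ltW k0') K0 (ltW fy0).
have {main} : k * (\sum_(i < n) pr mu (stay_below X y i.+1)) +
   fminus g y * (\sum_(i < n) pr mu (overshoot X y i.+1)) <= K1.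
  apply: (le_trans (main _ _ hocc _ n)).
  - move=> x /andP[xx0 xy] Sx; apply: mean_ub_le (hbig x xx0 Sx).
    rewrite lerD2l lerN2 -/k0 ler_wpM2l //; first exact: ltW.
    have x1 : 1 < x by lra.
    have xp : 0 < x by lra.
    have yp : 0 < y by lra.
    have lx0 : 0 < ln x by rewrite ln_gt0.
    apply: ler_pM; rewrite ?powR_ge0 ?invr_ge0 ?sqr_ge0 //.
      rewrite /powR !gt_eqF ?ler_expR //.
      by apply: ler_wnM2l; [lra|rewrite ler_ln ?posrE].
    rewrite lef_pV2 ?posrE ?exprn_gt0 // lerXn2r ?nnegrE ?(ltW lx0) ?(ltW L0) //.
    by rewrite ler_ln ?posrE.
  - move=> x xx0 Sx; apply: mean_ub_le (hsmall x xx0 Sx).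
    by rewrite lerDr fminus_ge0.
  - by move=> x yx; apply: le_fminus => //; lra.
  - rewrite {1}/fminus powR0 ?gt_eqF // mul0r add0r /K1.
    have : (K + k) * Kocc <= (K + k0) * Kocc by rewrite ler_wpM2r // lerD2l.
    lra.
set s1 := \sum_(i < n) _; set s2' := \sum_(i < n) _ => main.
have s10 : 0 <= s1 by apply: sumr_ge0 => i _; apply: pr_ge0.
have s20' : 0 <= s2' by apply: sumr_ge0 => i _; apply: pr_ge0.
have ks : 0 <= k * s1 by rewrite mulr_ge0 // ltW.
have fs : 0 <= fminus g y * s2' by rewrite mulr_ge0 // ltW.
have yg2 : y `^ (2 - g) * y `^ (g - 2) = 1 by rewrite -(opprB g 2) powR_neg.
split.
- apply: (@le_trans _ _ (K1 / k0 * (y `^ (2 - g) * ln y ^+ 2))); last first.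
    apply: ler_wpM2r; first by apply: mulr_ge0; rewrite ?powR_ge0 ?sqr_ge0.
    by rewrite lerDr ltW.
  rewrite (_ : _ * _ = K1 / k).
    by rewrite ler_pdivlMr //; lra.
  have ky : y `^ (2 - g) = (y `^ (g - 2))^-1 by rewrite -powRN opprB.
  by rewrite /k ky; field; rewrite !gt_eqF ?powR_gt0.
- apply: (@le_trans _ _ (K1 * (ln y * y `^ (- g)))); last first.
    apply: ler_wpM2r; first by apply: mulr_ge0; rewrite ?powR_ge0 ?(ltW L0).
    by rewrite lerDl; apply: divr_ge0; exact: ltW.
  rewrite powRN (_ : ln y * (y `^ g)^-1 = (fminus g y)^-1); last by rewrite fyE invf_div.
  by rewrite ler_pdivlMr //; lra.
Qed.

Lemma null_recurrent : g <= 2 -> recurrent mu X.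
Proof.
move=> g2 e e0; have [K K0 [y0 y01 hK]] := null_estimates g2.
have e2 : 0 < e / (2 * K) by rewrite divr_gt0 // mulr_gt0.
have [y1 hy1] := ln_powR_small 1 g0 e2.
pose y := Num.max (Num.max y0 y1) (expR 1).
have yy0 : y0 <= y by rewrite /y !le_max lexx.
have yy1 : y1 <= y by rewrite /y !le_max lexx orbT.
have ye : expR 1 <= y by rewrite /y le_max lexx orbT.
have yp : 0 < y by apply: lt_le_trans ye; apply: expR_gt0.
have L1 : 1 <= ln y by rewrite -ler_expR lnK.
pose M := K * (y `^ (2 - g) * ln y ^+ 2).
pose n := Num.bound (M / (e / 2)).
exists n; apply: (le_trans (alive_split hA0 n (ltW yp))).
have [_ h2] := hK y n yy0; have [h1 _] := hK y n.+1 yy0.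
have dec i : pr mu (stay_below X y i.+2) <= pr mu (stay_below X y i.+1).
  by apply: le_pr; [exact: (measurable_stay_below hA0)..|exact: stay_belowS].
have := decreasing_sum_bound dec h1; rewrite -/M => hn.
have M0 : 0 <= M.
  by apply: mulr_ge0; [exact: ltW|apply: mulr_ge0; rewrite ?powR_ge0 ?sqr_ge0].
have nb : M / (e / 2) < n%:R by apply: archi_boundP; rewrite divr_ge0 //; lra.
have t1 : pr mu (stay_below X y n.+1) <= e / 2.
  rewrite -(ler_pM2l (_ : 0 < n.+1%:R)) //; apply: (le_trans hn).
  move: nb; rewrite ltr_pdivrMr; last lra.
  rewrite -[n.+1%:R]natr1 mulrDl mul1r; lra.
have t2 : K * (ln y * y `^ (- g)) <= e / 2.
  have := hy1 y yy1; rewrite powRr1; last lra.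
  move=> h; apply: (@le_trans _ _ (K * (e / (2 * K) * y `^ g * y `^ (- g)))).
    by rewrite ler_wpM2l ?(ltW K0) // ler_wpM2r ?powR_ge0.
  rewrite -(mulrA (e / (2 * K))) [y `^ g * _]mulrC powR_neg // mulr1.
  by rewrite le_eqVlt; apply/orP; left; apply/eqP; field; rewrite gt_eqF.
lra.
Qed.

Lemma pos_estimates : 2 < g -> exists K : R, forall n,
  \sum_(i < n) pr mu (alive X i.+1) <= K.
Proof.
move=> g2; have [x0 x01 hbig] := square_drift hA0 hA2 p2 hM cE g2.
have fb (z : R) : 0 <= z -> z ^+ 2 <= 1 + z ^+ 2 by move=> _; lra.
have [K K0 hsmall] := bounded_mean hA0 p2 hM x0 (@sqr_ge0 R) fb.
have [Kocc hocc] := occupation_bound hA0 hA1 x0.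
have Kocc0 : 0 <= Kocc by have := hocc 0%N; rewrite big_ord0.
pose k := (g - 2) * s2 / 2; have k0 : 0 < k by rewrite /k !mulr_gt0 //; lra.
pose K1 := (K + k) * Kocc; have K10 : 0 <= K1 by rewrite mulr_ge0 //; lra.
exists (K1 / k + K1) => n; pose y : R := n%:R + 1.
have y0 : 0 < y by rewrite ltr_wpDl.
have main m : k * (\sum_(i < m) pr mu (stay_below X y i.+1)) +
   y ^+ 2 * (\sum_(i < m) pr mu (overshoot X y i.+1)) <= K1.
  have := @excursion_bound _ _ _ mu S X F hA0 (fun z => z ^+ 2) x0 y k K (y ^+ 2) Kocc
    (@sqr_ge0 R) (ltW k0) K0 (sqr_ge0 _).
  rewrite expr0n /= add0r; apply => //.
  - by move=> x /andP[xx0 _] Sx; apply: hbig.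
  - by move=> x xx0 Sx; apply: mean_ub_le (hsmall x xx0 Sx); rewrite lerDr sqr_ge0.
  - by move=> x yx; rewrite lerXn2r ?nnegrE; lra.
have nonneg m (B : nat -> set T) : 0 <= \sum_(i < m) pr mu (B i).
  by apply: sumr_ge0 => i _; apply: pr_ge0.
have y20 : 0 < y ^+ 2 by rewrite exprn_gt0.
have m1 m : \sum_(i < m) pr mu (stay_below X y i.+1) <= K1 / k.
  have := main m; have := nonneg m (fun i => overshoot X y i.+1).
  move=> h1 h2; rewrite ler_pdivlMr // mulrC.
  have : 0 <= y ^+ 2 * \sum_(i < m) pr mu (overshoot X y i.+1) by rewrite mulr_ge0 // ltW.
  lra.
have m2 m : \sum_(i < m) pr mu (overshoot X y i.+1) <= K1 / y ^+ 2.
  have := main m; have := nonneg m (fun i => stay_below X y i.+1).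
  move=> h1 h2; rewrite ler_pdivlMr // mulrC.
  have : 0 <= k * \sum_(i < m) pr mu (stay_below X y i.+1) by rewrite mulr_ge0 // ltW.
  lra.
apply: (@le_trans _ _ (\sum_(i < n) (pr mu (stay_below X y i.+1) + K1 / y ^+ 2))).
  apply: ler_sum => i _; apply: (le_trans (alive_split hA0 i (ltW y0))).
  by rewrite lerD2l.
rewrite big_split /= sumr_const card_ord; apply: lerD; first exact: m1.
rewrite -mulr_natr -mulrA ler_piMr // mulrC ler_pdivrMr // mul1r.
rewrite /y; have : 0 <= n%:R :> R by []; nra.
Qed.

Lemma pos_recurrent : 2 < g -> recurrent mu X.
Proof.
move=> g2 e e0; have [K hK] := pos_estimates g2.
have K0 : 0 <= K by have := hK 0%N; rewrite big_ord0.
exists (Num.bound (K / e)); set n := Num.bound _.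
have dec i : pr mu (alive X i.+2) <= pr mu (alive X i.+1).
  by apply: le_pr; [exact: (measurable_alive hA0)..|apply: alive_le].
have hn := decreasing_sum_bound dec (hK n.+1).
have nb : K / e < n%:R by apply: archi_boundP; rewrite divr_ge0 // ltW.
rewrite -(ler_pM2l (_ : 0 < n.+1%:R)) //; apply: (le_trans hn).
by move: nb; rewrite ltr_pdivrMr // -natr1 mulrDl mul1r; lra.
Qed.

End Recurrence.

Section Subadditivity.
Context {R : realType} {d : measure_display} {T : measurableType d}.
Variable mu : probability T R.

Lemma pr_bigcup_bound (A : nat -> set T) (K : R) : (forall n, measurable (A n)) ->
  (forall n, \sum_(k < n) pr mu (A k) <= K) -> pr mu (\bigcup_n A n) <= K.
Proof.
move=> mA hK; have mU : measurable (\bigcup_n A n) by apply: bigcupT_measurable.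
rewrite -lee_fin -prE //.
apply: (@le_trans _ _ (\sum_(0 <= n <oo) mu (A n))%E).
  exact: measure_sigma_subadditive.
apply: lime_le; first exact: is_cvg_ereal_nneg_natsum.
apply: nearW => n; rewrite big_mkord.
rewrite (eq_bigr (fun k : 'I_n => (pr mu (A k))%:E)) ?sumEFin ?lee_fin ?hK //.
by move=> k _; exact: prE.
Qed.

End Subadditivity.

(** * Decomposition into excursions *)

Section Paths.
Context {R : realType} {d : measure_display} {T : measurableType d}.
Variable X : nat -> T -> R.
Implicit Types (w : T) (n s t : nat) (y : R).

Lemma next_zeroP w s k : next_zero X w s = Some k <->
  [/\ (s < k)%N, X k w = 0 & forall q, (s < q < k)%N -> X q w <> 0].
Proof.
rewrite /next_zero; case: pselect => [h|nh].
  case: ex_minnP => m /andP[sm /asboolP Xm] mmin; split.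
    move=> [<-]; split => // q /andP[sq qm] Xq.
    have := mmin q; rewrite sq /= asboolT //; lia.
  move=> [sk Xk hk]; congr Some; apply/eqP; rewrite eqn_leq.
  apply/andP; split; first by apply: mmin; rewrite sk /= asboolT.
  by rewrite leqNgt; apply/negP => km; apply: (hk m) => //; lia.
split => // -[sk Xk _]; exfalso; apply: nh; exists k.
by rewrite sk /= asboolT.
Qed.

Lemma next_zero_None w s : next_zero X w s = None -> forall t, (s < t)%N -> X t w <> 0.
Proof.
rewrite /next_zero; case: pselect => // nh _ t st Xt; apply: nh; exists t.
by rewrite st /= asboolT.
Qed.

Lemma tau_ge1 w n k : tau X w n = Some k -> (1 <= k)%N.
Proof.
case: n => [[<-]//|n] /=; case: (tau X w n) => //= a /next_zeroP[]; lia.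
Qed.

Lemma tauS_Some w n b : tau X w n.+1 = Some b -> exists a,
  [/\ tau X w n = Some a, (a < b)%N, X b w = 0 & forall q, (a < q < b)%N -> X q w <> 0].
Proof.
by rewrite /=; case: (tau X w n) => //= a /next_zeroP[? ? ?]; exists a.
Qed.

Definition tn w n : nat := odflt 0%N (tau X w n).

Lemma tnP w n : N_infinite X w -> tau X w n = Some (tn w n).
Proof. by move=> /(_ n); rewrite /tn; case: (tau X w n). Qed.

Lemma tnS w n : N_infinite X w ->
  [/\ (tn w n < tn w n.+1)%N, X (tn w n.+1) w = 0 &
      forall q, (tn w n < q < tn w n.+1)%N -> X q w <> 0].
Proof.
move=> Ow; have [a [ea]] := tauS_Some (tnP n.+1 Ow).
by rewrite tnP // in ea; case: ea => <-.
Qed.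

Lemma tn0 w : tn w 0 = 1%N. Proof. by []. Qed.

Lemma tn_ge w n : N_infinite X w -> (n < tn w n)%N.
Proof.
by move=> Ow; elim: n => // n IH; have [h _ _] := tnS n Ow; lia.
Qed.

Lemma le_tn w m n : N_infinite X w -> (m <= n)%N -> (tn w m <= tn w n)%N.
Proof.
move=> Ow; elim: n => [|n IH]; first by rewrite leqn0 => /eqP->.
rewrite leq_eqVlt => /orP[/eqP->//|/IH h]; have [h2 _ _] := tnS n Ow; lia.
Qed.

Lemma excursionE w n : N_infinite X w ->
  excursion X n.+1 w = [seq X t w | t <- iota (tn w n) (tn w n.+1 - tn w n)].
Proof. by move=> Ow; rewrite /excursion [n.+1.-1]/= !tnP. Qed.

Definition len w n : nat := size (excursion X n.+1 w).

Lemma lenE w n : N_infinite X w -> len w n = (tn w n.+1 - tn w n)%N.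
Proof. by move=> Ow; rewrite /len excursionE // size_map size_iota. Qed.

Lemma tn_sum w n : N_infinite X w -> tn w n = (1 + \sum_(i < n) len w i)%N.
Proof.
move=> Ow; elim: n => [|n IH]; first by rewrite big_ord0.
by rewrite big_ord_recr /= lenE // addnA -IH; have [h _ _] := tnS n Ow; lia.
Qed.

Lemma eta1E w : N_infinite X w -> eta_n X 1 w = ((len w 0)%:R)%:E.
Proof. by move=> Ow; rewrite /eta_n [1.-1]/= !tnP // lenE. Qed.

Lemma len_gt_alive w v : N_infinite X w -> (v < len w 0)%N <-> alive X v.+1 w.
Proof.
move=> Ow; have [h1 h2 h3] := tnS 0 Ow; rewrite lenE // tn0 in h1 h3 *; split.
  by move=> h s hs; apply: h3; lia.
move=> al; rewrite ltnNge; apply/negP => h; apply: (al (tn w 1)) => //; lia.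
Qed.

Lemma excursion_cover w t : N_infinite X w -> (1 <= t)%N ->
  exists n, X t w \in excursion X n.+1 w.
Proof.
move=> Ow t1; have ex : exists n, (t < tn w n)%N by exists t; apply: tn_ge.
case: (ex_minnP ex) => -[|n]; first by rewrite tn0; lia.
move=> lt_t mmin; exists n; rewrite excursionE //.
have le_t : (tn w n <= t)%N by rewrite leqNgt; apply/negP => /mmin; lia.
by apply/mapP; exists t => //; rewrite mem_iota; lia.
Qed.

Lemma all_le_stay_below w y v : N_infinite X w -> all (fun x => x <= y) (excursion X 1 w) ->
  (v < len w 0)%N -> stay_below X y v.+1 w.
Proof.
move=> Ow /allP hall vl; split; first exact/len_gt_alive.
move=> s hs; apply: hall; rewrite excursionE //; apply/mapP; exists s => //.
by rewrite mem_iota tn0; move: vl; rewrite lenE // tn0; lia.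
Qed.

Lemma exceed_overshoot w y : N_infinite X w -> X 1%N w <= y ->
  ~~ all (fun x => x <= y) (excursion X 1 w) -> exists i, overshoot X y i.+1 w.
Proof.
move=> Ow X1 nall; have [h1 h2 h3] := tnS 0 Ow; rewrite tn0 in h1 h3.
have ex : exists t, (1 <= t < tn w 1)%N && (y < X t w).
  move: nall; rewrite -has_predC => /hasP[x]; rewrite excursionE // => /mapP[t].
  rewrite mem_iota tn0 => ht -> /=; rewrite -ltNge => hy; exists t.
  by rewrite hy andbT; lia.
case: (ex_minnP ex) => m /andP[hm ym] mmin.
have m2 : (2 <= m)%N.
  by rewrite ltnNge; apply/negP => hm1; move: ym; rewrite (_ : m = 1%N) ?ltNge ?X1 //; lia.
exists m.-2; rewrite (_ : m.-2.+1 = m.-1); last lia.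
split; last by rewrite /= prednK //; lia.
split; first by move=> s hs; apply: h3; lia.
move=> s hs; rewrite leNgt; apply/negP => hy.
by have := mmin s; rewrite hy andbT => /(_ ltac:(lia)); lia.
Qed.

Lemma NcountP w t : N_infinite X w -> (tn w 1 <= t)%N -> exists N,
  [/\ (1 <= N)%N, Ncount X t w = (N%:R)%:E, (tn w N <= t)%N & (t < tn w N.+1)%N].
Proof.
move=> Ow t1; have ex : exists n, (t < tn w n.+1)%N by exists t; have := tn_ge t.+1 Ow; lia.
case: (ex_minnP ex) => N ltN Nmin; exists N.
have N1 : (1 <= N)%N by case: N ltN {Nmin} => //; lia.
have leN : (tn w N <= t)%N.
  rewrite leqNgt; apply/negP => h; have := Nmin N.-1; rewrite prednK // => /(_ h); lia.
split => //; apply/eqP; rewrite eq_le; apply/andP; split.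
  apply: ge_ereal_sup => _ [n [n1 [k [ek kt]]] <-]; rewrite lee_fin ler_nat leqNgt.
  apply/negP => Nn; have := @le_tn w N.+1 n Ow Nn.
  by rewrite tnP // in ek; case: ek => ek; lia.
apply: ereal_sup_ubound; exists N => //; split => //; exists (tn w N); split => //.
exact: tnP.
Qed.

End Paths.

Section IID.
Context {R : realType} {d : measure_display} {T : measurableType d}.
Variables (mu : probability T R) (S : set R) (X : nat -> T -> R)
  (F : nat -> set (set T)).
Hypotheses (hA0 : A0 mu S X F).
Implicit Types (w : T) (n s t : nat) (y : R).

Let mXp t (B : set R) : (1 <= t)%N -> measurable (X t @^-1` B).
Proof. by move=> t1; exact: (filtration_measurable hA0 t1 (adapted_any hA0 _ t1)). Qed.

Lemma measurable_state_seq (ts : seq nat) (B : set (seq R)) :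
  all (leq 1) ts -> measurable [set w | B [seq X t w | t <- ts]].
Proof.
elim: ts B => [|t ts IH] B /=.
  move=> _; have [h|h] := pselect (B [::]).
    by rewrite (_ : [set _ | _] = setT) //; apply/seteqP; split.
  by rewrite (_ : [set _ | _] = set0) //; apply/seteqP; split.
move=> /andP[t1 hts].
have [iota iota_inj] := elimT (countable_injP _) (locally_finite_countable hA0).
pose E n := [set w | iota (X t w) = n /\ B (X t w :: [seq X t w | t <- ts])].
rewrite (_ : [set _ | _] = \bigcup_n E n); last first.
  by apply/seteqP; split => [w h|w [n _ []]//]; exists (iota (X t w)).
apply: bigcupT_measurable => n.
have [[x [Sx xn]]|nx] := pselect (exists x, S x /\ iota x = n).
  rewrite (_ : E n = X t @^-1` [set x] `&` [set w | B (x :: [seq X t w | t <- ts])]).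
    by apply: measurableI; [exact: mXp|exact: (IH [set s | B (x :: s)])].
  apply/seteqP; split => w /= [h1 h2]; last by rewrite /E /= h1.
  have e : X t w = x.
    by apply: iota_inj; rewrite ?inE //; [exact: (state_in hA0)|rewrite h1 xn].
  by rewrite -e.
rewrite (_ : E n = set0) //; rewrite -subset0 => w [h _]; apply: nx.
by exists (X t w); split => //; exact: (state_in hA0).
Qed.

Lemma measurable_next_zero s k : measurable [set w | next_zero X w s = Some k].
Proof.
have [sk|ks] := ltnP s k; last first.
  by rewrite (_ : [set _ | _] = set0) // -subset0 => w /= /next_zeroP[]; lia.
pose Q (q : nat) : set R := if q == k then [set x | x = 0] else [set x | x <> 0].
rewrite (_ : [set _ | _] = [set w | forall q, (s.+1 <= q <= k)%N -> Q q (X q w)]).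
  apply: (filtration_measurable hA0 (t := k)); first lia.
  by apply: (filtration_stay hA0); lia.
apply/seteqP; split => w /=.
  move=> /next_zeroP[_ Xk h] q hq; rewrite /Q; case: eqP => [->//|ne].
  by apply: h; lia.
move=> h; apply/next_zeroP; split => //.
  by have := h k; rewrite /Q eqxx; apply; lia.
move=> q hq; have := h q; rewrite /Q (_ : (q == k) = false); last lia.
by apply; lia.
Qed.

Lemma measurable_tau n k : measurable [set w | tau X w n = Some k].
Proof.
elim: n k => [|n IH] k /=.
  have [->|ne] := eqVneq k 1%N.
    by rewrite (_ : [set _ | _] = setT) //; apply/seteqP; split.
  rewrite (_ : [set _ | _] = set0) // -subset0 => w /= [e].
  by move: ne; rewrite e eqxx.
rewrite (_ : [set _ | _] = \bigcup_j ([set w | tau X w n = Some j] `&`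
   [set w | next_zero X w j = Some k])).
  by apply: bigcupT_measurable => j; apply: measurableI => //; apply: measurable_next_zero.
apply/seteqP; split => w /=; last by move=> [j _ [/= -> /= ->]].
by case e : (tau X w n) => [j|] //= h; exists j.
Qed.

Lemma measurable_tau_fin n : measurable [set w | tau X w n <> None].
Proof.
rewrite (_ : [set _ | _] = \bigcup_k [set w | tau X w n = Some k]).
  by apply: bigcupT_measurable => k; apply: measurable_tau.
apply/seteqP; split => w /=; last by move=> [k _ /= ->].
by case e : (tau X w n) => [k|] // _; exists k.
Qed.

Lemma measurable_N_infinite : measurable (N_infinite X).
Proof.
rewrite (_ : N_infinite X = \bigcap_n [set w | tau X w n <> None]).
  by apply: bigcapT_measurable => n; apply: measurable_tau_fin.
by apply/seteqP; split => w h n; [move=> _; apply: h|apply: h].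
Qed.

Lemma measurable_excursion n (B : set (seq R)) : measurable (excursion X n @^-1` B).
Proof.
pose E a b := [set w | tau X w n.-1 = Some a] `&` [set w | tau X w n = Some b] `&`
   [set w | B [seq X t w | t <- iota a (b - a)]].
pose E0 := ~` ([set w | tau X w n.-1 <> None] `&` [set w | tau X w n <> None]) `&`
   [set _ : T | B [::]].
have -> : excursion X n @^-1` B = (\bigcup_a \bigcup_b (if (1 <= a)%N then E a b else set0)) `|` E0.
  apply/seteqP; split => w; rewrite /excursion /=.
    case e1 : (tau X w n.-1) => [a|]; case e2 : (tau X w n) => [b|] h.
    - by left; exists a => //; exists b => //; rewrite (tau_ge1 e1).
    - by right; split => //= -[_]; rewrite e2.
    - by right; split => //= -[]; rewrite e1.
    - by right; split => //= -[]; rewrite e1.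
  move=> [[a _ [b _]]|[h0 h]].
    by case: ifP => // _ [[/= -> ->]].
  move: h0; case e1 : (tau X w n.-1) => [a|]; case e2 : (tau X w n) => [b|] //= h0.
  by exfalso; apply: h0; rewrite /= e1 e2.
apply: measurableU.
  apply: bigcupT_measurable => a; apply: bigcupT_measurable => b; case: ifP => // a1.
  apply: measurableI; first by apply: measurableI; apply: measurable_tau.
  apply: measurable_state_seq; apply/allP => t; rewrite mem_iota; lia.
apply: measurableI.
  by apply: measurableC; apply: measurableI; apply: measurable_tau_fin.
have [h|h] := pselect (B [::]).
  by rewrite (_ : [set _ | _] = setT) //; apply/seteqP; split.
by rewrite (_ : [set _ | _] = set0) //; apply/seteqP; split.
Qed.

Hypothesis hA3 : A3 mu X.
Hypothesis hrec : recurrent mu X.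

Lemma N_infinite_pr1 : pr mu (N_infinite X) = 1.
Proof.
have mtf := measurable_tau_fin.
have p1 : pr mu [set w | tau X w 1 <> None] = 1.
  set q := pr mu _; have q1 : q <= 1 by apply: pr_le1.
  apply/eqP; rewrite eq_le q1 leNgt; apply/negP => qlt.
  have [|n hn] := hrec (e := (1 - q) / 2); first lra.
  have : 1 - q <= pr mu (alive X n.+1).
    rewrite -prC //; apply: le_pr; [exact: measurableC|exact: (measurable_alive hA0)|].
    by move=> w /= /contrapT h s hs; apply: (next_zero_None h); lia.
  lra.
have eta_fin n w : (eta_n X n.+1 w < +oo)%E /\ tau X w n <> None <-> tau X w n.+1 <> None.
  rewrite /eta_n [n.+1.-1]/= -/(tau X w n.+1).
  case e1 : (tau X w n) => [a|].
    case e2 : (tau X w n.+1) => [b|]; first by split => // _; split => //; rewrite ltry.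
    by split => // -[]; rewrite ltxx.
  by rewrite /= e1; split => //; case.
have pn n : pr mu [set w | tau X w n <> None] = 1.
  elim: n => [|n IH].
    by rewrite (_ : [set _ | _] = setT) ?prT //; apply/seteqP; split.
  case: hA3 => _ /(_ n).
  rewrite (_ : _ `&` _ = [set w | tau X w n.+1 <> None]); last first.
    by apply/seteqP; split => w /eta_fin.
  rewrite (_ : [set w | (eta_n X 1 w < +oo)%E] = [set w | tau X w 1 <> None]); last first.
    by apply/seteqP; split => w; [move=> h; apply/eta_fin; split|case/eta_fin].
  by rewrite ![mu _]prE // IH p1 mule1 => -[].
have : pr mu (~` N_infinite X) <= 0.
  rewrite (_ : ~` N_infinite X = \bigcup_n ~` [set w | tau X w n <> None]).
    apply: pr_bigcup_bound => [n|n]; first exact: measurableC.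
    by rewrite big1 // => i _; rewrite prC // pn subrr.
  apply/seteqP; split => w /=.
    by move=> h; apply: contrapT => h2; apply: h => n e; apply: h2; exists n.
  by move=> [n _ h] h2; apply: h => e; exact: (h2 n).
rewrite prC; last exact: measurable_N_infinite.
by have := pr_le1 mu measurable_N_infinite; lra.
Qed.

Lemma N_infinite_ae : {ae mu, forall w, N_infinite X w}.
Proof. exact: ae_pr1 measurable_N_infinite N_infinite_pr1. Qed.

Lemma pr_N_infinite A : measurable A -> pr mu (N_infinite X `&` A) = pr mu A.
Proof.
move=> mA; have mO := measurable_N_infinite.
apply/eqP; rewrite eq_le; apply/andP; split.
  by apply: le_pr => //; exact: measurableI.
apply: pr_ae_le => //; first exact: measurableI.
by apply: filterS N_infinite_ae => w Ow Aw.
Qed.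

Lemma excursion_ident n (B : set (seq R)) :
  pr mu (excursion X n.+1 @^-1` B) = pr mu (excursion X 1 @^-1` B).
Proof.
have mE := measurable_excursion.
case: hA3 => -[/(_ n.+1 B isT (mE _ _) (mE _ _)) + _] _.
by rewrite ![mu _]prE ?pr_N_infinite //; [case|apply: measurableI => //;
  exact: measurable_N_infinite..].
Qed.

Lemma excursion_indep k (B : nat -> set (seq R)) :
  pr mu (\bigcap_(i in `I_k) (excursion X i.+1 @^-1` B i)) =
  \prod_(i < k) pr mu (excursion X i.+1 @^-1` B i).
Proof.
have mE := measurable_excursion; have mO := measurable_N_infinite.
have mC : measurable (\bigcap_(i in `I_k) (excursion X i.+1 @^-1` B i)).
  by apply: bigcap_measurableType => i _.
case: hA3 => -[_ /(_ k B (fun i => mE _ _)) +] _.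
rewrite ![mu _]prE ?pr_N_infinite //; last exact: measurableI.
rewrite N_infinite_pr1 big1 // mule1 mul1e.
rewrite (eq_bigr (fun i : 'I_k => (pr mu (excursion X i.+1 @^-1` B i))%:E)); last first.
  by move=> i _; rewrite [mu _]prE ?pr_N_infinite //; apply: measurableI.
by rewrite prodEFin => -[].
Qed.

End IID.

(** * Lower bound for the tail of the excursion length *)

Section LowerTail.
Context {R : realType} {d : measure_display} {T : measurableType d}.
Variables (mu : probability T R) (S : set R) (X : nat -> T -> R)
  (F : nat -> set (set T)).
Hypotheses (hA0 : A0 mu S X F).
Implicit Types (n i s : nat) (A U : set T).

Let mXp t (B : set R) : (1 <= t)%N -> measurable (X t @^-1` B).
Proof. by move=> t1; exact: (filtration_measurable hA0 t1 (adapted_any hA0 _ t1)). Qed.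

Let mX t (f : R -> R) A : (1 <= t)%N -> measurable_fun A (fun w => (f (X t w))%:E).
Proof.
move=> t1; apply: (@measurable_funTS _ _ _ _ _ (EFin \o f \o X t)).
exact: (measurable_state_fun hA0 (EFin \o f)).
Qed.

Definition confined U (B : set R) t s : set T :=
  U `&` [set w | forall q, (t <= q <= s)%N -> B (X q w)].

Lemma filtration_confined U B t s : (1 <= t)%N -> (t <= s)%N -> F t U ->
  F s (confined U B t s).
Proof.
move=> t1 ts FU; apply: sigma_algebraI.
- by apply: (filtration_sigma hA0); lia.
- exact: (filtration_mono hA0 t1 ts FU).
- by apply: (@filtration_stay _ _ _ _ _ _ _ hA0 t s (fun _ => B)) => //; lia.
Qed.

Lemma confinedS U B t s : confined U B t s.+1 `<=` confined U B t s.
Proof. by move=> w [Uw h]; split => // q hq; apply: h; lia. Qed.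

Lemma confined_exit U B t s w : (t <= s)%N -> confined U B t s w ->
  ~ confined U B t s.+1 w -> ~ B (X s.+1 w).
Proof.
move=> ts [Uw h] nh Bw; apply: nh; split => // q hq.
have [|qs] := leqP q s; first by move=> qs; apply: h; lia.
by rewrite (_ : q = s.+1) //; lia.
Qed.

Lemma dip_stay (K x0 y : R) U t N :
  0 < K -> 0 < y -> x0 <= y / 2 -> K * N%:R <= y ^+ 2 / 8 ->
  (forall x, x0 <= x -> y / 2 <= x -> S x ->
     mean_ub mu X F (fun z => Num.max (y - z) 0 ^+ 2) x (Num.max (y - x) 0 ^+ 2 + K)) ->
  (1 <= t)%N -> F t U -> U `<=` X t @^-1` [set x | y <= x] ->
  pr mu U <= 2 * pr mu (confined U [set x | y / 2 < x] t (t + N)).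
Proof.
move=> K0 y0 xy hN hd t1 FU UX.
pose V := confined U [set x | y / 2 < x] t.
pose f z : R := Num.max (y - z) 0 ^+ 2.
have f0 z : 0 <= f z by apply: sqr_ge0.
have FV s : (t <= s)%N -> F s (V s) by move=> ts; apply: filtration_confined.
have mU := filtration_measurable hA0 t1 FU.
have mV s : (t <= s)%N -> measurable (V s).
  by move=> ts; apply: (filtration_measurable hA0 _ (FV s ts)); lia.
have VU s : V s `<=` U by move=> w [].
have pVU s : (t <= s)%N -> pr mu (V s) <= pr mu U by move=> ts; apply: le_pr; [exact: mV| |].
have step i : (\int[mu]_(w in V (t + i)%N) (f (X (t + i).+1 w))%:E + (fun=> 0) i
      <= \int[mu]_(w in V (t + i)%N) (f (X (t + i)%N w))%:E + (fun=> (K * pr mu U)%:E) i)%E.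
  have ti : (1 <= t + i)%N by lia.
  have tti : (t <= t + i)%N by lia.
  have := mean_ub_integral hA0 (f := f) (G := fun=> 0) (H := fun=> K) ti (FV _ tti) f0
     (fun=> lexx 0) (fun=> ltW K0).
  rewrite !integral_cstE; [|exact: mV..]; rewrite mul0r => /(_ _)/le_trans; apply.
    move=> w [Uw hw]; rewrite subr0; have := hw (t + i)%N; rewrite leqnn tti => /(_ isT) /= h.
    by apply: hd; [lra|lra|exact: (state_in hA0)].
  by apply: leeD => //; rewrite lee_fin ler_wpM2l ?pVU // ltW.
have main := stopped_mean_super hA0 t1 FV (fun s _ => @confinedS U _ t s) f0 N step.
have VtU : V t = U.
  apply/seteqP; split; first exact: VU.
  move=> w Uw; split => // q hq; rewrite (_ : q = t); last lia.
  by have /= := UX _ Uw; lra.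
have init : (\int[mu]_(w in V t) (f (X t w))%:E = 0)%E.
  rewrite VtU integral0_eq // => w Uw; have /= h := UX _ Uw.
  by rewrite /f (max_idPr _) ?expr0n //; lra.
rewrite init add0e big1 // adde0 sumr_const card_ord in main.
have exit i : ((y ^+ 2 / 4 * (pr mu (V (t + i)%N) - pr mu (V (t + i).+1)))%:E <=
   \int[mu]_(w in V (t + i)%N `\` V (t + i).+1) (f (X (t + i).+1 w))%:E)%E.
  have tti : (t <= t + i)%N by lia.
  have tti' : (t <= (t + i).+1)%N by lia.
  have mD : measurable (V (t + i)%N `\` V (t + i).+1) by apply: measurableD; apply: mV.
  rewrite -prD; [|exact: mV..|exact: confinedS].
  rewrite -integral_cstE //; apply: ge0_le_integral => //.
  - by move=> w _; rewrite lee_fin divr_ge0 ?sqr_ge0.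
  - by apply: mX; lia.
  - move=> w [h1 h2]; rewrite lee_fin.
    have /= /negP := confined_exit tti h1 h2; rewrite -leNgt => h.
    rewrite (_ : y ^+ 2 / 4 = (y / 2) ^+ 2); last by field.
    rewrite /f (max_idPl _); last lra.
    by rewrite lerXn2r ?nnegrE; lra.
have tele n : \sum_(i < n) (pr mu (V (t + i)%N) - pr mu (V (t + i).+1)) =
    pr mu (V t) - pr mu (V (t + n)%N).
  elim: n => [|n IH]; first by rewrite big_ord0 addn0 subrr.
  by rewrite big_ord_recr /= IH addnS addrA subrK.
have : ((y ^+ 2 / 4 * (pr mu U - pr mu (V (t + N)%N)))%:E <= (K * pr mu U *+ N)%:E)%E.
  rewrite -{1}VtU -tele mulr_sumr -sumEFin.
  rewrite (_ : (K * pr mu U *+ N)%:E = (K * pr mu U)%:E *+ N)%R; last first.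
    by elim: (N) => [|m IH]; rewrite ?mulr0n // !mulrS EFinD IH.
  apply: le_trans main; rewrite /stopped_mean.
  apply: (@le_trans _ _ (\sum_(i < N) \int[mu]_(w in V (t + i)%N `\` V (t + i).+1)
     (f (X (t + i).+1 w))%:E)%E); first by apply: lee_sum => i _; apply: exit.
  by apply: leeDr; apply: integral_ge0 => w _; rewrite lee_fin.
rewrite lee_fin -mulr_natr mulrAC => h.
have : K * N%:R * pr mu U <= y ^+ 2 / 8 * pr mu U by rewrite ler_wpM2r ?pr_ge0.
have y2 : 0 < y ^+ 2 by rewrite exprn_gt0.
rewrite -/(V (t + N)%N); set a := pr mu U in h *; set b := pr mu _ in h * => h2.
rewrite -(ler_pM2l (_ : 0 < y ^+ 2 / 8)); last lra.
lra.
Qed.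

Variables (c s2 p : R).
Hypotheses (hA1 : A1 mu S X F) (hA2 : A2 mu X F c s2) (p2 : 2 < p) (hM : Mp mu X F p).
Hypotheses (hA3 : A3 mu X) (hrec : recurrent mu X).
Variable g : R.
Hypotheses (g0 : 0 < g) (g2 : g <= 2) (cE : c = - (g - 1) * s2 / 2).

Let s20 : 0 < s2. Proof. by case: hA2. Qed.

(* By (A1) the walk visits [y1]; by (A3) it does so in the first excursion with
   positive probability, since otherwise no excursion would. *)
Lemma reach_pos (y1 : R) : S y1 -> exists2 t, (1 <= t)%N &
  0 < pr mu (alive X t `&` X t @^-1` [set y1]).
Proof.
move=> Sy1; apply: contrapT => nex.
have mA t : (1 <= t)%N -> measurable (alive X t `&` X t @^-1` [set y1]).
  by move=> t1; apply: measurableI; [exact: (measurable_alive hA0)|exact: mXp].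
have z t : (1 <= t)%N -> pr mu (alive X t `&` X t @^-1` [set y1]) <= 0.
  by move=> t1; rewrite leNgt; apply/negP => h; apply: nex; exists t.
pose B := [set s : seq R | y1 \in s].
have mE n := measurable_excursion hA0 n B.
have z1 : pr mu (excursion X 1 @^-1` B) <= 0.
  apply: (@le_trans _ _ (pr mu (\bigcup_n (alive X n.+1 `&` X n.+1 @^-1` [set y1])))).
    apply: pr_ae_le => //.
      by apply: bigcupT_measurable => n; apply: mA.
    apply: filterS (N_infinite_ae hA0 hA3 hrec) => w Ow; rewrite /B /=.
    rewrite excursionE // => /mapP[t]; rewrite mem_iota tn0 => ht e.
    have [h1 h2 h3] := tnS 0 Ow; rewrite tn0 in h1 h3.
    exists t.-1 => //; rewrite prednK; last lia.
    by split => // s hs; apply: h3; lia.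
  apply: pr_bigcup_bound => [n|n]; first exact: mA.
  by apply: sumr_le0 => i _; apply: z.
have zU : pr mu (\bigcup_n (excursion X n.+1 @^-1` B)) <= 0.
  apply: pr_bigcup_bound => [n|n]; first exact: mE.
  by apply: sumr_le0 => i _; rewrite (excursion_ident hA0 hA3 hrec).
have S0 : S 0 by case: hA0 => -[].
have [m [phi [mphi h]]] := A1_atom hA0 hA1; have [m1 phi0] := mphi 0 y1 S0 Sy1.
have FZ : F 1 (X 1%N @^-1` [set 0]) by apply: (adapted_any hA0).
have := h 0 y1 1%N _ S0 Sy1 isT FZ (@subset_refl _ _).
have -> : pr mu (X 1%N @^-1` [set 0]) = 1.
  by rewrite /pr; case: hA0 => _ [_ _ _ _]; rewrite -[X in _ = X%E]/(1%:E) => ->.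
rewrite mulr1 => hphi.
suff : phi 0 y1 <= 0 by lra.
apply: (le_trans hphi); apply: le_trans zU; apply: pr_ae_le.
- by apply: measurableI; apply: mXp; lia.
- by apply: bigcupT_measurable.
apply: filterS (N_infinite_ae hA0 hA3 hrec) => w Ow [_ /= hX].
have [|n hn] := @excursion_cover _ _ _ X w (1 + m 0%R y1)%N Ow; first lia.
by exists n => //; rewrite /B /= -hX.
Qed.

Lemma mean_lb_le (f : R -> R) x (a b : R) : b <= a ->
  mean_lb mu X F f x a -> mean_lb mu X F f x b.
Proof.
move=> ab h t A t1 FA AX; apply: le_trans (h t A t1 FA AX).
by rewrite lee_fin ler_wpM2r // pr_ge0.
Qed.

Lemma climb_prob (x0 y1 y : R) t1 : 1 < x0 -> x0 < y1 -> y1 < y ->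
  fplus g x0 + 1 <= fplus g y1 ->
  (forall x Y, x0 <= x -> x <= Y -> S x ->
     mean_lb mu X F (fun z => Num.min (fplus g z) (fplus g (2 * Y))) x
       (fplus g x + s2 * g / 4 * x `^ (g - 2))) ->
  (1 <= t1)%N ->
  let A1 := alive X t1 `&` X t1 @^-1` [set y1] in
  let W := confined A1 [set x | x0 < x < y] t1 in
  0 < pr mu A1 ->
  exists n, pr mu A1 / 2 <= fplus g (2 * y) *
    \sum_(i < n) pr mu (W (t1 + i)%N `&` X (t1 + i).+1 @^-1` [set x | y <= x]).
Proof.
move=> x01 xy1 yy fx hd t11.
have L1 i : (t1 <= t1 + i)%N by lia.
have L2 i : (1 <= t1 + i)%N by lia.
have L3 i : (t1 <= (t1 + i).+1)%N by lia.
have L4 i j : (i < j)%N -> (t1 <= (t1 + i).+1 <= t1 + j)%N by lia.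
have L5 q : (t1 <= q <= t1)%N -> q = t1 by lia.
have L6 s : (t1 <= s)%N -> (1 <= s)%N by lia.
move=> A1 W pA1.
pose U i := W (t1 + i)%N `&` X (t1 + i).+1 @^-1` [set x | y <= x].
pose h z := Num.min (fplus g z) (fplus g (2 * y)).
have h0 z : 0 <= h z by rewrite le_min !fplus_ge0.
have FA1 : F t1 A1.
  apply: sigma_algebraI; [exact: (filtration_sigma hA0)|exact: (filtration_alive hA0)|].
  exact: (adapted_any hA0).
have FW s : (t1 <= s)%N -> F s (W s) by move=> ts; apply: filtration_confined.
have mA1 := filtration_measurable hA0 t11 FA1.
have mW s : (t1 <= s)%N -> measurable (W s).
  by move=> ts; apply: (filtration_measurable hA0 (L6 _ ts) (FW s ts)).
have WA s : W s `<=` A1 by move=> w [].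
have mU i : measurable (U i) by apply: measurableI; [exact: mW|exact: mXp].
pose k := s2 * g / 4 * y `^ (g - 2).
have k0 : 0 < k by rewrite /k mulr_gt0 ?powR_gt0 ?divr_gt0 ?mulr_gt0 //; lra.
have step i : (\int[mu]_(w in W (t1 + i)%N) (h (X (t1 + i)%N w))%:E
    + (k * pr mu (W (t1 + i)%N))%:E
    <= \int[mu]_(w in W (t1 + i)%N) (h (X (t1 + i).+1 w))%:E)%E.
  have tti := L1 i.
  apply: (mean_lb_integral hA0) => //; [exact: FW|exact: ltW|].
  move=> w [_ hw]; have := hw (t1 + i)%N; rewrite leqnn tti => /(_ isT) /= /andP[hx hy].
  have hxy : X (t1 + i)%N w <= y by apply: ltW.
  have t1i := L2 i.
  have Sx := state_in hA0 w t1i.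
  have xp : 0 < X (t1 + i)%N w by lra.
  have yp : 0 < y by lra.
  apply: (mean_lb_le (f := h) _ (hd _ y (ltW hx) hxy Sx)).
  rewrite lerD //; first by rewrite ge_min lexx.
  rewrite /k ler_wpM2l //; first by apply: divr_ge0 => //; apply: mulr_ge0; exact: ltW.
  rewrite /powR !gt_eqF // ler_expR.
  by apply: ler_wnM2l; [rewrite subr_le0|rewrite ler_ln ?posrE].
have main n := stopped_mean_sub hA0 t11 FW (fun s _ => @confinedS A1 _ t1 s) h0 n step.
have Wt1 : W t1 = A1.
  apply/seteqP; split; first exact: WA.
  move=> w A1w; split => // q hq; rewrite (L5 _ hq).
  by case: A1w => _ /= ->; rewrite xy1 yy.
have f2y : 0 <= fplus g (2 * y) by apply: fplus_ge0.
have init : ((fplus g y1 * pr mu A1)%:E <= \int[mu]_(w in W t1) (h (X t1 w))%:E)%E.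
  rewrite Wt1 -integral_cstE //; apply: ge0_le_integral => //.
  - by move=> w _; rewrite lee_fin fplus_ge0.
  - exact: mX.
  - move=> w [_ /= ->]; rewrite lee_fin le_min lexx /=.
    by apply: le_fplus => //; lra.
have fin n : (\int[mu]_(w in W (t1 + n)%N) (h (X (t1 + n)%N w))%:E <=
    (fplus g (2 * y) * pr mu (W (t1 + n)%N))%:E)%E.
  rewrite -integral_cstE; last exact: mW.
  apply: ge0_le_integral => //.
  - exact: mW.
  - by move=> w _; rewrite lee_fin.
  - exact: mX.
  - by move=> w _; rewrite lee_fin ge_min lexx orbT.
have exit i : (\int[mu]_(w in W (t1 + i)%N `\` W (t1 + i).+1) (h (X (t1 + i).+1 w))%:E <=
   (fplus g (2 * y) * pr mu (U i) +
    fplus g x0 * (pr mu (W (t1 + i)%N) - pr mu (W (t1 + i).+1)))%:E)%E.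
  have tti := L1 i.
  have tti' := L3 i.
  have mD : measurable (W (t1 + i)%N `\` W (t1 + i).+1) by apply: measurableD; apply: mW.
  rewrite -prD; [|exact: mW..|exact: confinedS].
  set D := W (t1 + i)%N `\` _ in mD *.
  have mU' : measurable (D `&` X (t1 + i).+1 @^-1` [set x | y <= x]).
    by apply: measurableI => //; apply: mXp.
  rewrite (integral_shrink hA0 _ mD mU' (@subIsetl _ _ _) h0) //.
  rewrite EFinD; apply: leeD.
    apply: (@le_trans _ _ (fplus g (2 * y) * pr mu (D `&` X (t1 + i).+1 @^-1` [set x | y <= x]))%:E).
      rewrite -integral_cstE //; apply: ge0_le_integral => //.
      - by move=> w _; rewrite lee_fin.
      - exact: mX.
      - by move=> w _; rewrite lee_fin ge_min lexx orbT.
    rewrite lee_fin ler_wpM2l //; apply: le_pr => //.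
    by move=> w [[h1 _] h2].
  apply: (@le_trans _ _ (fplus g x0 * pr mu (D `\` (D `&` X (t1 + i).+1 @^-1` [set x | y <= x])))%:E).
    have mD' := measurableD mD mU'.
    rewrite -integral_cstE //; apply: ge0_le_integral => //.
    - by move=> w _; rewrite lee_fin.
    - exact: mX.
    - move=> w [[h1 h2] h3]; rewrite lee_fin ge_min; apply/orP; left.
      have := confined_exit tti h1 h2 => /= /negP; rewrite negb_and -!leNgt.
      case/orP => [hx|hy]; last by exfalso; apply: h3; split.
      by apply: le_fplus => //; apply: (state_ge0 hA0).
  rewrite lee_fin ler_wpM2l ?fplus_ge0 //; apply: le_pr => //; exact: measurableD.
have tele n : \sum_(i < n) (pr mu (W (t1 + i)%N) - pr mu (W (t1 + i).+1)) =
    pr mu (W t1) - pr mu (W (t1 + n)%N).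
  elim: n => [|n IH]; first by rewrite big_ord0 addn0 subrr.
  by rewrite big_ord_recr /= IH addnS addrA subrK.
have ineq n : fplus g y1 * pr mu A1 + k * (\sum_(i < n) pr mu (W (t1 + i)%N)) <=
   fplus g (2 * y) * pr mu (W (t1 + n)%N) + fplus g (2 * y) * (\sum_(i < n) pr mu (U i))
   + fplus g x0 * pr mu A1.
  have {main} := main n; rewrite sumEFin -mulr_sumr => main.
  have := le_trans (leeD init (lexx _)) main; rewrite /stopped_mean => {}main.
  have hs : (\sum_(i < n) \int[mu]_(w in W (t1 + i)%N `\` W (t1 + i).+1) (h (X (t1 + i).+1 w))%:E
    <= \sum_(i < n) (fplus g (2 * y) * pr mu (U i) +
    fplus g x0 * (pr mu (W (t1 + i)%N) - pr mu (W (t1 + i).+1)))%:E)%E.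
    by apply: lee_sum => i _; exact: exit.
  have := le_trans main (leeD (fin n) hs).
  rewrite sumEFin -!EFinD lee_fin big_split /= -!mulr_sumr tele Wt1.
  have : 0 <= fplus g x0 * pr mu (W (t1 + n)%N) by rewrite mulr_ge0 ?fplus_ge0 ?pr_ge0.
  lra.
have sumU n : \sum_(i < n) pr mu (U i) <= 1.
  rewrite -(@prT _ _ _ mu); apply: pr_sum_disjoint_le => // i j w.
  wlog ij : i j / (i < j)%N => [hw|].
    case: (ltngtP i j) => [ij Ui Uj|ji Ui Uj|//]; first exact: hw.
    by apply/esym; apply: hw.
  move=> [_ /= Ui] [[_ /(_ (t1 + i).+1)]] /=.
  by move=> /(_ (L4 _ _ ij)) /andP[_]; rewrite ltNge Ui.
have pA11 : pr mu A1 <= 1 by apply: pr_le1.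
have fx0 : 0 <= fplus g x0 by apply: fplus_ge0.
have fy1 : 0 <= fplus g y1 by apply: fplus_ge0.
pose M := (2 * fplus g (2 * y) + fplus g x0) / k.
have sumW n : \sum_(i < n) pr mu (W (t1 + i)%N) <= M.
  rewrite /M ler_pdivlMr // mulrC.
  have := ineq n; have : pr mu (W (t1 + n)%N) <= 1 by apply: pr_le1; exact: mW.
  have := sumU n; set a := pr mu _; set b := \sum_(i < n) pr mu (U i); set e := k * _.
  have := pr_ge0 mu A1; nra.
have dec i : pr mu (W (t1 + i.+1)%N) <= pr mu (W (t1 + i)%N).
  by apply: le_pr; [exact: mW|exact: mW|rewrite addnS; exact: confinedS].
pose e := pr mu A1 / (2 * (fplus g (2 * y) + 1)).
have e0 : 0 < e by rewrite /e divr_gt0 // mulr_gt0 //; lra.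
have M0 : 0 <= M by rewrite /M divr_ge0 ?(ltW k0) //; lra.
pose n := Num.bound (M / e).
have nb : M / e < n%:R by apply: archi_boundP; rewrite divr_ge0 // ltW.
exists n.+1.
have := ineq n.+1; rewrite -/(U _).
have Wn : fplus g (2 * y) * pr mu (W (t1 + n.+1)%N) <= pr mu A1 / 2.
  have hn := decreasing_sum_bound dec (sumW n.+1).
  have We : pr mu (W (t1 + n)%N) <= e.
    rewrite -(ler_pM2l (_ : 0 < n.+1%:R)) //; apply: (le_trans hn).
    by move: nb; rewrite ltr_pdivrMr // -natr1 mulrDl mul1r; lra.
  apply: (@le_trans _ _ (fplus g (2 * y) * e)).
    by rewrite ler_wpM2l // (le_trans (dec _)).
  rewrite /e mulrA ler_pdivrMr ?mulr_gt0 //; last lra.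
  have := pr_ge0 mu A1; nra.
have : 0 <= k * \sum_(i < n.+1) pr mu (W (t1 + i)%N).
  by rewrite mulr_ge0 ?(ltW k0) // sumr_ge0 // => i _; apply: pr_ge0.
have : (fplus g x0 + 1) * pr mu A1 <= fplus g y1 * pr mu A1 by rewrite ler_wpM2r ?pr_ge0.
rewrite mulrDl mul1r -/U; lra.
Qed.

Lemma lower_tail : exists2 K : R, 0 < K & exists2 k : R, 0 < k & exists y0 : R,
  forall y N, y0 <= y -> K * N%:R <= y ^+ 2 ->
    k <= fplus g (2 * y) * pr mu (alive X N).
Proof.
have N1 t i : (1 <= t -> 1 <= t + i)%N by lia.
have N2 t i N : (1 <= t -> 1 <= (t + i).+1 + N)%N by lia.
have N3 t N s : (2 <= s <= N -> s <= t -> 2 <= s <= t)%N by lia.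
have N4 t i N s : (2 <= s <= N -> t + i < s -> (t + i).+1 <= s <= (t + i).+1 + N)%N by lia.
have N5 t i j : (i < j -> t <= (t + i).+1 <= t + j)%N by lia.
have [xa xa1 hplus] := fplus_drift hA0 hA2 p2 hM g0 cE g2.
have [K K0 [xb xb1 hdip]] := dip_drift hA0 hA2 p2 hM.
have [x0 xxa xxb] : exists2 x0, xa <= x0 & xb <= x0.
  by exists (Num.max xa xb); rewrite le_max lexx ?orbT.
have x01 : 1 < x0 by lra.
have fx0 := fplus_ge0 g x0.
have [y1 Sy1 hy1] : exists2 y1, S y1 & x0 + (fplus g x0 + 1) `^ (g^-1) < y1.
  by case: hA0 => -[_ + _ _] _; apply.
have pw0 : 0 <= (fplus g x0 + 1) `^ (g^-1) by apply: powR_ge0.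
have fy1 : fplus g x0 + 1 <= fplus g y1.
  apply: (@le_trans _ _ (y1 `^ g)).
    rewrite [leLHS](_ : _ = ((fplus g x0 + 1) `^ g^-1) `^ g); last first.
      by rewrite -powRrM mulVf ?gt_eqF // powRr1 //; lra.
    by apply: ge0_ler_powR; [exact: ltW|by rewrite nnegrE|rewrite nnegrE; lra|lra].
  by rewrite /fplus ler_peMr ?powR_ge0 // max_ln_ge1.
have [t1 t11 pA1] := reach_pos Sy1.
exists (8 * K); first lra.
exists (pr mu (alive X t1 `&` X t1 @^-1` [set y1]) / 4); first lra.
exists (y1 + 2 * x0 + 1) => y N hy hN.
have xy1 : x0 < y1 by lra.
have yy1 : y1 < y by lra.
have hp x Y : x0 <= x -> x <= Y -> S x ->
    mean_lb mu X F (fun z => Num.min (fplus g z) (fplus g (2 * Y))) x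
      (fplus g x + s2 * g / 4 * x `^ (g - 2)).
  by move=> xx xY Sx; apply: hplus => //; lra.
have [n hn] := climb_prob x01 xy1 yy1 fy1 hp t11 pA1.
move: hn; set A1 := alive X t1 `&` _; set W := confined A1 _ t1 => hn.
pose U i := W (t1 + i)%N `&` X (t1 + i).+1 @^-1` [set x | y <= x].
have FA1 : F t1 A1.
  apply: sigma_algebraI; [exact: (filtration_sigma hA0)|exact: (filtration_alive hA0)|].
  exact: (adapted_any hA0).
have FU i : F (t1 + i).+1 (U i).
  apply: sigma_algebraI; first exact: (filtration_sigma hA0).
    apply: (filtration_mono hA0 (s := (t1 + i)%N)); [exact: N1|exact: leqnSn|].
    by apply: filtration_confined => //; exact: leq_addr.
  exact: (adapted_any hA0).
pose E i := confined (U i) [set x | y / 2 < x] (t1 + i).+1 ((t1 + i).+1 + N).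
have mE i : measurable (E i).
  apply: (filtration_measurable hA0 (t := ((t1 + i).+1 + N)%N)); first exact: N2.
  by apply: filtration_confined => //; exact: leq_addr.
have UE i : pr mu (U i) <= 2 * pr mu (E i).
  apply: (@dip_stay K x0) => //; [lra|lra|lra| |exact: subIsetr].
  by move=> x xx0 xy Sx; apply: hdip => //; lra.
have sE : \sum_(i < n) pr mu (E i) <= pr mu (alive X N).
  apply: pr_sum_disjoint_le => //; first exact: (measurable_alive hA0).
    move=> i w [[[[al _] hW] hU] hE] s hs.
    have [s1|s1] := leqP s t1; first by apply: al; exact: N3 hs s1.
    have [s2'|s2'] := leqP s (t1 + i).
      have := hW s; rewrite s2' (ltnW s1) => /(_ isT) /= /andP[h _]; lra.
    by have /= := hE s (N4 _ _ _ _ hs s2'); lra.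
  move=> i j w; wlog ij : i j / (i < j)%N => [hw|].
    case: (ltngtP i j) => [ij Ui Uj|ji Ui Uj|//]; first exact: hw.
    by apply/esym; apply: hw.
  move=> [[_ /= Ui] _] [[[_ /(_ (t1 + i).+1)]]] /=.
  by move=> /(_ (N5 _ _ _ ij)) /andP[_]; rewrite ltNge Ui.
have : \sum_(i < n) pr mu (U i) <= 2 * pr mu (alive X N).
  apply: (le_trans (ler_sum _ (fun (i : 'I_n) _ => UE i))); rewrite -mulr_sumr.
  by rewrite ler_wpM2l.
move=> hU; have := ler_wpM2l (fplus_ge0 g (2 * y)) hU.
by move: hn; rewrite -/U; lra.
Qed.

End LowerTail.

(** * Bounds for the number of excursions *)

Section PowerSums.
Context {R : realType}.

Lemma sum_powR_bound (e : R) n : 0 < e ->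
  \sum_(k < n) k.+1%:R `^ (- (1 + e)) <= 1 + e^-1.
Proof.
move=> e0; have ei0 : 0 < e^-1 by rewrite invr_gt0.
case: n => [|n]; first by rewrite big_ord0; lra.
suff h : \sum_(k < n.+1) k.+1%:R `^ (- (1 + e)) <= 1 + (1 - n.+1%:R `^ (- e)) / e.
  by apply: (le_trans h); rewrite lerD2l -[leRHS]mul1r ler_wpM2r ?(ltW ei0).
elim: n => [|n IH]; first by rewrite big_ord1 !powR1 subrr mul0r addr0.
rewrite big_ord_recr /=; apply: (le_trans (lerD IH (lexx _))).
suff key : n.+2%:R `^ (- (1 + e)) <= (n.+1%:R `^ (- e) - n.+2%:R `^ (- e)) / e.
  move: key; rewrite !mulrBl; lra.
rewrite ler_pdivlMr //; set m : R := n.+2%:R; set l : R := n.+1%:R.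
have lm : l = m - 1 by rewrite /m -[n.+2%:R]natr1 addrK.
have l0 : 0 < l by rewrite ltr0n.
have m0 : 0 < m by rewrite ltr0n.
have lmE : l = m * (1 + - m^-1) by rewrite lm mulrDr mulrN mulfV ?gt_eqF // mulr1.
have i0 : 0 < 1 + - m^-1 by rewrite -(pmulr_rgt0 _ m0) -lmE.
have -> : l `^ (- e) = m `^ (- e) * expR (- e * ln (1 + - m^-1)).
  by rewrite {1}lmE powRM ?(ltW m0) ?(ltW i0) //; congr (_ * _); rewrite /powR gt_eqF.
have -> : m `^ (- (1 + e)) = m `^ (- e) * m^-1.
  by rewrite opprD addrC powR_add // -powR_inv1 ?(ltW m0).
rewrite -mulrA -{3}(mulr1 (m `^ (- e))) -mulrBr ler_wpM2l ?powR_ge0 //.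
rewrite lerBrDl; apply: (le_trans _ (expR_ge1Dx _)); rewrite lerD2l mulrC.
have := @le_ln1Dx R (- m^-1); rewrite ltrN2 => /(_ _) h.
have {h} : ln (1 + - m^-1) <= - m^-1.
  by apply: h; rewrite invf_lt1 // /m ltr1n.
by move=> h; rewrite mulNr -mulrN; apply: ler_wpM2l; [exact: ltW|rewrite lerNr].
Qed.

End PowerSums.

Section IndicatorInequality.
Context {R : realType} {d : measure_display} {T : measurableType d}.
Variable mu : probability T R.

Lemma integral_indic_sum (I : finType) (al : I -> R) (A : I -> set T) :
  (forall i, 0 <= al i) -> (forall i, measurable (A i)) ->
  (\int[mu]_w (\sum_i al i * \1_(A i) w)%:E = (\sum_i al i * pr mu (A i))%:E)%E.
Proof.
move=> al0 mA.
have mI i : measurable_fun setT (fun w => (\1_(A i) w : R)%:E).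
  by apply/measurable_EFinP; apply: measurable_indic.
under eq_integral do rewrite -sumEFin.
rewrite ge0_integral_sum //; last 2 first.
- by move=> i; apply/measurable_EFinP; apply: measurable_funM => //; apply: measurable_indic.
- by move=> i w _; rewrite lee_fin mulr_ge0.
rewrite -sumEFin; apply: eq_bigr => i _.
under eq_integral do rewrite EFinM.
rewrite ge0_integralZl_EFin // integral_indic // setIT EFinM; congr (_ * _)%E.
exact: prE.
Qed.

Lemma pr_indic_le (I J : finType) (al : I -> R) (A : I -> set T)
    (be : J -> R) (B : J -> set T) :
  (forall i, 0 <= al i) -> (forall j, 0 <= be j) ->
  (forall i, measurable (A i)) -> (forall j, measurable (B j)) ->
  (forall w, \sum_i al i * \1_(A i) w <= \sum_j be j * \1_(B j) w) ->
  \sum_i al i * pr mu (A i) <= \sum_j be j * pr mu (B j).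
Proof.
move=> al0 be0 mA mB h; rewrite -lee_fin -!integral_indic_sum //.
have mS (K : finType) (ga : K -> R) (C : K -> set T) : (forall k, measurable (C k)) ->
    measurable_fun setT (fun w => (\sum_k ga k * \1_(C k) w)%:E).
  move=> mC; apply/measurable_EFinP; apply: measurable_sum => k.
  by apply: measurable_funM => //; apply: measurable_indic.
apply: ge0_le_integral => //; try exact: mS.
- by move=> w _; rewrite lee_fin sumr_ge0 // => i _; rewrite mulr_ge0.
- by move=> w _; rewrite lee_fin h.
Qed.

(* [(N - c)^2 >= del^2] on [A], expanded so that all coefficients are nonnegative. *)
Lemma chebyshev_count (I : finType) (A : set T) (B : I -> set T) (c del : R) :
  0 <= c -> measurable A -> (forall i, measurable (B i)) ->
  (forall w, A w -> del ^+ 2 <= (\sum_i \1_(B i) w - c) ^+ 2) ->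
  del ^+ 2 * pr mu A + 2 * c * \sum_i pr mu (B i) <=
    c ^+ 2 + \sum_i \sum_j pr mu (B i `&` B j).
Proof.
move=> c0 mA mB h.
pose al (o : option I) := if o is Some _ then 2 * c else del ^+ 2.
pose A' o := if o is Some i then B i else A.
pose be (o : option (I * I)) := if o is Some _ then 1 else c ^+ 2.
pose B' o := if o is Some ij then B ij.1 `&` B ij.2 else setT.
have split_opt (K : finType) (f : option K -> R) :
    \sum_o f o = f None + \sum_k f (Some k).
  rewrite (bigD1 None) //=; congr (_ + _).
  rewrite (reindex_omap Some id) /=; first by apply: eq_bigl => k; rewrite eqxx.
  by case.
have := @pr_indic_le _ _ al A' be B'; rewrite !split_opt /= prT mulr1.
rewrite -(pair_bigA _ (fun i j => 1 * pr mu (B i `&` B j))) /=.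
rewrite -mulr_sumr.
under [X in _ -> _ -> _ -> _ -> _ -> _ <= _ + X]eq_bigr do under eq_bigr do rewrite mul1r.
apply.
- by case=> [i|]; [apply: mulr_ge0|apply: sqr_ge0].
- by case=> [ij|] //; apply: sqr_ge0.
- by case.
- by case=> [[i j]|] //=; apply: measurableI.
move=> w; rewrite !split_opt /= -mulr_sumr indicT mulr1.
rewrite -(pair_bigA _ (fun i j => 1 * \1_(B i `&` B j) w)) /=.
have -> : \sum_i \sum_j 1 * \1_(B i `&` B j) w = (\sum_i \1_(B i) w) ^+ 2 :> R.
  rewrite expr2 mulr_suml; apply: eq_bigr => i _; rewrite mulr_sumr.
  by apply: eq_bigr => j _; rewrite mul1r indicI.
set N : R := \sum_i _.
suff : del ^+ 2 * \1_A w <= (N - c) ^+ 2 by rewrite sqrrB; lra.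
rewrite indicE; case: (boolP (w \in A)) => [|_]; last by rewrite mulr0 sqr_ge0.
by rewrite inE mulr1; apply: h.
Qed.

End IndicatorInequality.

Section Counting.
Context {R : realType} {d : measure_display} {T : measurableType d}.
Variable mu : probability T R.

Lemma borel_cantelli_powR (A : nat -> set T) (C e : R) k0 :
  (forall n, measurable (A n)) -> 0 < e ->
  (forall k, (k0 <= k)%N -> pr mu (A k) <= C * k.+1%:R `^ (- (1 + e))) ->
  {ae mu, forall w, exists n0, forall n, (n0 <= n)%N -> ~ A n w}.
Proof.
move=> mA e0 hA; pose C' := `|C| + k0.+1%:R `^ (1 + e).
have C'0 : 0 <= C' by rewrite addr_ge0 ?powR_ge0.
apply: (@borel_cantelli_bound _ _ _ mu A (C' * (1 + e^-1))) => // n.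
apply: (@le_trans _ _ (\sum_(k < n) C' * k.+1%:R `^ (- (1 + e)))); last first.
  by rewrite -mulr_sumr ler_wpM2l // sum_powR_bound.
apply: ler_sum => k _; have [kk|kk] := leqP k0 k.
  apply: (le_trans (hA k kk)); rewrite ler_wpM2r ?powR_ge0 //.
  by rewrite (le_trans (ler_norm _)) // lerDl powR_ge0.
apply: (@le_trans _ _ 1); first exact: pr_le1.
have k10 : 0 < k.+1%:R :> R by [].
rewrite -[leLHS](powR_neg (1 + e) k10) [leLHS]mulrC ler_wpM2r ?powR_ge0 //.
apply: (@le_trans _ _ (k0.+1%:R `^ (1 + e))); last by rewrite lerDr.
by apply: ge0_ler_powR; rewrite ?nnegrE ?ler_nat //; [lra|lia].
Qed.

Lemma pr_count (I : finType) (A : set T) (B : I -> set T) (c : R) : 0 <= c ->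
  measurable A -> (forall i, measurable (B i)) ->
  (forall w, A w -> c <= \sum_(i : I) \1_(B i) w) ->
  c * pr mu A <= \sum_(i : I) pr mu (B i).
Proof.
move=> c0 mA mB h.
have := @pr_indic_le _ _ _ mu 'I_1 I (fun=> c) (fun=> A) (fun=> 1) B.
rewrite big_ord1.
under eq_bigr do rewrite mul1r.
apply => // w; rewrite big_ord1; under eq_bigr do rewrite mul1r.
rewrite indicE; case: (boolP (w \in A)) => [|_]; first by rewrite inE mulr1; apply: h.
by rewrite mulr0 sumr_ge0.
Qed.

Lemma sum_lt_minn (h M : nat) : (\sum_(v < M) (v < h) = minn h M)%N.
Proof.
elim: M => [|M IH]; first by rewrite big_ord0 minn0.
by rewrite big_ord_recr /= IH; case: ltnP; lia.
Qed.

(* Expectations are encoded as truncated sums of tail probabilities. *)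
Lemma markov_count (h : nat -> T -> nat) (n M : nat) (K : R) :
  (forall i v, measurable [set w | (v < h i w)%N]) ->
  measurable [set w | (M <= \sum_(i < n) h i w)%N] ->
  (forall i, \sum_(v < M) pr mu [set w | (v < h i w)%N] <= K) ->
  M%:R * pr mu [set w | (M <= \sum_(i < n) h i w)%N] <= n%:R * K.
Proof.
move=> mh mA hK.
pose B (iv : 'I_n * 'I_M) := [set w | (iv.2 < h iv.1 w)%N].
apply: (@le_trans _ _ (\sum_(iv : 'I_n * 'I_M) pr mu (B iv))).
  apply: pr_count => // [iv|w hw]; first exact: mh.
  rewrite (eq_bigr (fun iv : 'I_n * 'I_M => ((iv.2 < h iv.1 w)%N : nat)%:R)); last first.
    move=> iv _; rewrite indicE; congr (_ %:R); congr nat_of_bool.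
    by apply/idP/idP; rewrite inE.
  rewrite -natr_sum ler_nat -(pair_bigA _ (fun (i : 'I_n) (v : 'I_M) => (v < h i w)%N : nat)) /=.
  under eq_bigr do rewrite sum_lt_minn.
  have key m : (M <= \sum_(i < m) h i w -> M <= \sum_(i < m) minn (h i w) M)%N.
    elim: m => [|m IH]; first by rewrite !big_ord0.
    have mono l : (minn (\sum_(i < l) h i w) M <= \sum_(i < l) minn (h i w) M)%N.
      elim: l => [|l]; first by rewrite !big_ord0 min0n.
      rewrite !big_ord_recr /=; set a := (\sum_(i < l) h i w)%N.
      by set b := (\sum_(i < l) minn _ _)%N; move: (h l w) => x; lia.
    by move=> hM; have := mono m.+1; rewrite (minn_idPr hM).
  exact: key.
rewrite -(pair_bigA _ (fun (i : 'I_n) (v : 'I_M) => pr mu [set w | (v < h i w)%N])) /=.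
apply: (@le_trans _ _ (\sum_(i < n) K)); first exact: ler_sum.
by rewrite sumr_const card_ord mulr_natl.
Qed.

End Counting.

Section ExcursionProb.
Context {R : realType} {d : measure_display} {T : measurableType d}.
Variables (mu : probability T R) (S : set R) (X : nat -> T -> R)
  (F : nat -> set (set T)).
Hypotheses (hA0 : A0 mu S X F) (hA3 : A3 mu X) (hrec : recurrent mu X).

Let mE := measurable_excursion hA0.
Let Oae := N_infinite_ae hA0 hA3 hrec.

Lemma pr_len_gt i v : pr mu [set w | (v < len X w i)%N] = pr mu (alive X v.+1).
Proof.
pose B := [set s : seq R | (v < size s)%N].
rewrite -[LHS]/(pr mu (excursion X i.+1 @^-1` B)) (excursion_ident hA0 hA3 hrec).
apply/eqP; rewrite eq_le; apply/andP; split; apply: pr_ae_le; try exact: mE;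
  try exact: (measurable_alive hA0).
  by apply: filterS Oae => w Ow hw; apply/(len_gt_alive _ Ow).
by apply: filterS Oae => w Ow hw; apply/(len_gt_alive _ Ow).
Qed.

Lemma pr_all_short n M : pr mu [set w | forall i, (i < n)%N -> (len X w i <= M)%N]
  <= expR (- (n%:R * pr mu (alive X M.+1))).
Proof.
pose B (i : nat) := [set s : seq R | (size s <= M)%N].
have -> : [set w | forall i, (i < n)%N -> (len X w i <= M)%N] =
   \bigcap_(i in `I_n) (excursion X i.+1 @^-1` B i).
  by apply/seteqP; split.
rewrite (excursion_indep hA0 hA3 hrec).
have e i : pr mu (excursion X i.+1 @^-1` B i) = 1 - pr mu (alive X M.+1).
  rewrite -(pr_len_gt i) -prC; last exact: (mE i.+1 [set s | (M < size s)%N]).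
  congr (pr mu _); apply/seteqP; split => w; rewrite /B /= -/(len X w i) => h.
    by apply/negP; rewrite -leqNgt.
  by move/negP: h; rewrite -leqNgt.
rewrite (eq_bigr (fun=> 1 - pr mu (alive X M.+1))) => [|i _]; last exact: e.
rewrite prodr_const card_ord -mulrN mulrC expRM_natr.
have q1 : pr mu (alive X M.+1) <= 1 by apply: pr_le1; exact: (measurable_alive hA0).
apply: lerXn2r; rewrite ?nnegrE ?expR_ge0 //; first lra.
exact: expR_ge1Dx.
Qed.

Definition exceeds (y : R) i := [set w | ~~ all (fun x => x <= y) (excursion X i.+1 w)].

Lemma measurable_exceeds y i : measurable (exceeds y i).
Proof. exact: (mE i.+1 [set s | ~~ all (fun x => x <= y) s]). Qed.

Lemma pr_exceeds (y K : R) i : 0 <= y ->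
  (forall n, \sum_(i < n) pr mu (overshoot X y i.+1) <= K) -> pr mu (exceeds y i) <= K.
Proof.
move=> y0 hK.
rewrite -[pr _ _]/(pr mu (excursion X i.+1 @^-1` [set s | ~~ all (fun x => x <= y) s])).
rewrite (excursion_ident hA0 hA3 hrec).
have mo j : measurable (overshoot X y j.+1) by exact: (measurable_overshoot hA0).
apply: (@le_trans _ _ (pr mu (\bigcup_j overshoot X y j.+1))); last exact: pr_bigcup_bound.
apply: pr_ae_le => //; first exact: bigcupT_measurable.
apply: filterS2 Oae (start_ae hA0) => w Ow X1 /= nall.
have [|j hj] := exceed_overshoot Ow _ nall; first by rewrite X1.
by exists j.
Qed.

Definition low_len (y : R) i w : nat :=
  if all (fun x => x <= y) (excursion X i.+1 w) then len X w i else 0%N.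

Lemma measurable_low_len y i v : measurable [set w | (v < low_len y i w)%N].
Proof.
exact: (mE i.+1 [set s | (v < if all (fun x => x <= y)%R s then size s else 0)%N]).
Qed.

Lemma pr_low_len_gt (y : R) i v :
  pr mu [set w | (v < low_len y i w)%N] <= pr mu (stay_below X y v.+1).
Proof.
pose B := [set s : seq R | (v < if all (fun x => x <= y)%R s then size s else 0)%N].
rewrite -[leLHS]/(pr mu (excursion X i.+1 @^-1` B)) (excursion_ident hA0 hA3 hrec).
apply: pr_ae_le; [exact: mE|exact: (measurable_stay_below hA0)|].
apply: filterS Oae => w Ow; rewrite /B /=; case: ifP => // hall hv.
exact: all_le_stay_below.
Qed.

Lemma measurable_nat_sum (h : nat -> T -> nat) n M :
  (forall i v, measurable [set w | (v < h i w)%N]) ->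
  measurable [set w | (M <= \sum_(i < n) h i w)%N].
Proof.
move=> mh; elim: n M => [|n IH] M.
  have [->|M0] := posnP M.
    by rewrite (_ : [set _ | _] = setT) //; apply/seteqP; split.
  rewrite (_ : [set _ | _] = set0) // -subset0 => w /=; rewrite big_ord0; lia.
have mhe v : measurable [set w | (v <= h n w)%N].
  case: v => [|v]; last exact: mh.
  by rewrite (_ : [set _ | _] = setT) //; apply/seteqP; split.
rewrite (_ : [set _ | _] = \bigcup_j ([set w | (M - j <= \sum_(i < n) h i w)%N] `&`
   [set w | (j <= h n w)%N])).
  by apply: bigcupT_measurable => j; apply: measurableI.
apply/seteqP; split => w /=; rewrite big_ord_recr /=.
  by move=> hM; exists (h n w) => //; split => //=; lia.
by move=> [j _ [/= h1 h2]]; lia.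
Qed.

(* Excursions below level [y] are controlled in mean, the others by a union bound. *)
Lemma pr_long (y K1 K2 : R) n M : 0 <= y -> (0 < M)%N ->
  (forall m, \sum_(i < m) pr mu (stay_below X y i.+1) <= K1) ->
  (forall m, \sum_(i < m) pr mu (overshoot X y i.+1) <= K2) ->
  pr mu [set w | (M <= \sum_(i < n) len X w i)%N] <= n%:R * K2 + n%:R * K1 / M%:R.
Proof.
move=> y0 M0 hK1 hK2; have M0' : 0 < M%:R :> R by rewrite ltr0n.
have mlen : measurable [set w | (M <= \sum_(i < n) len X w i)%N].
  apply: (measurable_nat_sum (h := fun i w => len X w i)) => i v.
  exact: (mE i.+1 [set s | (v < size s)%N]).
have mlow : measurable [set w | (M <= \sum_(i < n) low_len y i w)%N].
  by apply: (measurable_nat_sum (h := low_len y)) => i v; apply: measurable_low_len.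
have mU : measurable (\bigcup_(i in `I_n) exceeds y i).
  by apply: bigcup_measurable => i _; apply: measurable_exceeds.
apply: (@le_trans _ _ (pr mu ((\bigcup_(i in `I_n) exceeds y i) `|`
   [set w | (M <= \sum_(i < n) low_len y i w)%N]))).
  apply: le_pr => //; first exact: measurableU.
  move=> w /= hw; have [h|h] := pselect ((\bigcup_(i in `I_n) exceeds y i) w); [by left|right].
  rewrite /= (eq_bigr (fun i : 'I_n => len X w i)) // => i _; rewrite /low_len.
  by case: ifPn => // hall; exfalso; apply: h; exists i => /=.
apply: (le_trans (prU_le _ _ _)) => //; apply: lerD.
  apply: (le_trans (pr_bigcup_lt_le _ _ _)); first by move=> i; apply: measurable_exceeds.
  apply: (@le_trans _ _ (\sum_(i < n) K2)); first by apply: ler_sum => i _; apply: pr_exceeds.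
  by rewrite sumr_const card_ord mulr_natl.
rewrite ler_pdivlMr // mulrC; apply: markov_count => // i.
  exact: measurable_low_len.
apply: le_trans (hK1 M); apply: ler_sum => v _; exact: pr_low_len_gt.
Qed.

End ExcursionProb.

Section Dyadic.
Context {R : realType}.
Implicit Types (k : nat) (g eps : R).

Lemma ln2_bounds : 0 < ln (2 : R) <= 1.
Proof.
apply/andP; split; first by rewrite ln_gt0 // ltr1n.
by have := @le_ln1Dx R 1; rewrite (_ : 1 + 1 = 2) //; apply; lra.
Qed.

Definition dy k : R := 2 ^+ k.

Lemma dy_gt0 k : 0 < dy k. Proof. by rewrite exprn_gt0. Qed.

Lemma dyE k : dy k = (2 ^ k)%:R. Proof. by rewrite /dy natrX. Qed.

Lemma dyS k : dy k.+1 = 2 * dy k. Proof. by rewrite /dy exprS. Qed.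

Lemma dy_ge k : k.+1%:R <= dy k.
Proof. by rewrite dyE ler_nat ltn_expl. Qed.

Lemma ln_dy k : ln (dy k) = k%:R * ln 2.
Proof. by rewrite /dy lnXn // mulr_natl. Qed.

Lemma powR_le_neg (x y a : R) : 0 < x -> x <= y -> a <= 0 -> y `^ a <= x `^ a.
Proof.
move=> x0 xy a0; have y0 : 0 < y by apply: lt_le_trans xy.
by rewrite /powR !gt_eqF // ler_expR; apply: ler_wnM2l => //; rewrite ler_ln.
Qed.

Lemma expRN_le_powR (c' eps : R) : 0 < c' -> 0 < eps -> exists C : R, forall k,
  expR (- (c' * k.+1%:R `^ eps)) <= C * k.+1%:R `^ (- 2).
Proof.
move=> c0 e0; pose m := Num.bound (2 / eps).
have hm : 2 / eps < m%:R by apply: archi_boundP; rewrite divr_ge0 // ltW.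
exists ((m.+1%:R / c') ^+ m.+1) => k.
set x : R := k.+1%:R; have x1 : 1 <= x by rewrite ler1n.
have x0 : 0 < x by lra.
have z0 : 0 < c' * x `^ eps by rewrite mulr_gt0 // powR_gt0.
have := expR_ge_pow m (ltW z0); rewrite expRN => h.
have p0 : 0 < (c' * x `^ eps / m.+1%:R) ^+ m.+1 by rewrite exprn_gt0 // divr_gt0.
apply: (@le_trans _ _ ((c' * x `^ eps / m.+1%:R) ^+ m.+1)^-1).
  by rewrite lef_pV2 ?posrE ?expR_gt0.
rewrite (_ : ((c' * x `^ eps / m.+1%:R) ^+ m.+1)^-1 =
  (m.+1%:R / c') ^+ m.+1 * (x `^ eps) ^- m.+1); last first.
  rewrite -exprVn -[(x `^ eps) ^- m.+1]exprVn -exprMn; congr (_ ^+ _).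
  by rewrite !invfM invrK; ring.
rewrite ler_wpM2l ?exprn_ge0 ?divr_ge0 ?(ltW c0) //.
rewrite -powR_mulrn ?powR_ge0 // -powRrM -powRN; apply: ler_powR => //.
rewrite lerN2; move: hm; rewrite ltr_pdivrMr // => hm.
by rewrite -[m.+1%:R]natr1 mulrDr; lra.
Qed.

Definition nu_up g eps k := dy k `^ (g / 2) * (k%:R * ln 2) `^ (1 + eps).
Definition nu_lo g eps k := (2 * dy k) `^ (g / 2) * (k%:R * ln 2) `^ (- (2 + g + eps)).

End Dyadic.

Section CountBounds.
Context {R : realType} {d : measure_display} {T : measurableType d}.
Variables (mu : probability T R) (S : set R) (X : nat -> T -> R)
  (F : nat -> set (set T)).
Hypotheses (hA0 : A0 mu S X F) (hA1 : A1 mu S X F).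
Variables (c s2 p : R).
Hypotheses (hA2 : A2 mu X F c s2) (p2 : 2 < p) (hM : Mp mu X F p) (hA3 : A3 mu X).
Variable g : R.
Hypotheses (g0 : 0 < g) (g2 : g <= 2) (cE : c = - (g - 1) * s2 / 2).
Variable eps : R.
Hypothesis eps0 : 0 < eps.

Let hrec : recurrent mu X := null_recurrent hA0 hA1 hA2 p2 hM g0 cE g2.

Lemma fplus_dyadic (C1 : R) : 1 <= C1 -> exists2 C3 : R, 0 < C3 & forall k,
  fplus g (2 * (C1 * dy k.+1 `^ (1 / 2))) <= C3 * (dy k.+1 `^ (g / 2) * k.+1%:R).
Proof.
move=> C11; have [l0 l1] := andP (@ln2_bounds R).
have lC : 0 <= ln (2 * C1) by apply: ln_ge0; lra.
exists ((2 * C1) `^ g * (ln (2 * C1) + 1)).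
  by rewrite mulr_gt0 ?powR_gt0 //; lra.
move=> k; have D0 := @dy_gt0 R k.+1; set D := dy k.+1 in D0 *.
have k1 : 1 <= k.+1%:R :> R by rewrite ler1n.
have C20 : 0 < 2 * C1 by lra.
have Dh : 0 < D `^ (1 / 2) by rewrite powR_gt0.
rewrite /fplus mulrA powRM ?(ltW C20) ?(ltW Dh) // -powRrM.
rewrite (_ : 1 / 2 * g = g / 2); last by lra.
rewrite [leRHS]mulrACA ler_wpM2l ?mulr_ge0 ?powR_ge0 //.
rewrite ge_max; apply/andP; split; last by nra.
rewrite lnM ?posrE // ln_powR /D ln_dy.
have : k.+1%:R * ln 2 <= k.+1%:R :> R by rewrite ler_piMr.
nra.
Qed.

Lemma upper_events : exists C : R, exists k0 : nat, forall k, (k0 <= k)%N ->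
  pr mu [set w | forall i, (i < (Num.truncn (nu_up g eps k.+1)).+1)%N ->
    (len X w i <= 2 ^ k.+2)%N] <= C * k.+1%:R `^ (- (1 + 1)).
Proof.
have [K K0 [q q0 [y0 hlow]]] := lower_tail hA0 hA1 hA2 p2 hM hA3 hrec g0 g2 cE.
pose C1 := 1 + 3 * K; have C11 : 1 <= C1 by rewrite /C1; lra.
have [C3 C30 hC3] := fplus_dyadic C11.
have [l0 l1] := andP (@ln2_bounds R).
pose c' := q * ln 2 `^ (1 + eps) / C3.
have c'0 : 0 < c' by rewrite divr_gt0 // mulr_gt0 // powR_gt0.
have [C hC] := expRN_le_powR c'0 eps0.
exists C, (Num.bound (`|y0| ^+ 2)) => k kk; rewrite (_ : 1 + 1 = 2) //.
apply: le_trans (hC k).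
apply: (le_trans (pr_all_short hA0 hA3 hrec _ _)).
rewrite ler_expR lerN2; set n := (Num.truncn _).+1; set N := (2 ^ k.+2).+1.
have D0 := @dy_gt0 R k.+1; set D := dy k.+1 in D0.
have D1 : 1 <= D by apply: le_trans (dy_ge _); rewrite ler1n.
have Dk : `|y0| ^+ 2 <= D.
  apply: (@le_trans _ _ k.+2%:R); last exact: dy_ge.
  apply: (@le_trans _ _ (Num.bound (`|y0| ^+ 2))%:R).
    by apply: ltW; apply: archi_boundP; rewrite sqr_ge0.
  by rewrite ler_nat (leq_trans kk) // ltnW.
pose y := C1 * D `^ (1 / 2).
have Dh : D `^ (1 / 2) ^+ 2 = D.
  by rewrite -powR_mulrn ?powR_ge0 // -powRrM (_ : 1 / 2 * 2 = 1) ?powRr1 ?(ltW D0) //; lra.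
have hy : y0 <= y.
  apply: (le_trans (ler_norm _)); apply: (@le_trans _ _ (D `^ (1 / 2))).
    by rewrite -(@ler_pXn2r _ 2) ?nnegrE ?powR_ge0 // Dh.
  by rewrite /y ler_peMl ?powR_ge0.
have hN : K * N%:R <= y ^+ 2.
  rewrite /y exprMn Dh /N -[(2 ^ k.+2).+1%:R]natr1 -dyE dyS -/D.
  have : K * (2 * D + 1) <= K * (3 * D) by rewrite ler_wpM2l ?(ltW K0) //; lra.
  move=> /le_trans; apply; rewrite mulrCA mulrA ler_wpM2r ?(ltW D0) // /C1; nra.
have ql := hlow y N hy hN.
have qN := ler_wpM2r (pr_ge0 mu (alive X N)) (hC3 k); rewrite -/D -/y in qN.
have k10 : 0 < k.+1%:R :> R by rewrite ltr0n.
have nnu : nu_up g eps k.+1 <= n%:R by apply: ltW; apply: truncnS_gt.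
apply: le_trans (ler_wpM2r (pr_ge0 mu (alive X N)) nnu).
rewrite /nu_up -/D powRM ?(ltW l0) ?(ltW k10) // (powR_add 1 eps k10) powRr1 ?(ltW k10) //.
rewrite /c' mulrAC ler_pdivrMr //.
have := le_trans ql qN => h.
have h0 : 0 <= ln 2 `^ (1 + eps) * k.+1%:R `^ eps by rewrite mulr_ge0 ?powR_ge0.
have := ler_wpM2r h0 h; set a := ln 2 `^ _; set b := k.+1%:R `^ eps.
set P := pr mu _; set Da := D `^ _; set kk1 := k.+1%:R => hh.
have -> : q * a * b = q * (a * b) by ring.
by apply: (le_trans hh); rewrite le_eqVlt; apply/orP; left; apply/eqP; ring.
Qed.

Lemma lower_events : exists C : R, exists k0 : nat, forall k, (k0 <= k)%N ->
  pr mu [set w | (2 ^ k.+1 <= \sum_(i < (Num.truncn (nu_lo g eps k.+1)).+1) len X w i)%N]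
    <= C * k.+1%:R `^ (- (1 + eps)).
Proof.
have [K K0 [y0 y01 hest]] := null_estimates hA0 hA1 hA2 p2 hM g0 cE g2.
have [l0 l1] := andP (@ln2_bounds R).
have g0' := g0; have g2' := g2; have eps0' := eps0.
have gh0 : 0 < g / 2 by lra.
have [xa hxa] := ln_powR_small (2 + g + eps) gh0 (@ltr01 R).
have e1 : 0 < ln 2 / y0 by rewrite divr_gt0 //; lra.
have h2 : 0 < 1 / 2 :> R by lra.
have [xb hxb] := ln_powR_small 1 h2 e1.
pose a := 2 + g + eps; pose lam : R := ln 2 `^ (- a).
pose k0 := maxn (Num.bound `|xa|) (Num.bound `|xb|).
exists (4 * 2 `^ (g / 2) * lam * K), k0 => k kk.
set n := (Num.truncn _).+1.
have D0 := @dy_gt0 R k.+1; set D := dy k.+1 in D0.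
have big (z : R) : (Num.bound `|z| <= k)%N -> z <= D.
  move=> hz; apply: (le_trans (ler_norm _)); apply: (@le_trans _ _ (Num.bound `|z|)%:R).
    by apply: ltW; apply: archi_boundP.
  by apply: (@le_trans _ _ k.+2%:R); [rewrite ler_nat (leq_trans hz) // ltnW|exact: dy_ge].
have Dxa : xa <= D by apply: big; rewrite (leq_trans _ kk) // leq_maxl.
have Dxb : xb <= D by apply: big; rewrite (leq_trans _ kk) // leq_maxr.
set kap : R := k.+1%:R.
have kap1 : 1 <= kap by rewrite ler1n.
have kap0 : 0 < kap by lra.
have lnD : ln D = kap * ln 2 by rewrite /D ln_dy.
have lnD0 : 0 < ln D by rewrite lnD mulr_gt0.
pose P := D `^ (g / 2); have P0 : 0 < P by rewrite powR_gt0.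
have nuE : nu_lo g eps k.+1 = 2 `^ (g / 2) * P * (kap `^ (- a) * lam).
  rewrite /nu_lo -/D -/kap powRM ?(ltW D0) // (powRM _ (ltW kap0) (ltW l0)) -/P.
  by rewrite -/a -/lam.
have nu1 : 1 <= nu_lo g eps k.+1.
  have := hxa D Dxa; rewrite -/a -/P mul1r => h.
  rewrite nuE (_ : kap `^ (- a) * lam = ln D `^ (- a)); last first.
    by rewrite lnD powRM ?(ltW kap0) ?(ltW l0).
  apply: (@le_trans _ _ (P * ln D `^ (- a))).
    by rewrite -[leLHS](powR_neg a lnD0) [leLHS]mulrC ler_wpM2r ?powR_ge0.
  rewrite ler_wpM2r ?powR_ge0 // ler_peMl ?(ltW P0) //.
  by rewrite -[leLHS](powRr0 2); apply: ler_powR; lra.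
have n2 : n%:R <= 2 * nu_lo g eps k.+1.
  rewrite /n -[(Num.truncn _).+1%:R]natr1; have := @truncn_itv R _ (le_trans ler01 nu1); lra.
pose y := D `^ (1 / 2) / kap.
have hy : y0 <= y.
  have := hxb D Dxb; rewrite powRr1 ?(ltW lnD0) // lnD [leLHS]mulrC -mulrA ler_pM2l // => h.
  rewrite /y ler_pdivlMr //; move: h; rewrite [leRHS]mulrC.
  by rewrite ler_pdivlMr ?(lt_le_trans ltr01 y01) // mulrC.
have yp : 0 < y by lra.
have y1 : 1 <= y by lra.
have lny0 : 0 <= ln y by apply: ln_ge0.
have Dh0 : 0 < D `^ (1 / 2) by rewrite powR_gt0.
have lny : ln y <= kap.
  apply: (@le_trans _ _ (ln (D `^ (1 / 2)))).
    by rewrite ler_ln ?posrE // /y ler_pdivrMr // ler_peMr // ltW.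
  by rewrite ln_powR lnD; nra.
have yg (b : R) : y `^ b = D `^ (b / 2) * kap `^ (- b).
  rewrite /y powRM ?(ltW Dh0) ?invr_ge0 ?(ltW kap0) // -powRrM.
  have -> : kap^-1 = kap `^ (- 1) by rewrite powR_inv1 ?(ltW kap0).
  by rewrite -powRrM mulN1r; congr (_ `^ _ * _); lra.
have hb m := proj1 (hest y m hy); have ho m := proj2 (hest y m hy).
have M0 : (0 < 2 ^ k.+1)%N by rewrite expn_gt0.
have yn0 : 0 <= y by apply: ltW.
apply: (le_trans (pr_long hA0 hA3 hrec n yn0 M0 hb ho)).
rewrite -dyE -/D.
have kpow : kap `^ (- (1 + eps)) = kap `^ (- a) * kap `^ (1 + g).
  by rewrite -powR_add //; congr (_ `^ _); rewrite /a; lra.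
have PD : P * D `^ (- g / 2) = 1.
  by rewrite mulrC (_ : - g / 2 = - (g / 2)) ?powR_neg // mulNr.
have lam0 : 0 < lam by rewrite powR_gt0.
pose Q := 2 `^ (g / 2) * lam * K * kap `^ (- (1 + eps)).
have Q0 : 0 <= Q by rewrite /Q !mulr_ge0 ?powR_ge0 ?(ltW lam0) ?(ltW K0).
have two : 0 < 2 `^ (g / 2) :> R by rewrite powR_gt0.
have t1 : n%:R * (K * (ln y * y `^ (- g))) <= 2 * Q.
  apply: (@le_trans _ _ (2 * nu_lo g eps k.+1 * (K * (kap * y `^ (- g))))).
    apply: ler_pM => //.
      by apply: mulr_ge0; [exact: ltW|apply: mulr_ge0; rewrite ?powR_ge0].
    by rewrite ler_wpM2l ?(ltW K0) // ler_wpM2r ?powR_ge0.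
  rewrite nuE yg opprK le_eqVlt; apply/orP; left; apply/eqP.
  rewrite /Q kpow (powR_add 1 g kap0) powRr1 ?(ltW kap0) //.
  transitivity (2 * (2 `^ (g / 2) * lam * K * (kap `^ (- a) * (kap * kap `^ g))) *
    (P * D `^ (- g / 2))); first by ring.
  by rewrite PD mulr1.
have t2 : n%:R * (K * (y `^ (2 - g) * ln y ^+ 2)) / D <= 2 * Q.
  rewrite ler_pdivrMr //.
  apply: (@le_trans _ _ (2 * nu_lo g eps k.+1 * (K * (y `^ (2 - g) * kap ^+ 2)))).
    apply: ler_pM => //.
      by apply: mulr_ge0; [exact: ltW|apply: mulr_ge0; rewrite ?powR_ge0 ?sqr_ge0].
    rewrite ler_wpM2l ?(ltW K0) // ler_wpM2l ?powR_ge0 //.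
    by rewrite lerXn2r ?nnegrE // ltW.
  rewrite nuE yg.
  have DE : D `^ ((2 - g) / 2) = D * D `^ (- g / 2).
    rewrite -{2}(powRr1 (ltW D0)) -powR_add //; congr (_ `^ _); lra.
  have kE : kap `^ (- (2 - g)) * kap ^+ 2 = kap `^ g.
    rewrite -powR_mulrn ?(ltW kap0) // -powR_add //; congr (_ `^ _); lra.
  apply: (@le_trans _ _ (2 * (2 `^ (g / 2) * lam * K * (kap `^ (- a) * kap `^ g)) * D)).
    rewrite le_eqVlt; apply/orP; left; apply/eqP.
    transitivity (2 * (2 `^ (g / 2) * lam * K * (kap `^ (- a) *
      (kap `^ (- (2 - g)) * kap ^+ 2))) * D * (P * D `^ (- g / 2))).
      by rewrite DE; ring.
    by rewrite PD kE mulr1.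
  rewrite ler_wpM2r ?(ltW D0) // ler_wpM2l // /Q kpow.
  rewrite ler_wpM2l //; first by rewrite !mulr_ge0 ?(ltW lam0) ?(ltW K0) ?(ltW two).
  rewrite ler_wpM2l ?powR_ge0 //; apply: ler_powR => //; lra.
apply: (le_trans (lerD t1 t2)); rewrite /Q; lra.
Qed.

Lemma excursion_count_bounds : {ae mu, forall w, exists t0 : nat, forall t : nat, (t0 <= t)%N ->
   ((t%:R `^ (g / 2) * ln t%:R `^ (- (2 + g + eps)))%R%:E <= Ncount X t w)%E /\
   (Ncount X t w <= (t%:R `^ (g / 2) * ln t%:R `^ (1 + eps))%R%:E)%E}.
Proof.
have [Cu [ku hu]] := upper_events; have [Cl [kl hl]] := lower_events.
have [l0 l1] := andP (@ln2_bounds R).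
have mE := measurable_excursion hA0.
have mup k : measurable [set w | forall i, (i < (Num.truncn (nu_up g eps k.+1)).+1)%N ->
    (len X w i <= 2 ^ k.+2)%N].
  set n := (Num.truncn _).+1.
  rewrite (_ : [set _ | _] = \bigcap_(i in `I_n)
    (excursion X i.+1 @^-1` [set s | (size s <= 2 ^ k.+2)%N])).
    by apply: bigcap_measurableType => i _; exact: mE.
  by apply/seteqP; split.
have mlo k : measurable [set w | (2 ^ k.+1 <=
    \sum_(i < (Num.truncn (nu_lo g eps k.+1)).+1) len X w i)%N].
  apply: (measurable_nat_sum (h := fun i w => len X w i)) => i v.
  exact: (mE i.+1 [set s | (v < size s)%N]).
have bu := borel_cantelli_powR mup (@ltr01 R) hu.
have bl := borel_cantelli_powR mlo eps0 hl.
apply: filterS3 (N_infinite_ae hA0 hA3 hrec) bu bl => w Ow [nu hnu] [nl hnl].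
exists (maxn (tn X w 1) (2 ^ (maxn nu nl).+1)) => t.
rewrite geq_max => /andP[ht1 ht2].
have t0 : (0 < t)%N by apply: leq_trans ht2; rewrite expn_gt0.
pose k := (trunc_log 2 t).-1.
have kk : (maxn nu nl <= k)%N.
  by have := trunc_log_max (isT : 1 < 2)%N ht2; rewrite /k; lia.
have kS : (trunc_log 2 t = k.+1)%N.
  by have := trunc_log_max (isT : 1 < 2)%N ht2; rewrite /k; lia.
have := trunc_log_bounds (isT : 1 < 2)%N t0; rewrite /= kS => /andP[tlo thi].
have [N [N1 NE Nlo Nhi]] := NcountP Ow ht1.
have Dt : dy k.+1 <= t%:R :> R by rewrite dyE ler_nat.
have tD : t%:R <= 2 * dy k.+1 :> R by rewrite -dyS dyE ler_nat ltnW.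
have D0 := @dy_gt0 R k.+1.
have tp : 0 < t%:R :> R by rewrite ltr0n.
have kl2 : 0 < k.+1%:R * ln 2 :> R by rewrite mulr_gt0.
have lnt : k.+1%:R * ln 2 <= ln t%:R :> R by rewrite -ln_dy ler_ln ?posrE.
have g0' := g0; have eps0' := eps0.
have gh : 0 <= g / 2 by lra.
rewrite NE !lee_fin; split.
- apply: (@le_trans _ _ (nu_lo g eps k.+1)).
    apply: ler_pM; rewrite ?powR_ge0 //.
      by apply: ge0_ler_powR; rewrite ?nnegrE // ?(ltW tp) // mulr_ge0 // ltW.
    by apply: powR_le_neg => //; lra.
  set n := (Num.truncn (nu_lo g eps k.+1)).+1.
  apply: (@le_trans _ _ n%:R); first by apply: ltW; apply: truncnS_gt.
  rewrite ler_nat leqNgt; apply/negP => Nn.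
  have nlk : (nl <= k)%N := leq_trans (leq_maxr _ _) kk.
  apply: (hnl k nlk) => /=; rewrite -/n.
  have := le_tn Ow Nn; rewrite (tn_sum n Ow) add1n => h.
  by rewrite -ltnS; exact: leq_trans (leq_ltn_trans tlo Nhi) h.
- have step : nu_up g eps k.+1 <= t%:R `^ (g / 2) * ln t%:R `^ (1 + eps).
    apply: ler_pM; rewrite ?powR_ge0 //.
      by apply: ge0_ler_powR; rewrite ?nnegrE // ltW.
    have lt0 : 0 < ln t%:R :> R by apply: lt_le_trans lnt.
    by apply: ge0_ler_powR; rewrite ?nnegrE ?(ltW kl2) ?(ltW lt0) //; lra.
  apply: le_trans step; rewrite leNgt; apply/negP => nuN.
  have nuk : (nu <= k)%N := leq_trans (leq_maxl _ _) kk.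
  apply: (hnu k nuk) => i; set n := (Num.truncn _).+1 => ilt.
  have nu0 : 0 <= nu_up g eps k.+1 by rewrite mulr_ge0 ?powR_ge0.
  have nN : (n <= N)%N by rewrite /n truncn_lt_nat.
  have iN : (i.+1 <= N)%N := leq_trans ilt nN.
  rewrite lenE //; apply: (leq_trans (leq_subr _ _)).
  exact: leq_trans (le_tn Ow iN) (leq_trans Nlo (ltnW thi)).
Qed.

End CountBounds.

(** * The strong law of large numbers *)

Section Geometric.
Context {R : realType}.
Implicit Types (rho x : R) (a : nat -> R).

Lemma geometric_tail rho x n : 1 < rho -> 0 < x ->
  \sum_(j < n) (if x <= rho ^+ j then rho ^- j else 0) <= rho / (rho - 1) / x.
Proof.
move=> r1 x0; have r0 : 0 < rho by lra.
have rm : 0 < rho - 1 by lra.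
have xi0 : 0 < x^-1 by rewrite invr_gt0.
pose h j := Num.min (rho / x) (rho * rho ^- j).
suff : (rho - 1) * \sum_(j < n) (if x <= rho ^+ j then rho ^- j else 0) + h n <= rho / x.
  have hn : 0 <= h n.
    by rewrite /h le_min; apply/andP; split; apply: mulr_ge0; rewrite ?(ltW r0) ?(ltW xi0)
       ?invr_ge0 ?exprn_ge0 ?(ltW r0).
  move=> hs; rewrite mulrAC ler_pdivlMr // mulrC; lra.
elim: n => [|n IH]; first by rewrite big_ord0 mulr0 add0r /h ge_min lexx.
rewrite big_ord_recr /=; apply: le_trans IH; rewrite mulrDr -addrA lerD2l.
have p0 : 0 < rho ^- n by rewrite invr_gt0 exprn_gt0.
have hS : rho * rho ^- n.+1 = rho ^- n.
  by rewrite exprS invfM mulrA mulfV ?mul1r // gt_eqF.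
rewrite /h hS; case: ifPn => hx.
  have px : rho ^- n <= x^-1 by rewrite lef_pV2 ?posrE ?exprn_gt0.
  have e1 : rho * rho ^- n <= rho / x by rewrite ler_wpM2l // ltW.
  by rewrite (min_idPr e1) [X in _ + X]min_r; nra.
rewrite mulr0 add0r le_min; apply/andP; split; first by rewrite ge_min lexx.
by rewrite ge_min; apply/orP; right; nra.
Qed.

Definition geo rho j : nat := (Num.truncn (rho ^+ j)).+1.

Lemma geo_bounds rho j : 1 <= rho -> rho ^+ j < (geo rho j)%:R <= rho ^+ j + 1.
Proof.
move=> r1; have p0 : 0 <= rho ^+ j by apply: exprn_ge0; lra.
have /andP[h1 h2] := truncn_itv p0.
by rewrite /geo h2 -[(Num.truncn _).+1%:R]natr1 lerD2r h1.
Qed.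

Lemma le_geo rho i j : 1 <= rho -> (i <= j)%N -> (geo rho i <= geo rho j)%N.
Proof.
by move=> r1 ij; rewrite ltnS; apply: le_truncn; apply: ler_weXn2l.
Qed.

Lemma geo_unbounded rho n : 1 < rho -> exists j, (n < geo rho j)%N.
Proof.
move=> r1; have rm : 0 < rho - 1 by lra.
have bern j : 1 + j%:R * (rho - 1) <= rho ^+ j.
  elim: j => [|j IH]; first by rewrite mul0r expr0 addr0.
  have j0 : 0 <= j%:R :> R by [].
  rewrite exprS -[j.+1%:R]natr1; have r0 : 0 <= rho by lra.
  have := ler_wpM2l r0 IH; have := mulr_ge0 j0 (sqr_ge0 (rho - 1)); rewrite expr2; lra.
exists (Num.bound (n%:R / (rho - 1))); rewrite -(ltr_nat R).
have := @archi_boundP R (n%:R / (rho - 1)); rewrite divr_ge0 ?(ltW rm) // => /(_ isT).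
set j := Num.bound _; rewrite ltr_pdivrMr // => hj.
by have /andP[h _] := geo_bounds j (ltW r1); have := bern j; lra.
Qed.

(* [a v] is counted with total weight [O(v) * O(1 / v)]. *)
Lemma geo_sum_bound rho a K n : 1 < rho -> (forall v, 0 <= a v) ->
  (forall k, \sum_(v < k) a v <= K) ->
  \sum_(j < n) (\sum_(v < geo rho j) 2 * v.+1%:R * a v) / (geo rho j)%:R
    <= 4 * (rho / (rho - 1)) * K.
Proof.
move=> r1 a0 aK; have r0 : 0 < rho by lra.
have rm : 0 < rho - 1 by lra.
pose M := geo rho n.
apply: (@le_trans _ _ (\sum_(j < n) \sum_(v < M)
   2 * v.+1%:R * a v * (if v.+1%:R / 2 <= rho ^+ j then rho ^- j else 0))).
  apply: ler_sum => j _; rewrite mulr_suml.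
  have jM : (geo rho j <= M)%N by apply: le_geo; [exact: ltW|exact: ltnW].
  rewrite (big_ord_widen M (fun v => 2 * v.+1%:R * a v / (geo rho j)%:R)) //.
  rewrite big_mkcond; apply: ler_sum => v _.
  have w0 : 0 <= 2 * v.+1%:R * a v by rewrite !mulr_ge0.
  have p0 : 0 < rho ^+ j by rewrite exprn_gt0.
  have p1 : 1 <= rho ^+ j by rewrite exprn_ege1 // ltW.
  have /andP[g1 g2] := geo_bounds j (ltW r1).
  case: ifPn => hv; last by rewrite mulr_ge0 //; case: ifP => // _; rewrite invr_ge0 ltW.
  have vg : v.+1%:R <= (geo rho j)%:R :> R by rewrite ler_nat.
  rewrite ifT; last by rewrite ler_pdivrMr //; lra.
  by rewrite ler_wpM2l // lef_pV2 ?posrE // ?(ltW g1) // (lt_trans p0).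
rewrite exchange_big /=.
apply: (@le_trans _ _ (\sum_(v < M) 4 * (rho / (rho - 1)) * a v)); last first.
  by rewrite -mulr_sumr ler_wpM2l // !mulr_ge0 // ?invr_ge0 ltW.
apply: ler_sum => v _; rewrite -mulr_sumr.
have v0 : 0 < v.+1%:R :> R by [].
have x0 : 0 < v.+1%:R / 2 :> R by rewrite divr_gt0.
have := geometric_tail n r1 x0; set s := \sum_(j < n) _ => hs.
have w0 : 0 <= 2 * v.+1%:R * a v by rewrite !mulr_ge0.
apply: (le_trans (ler_wpM2l w0 hs)); rewrite le_eqVlt; apply/orP; left; apply/eqP.
by field; rewrite gt_eqF //= gt_eqF.
Qed.

Lemma double_max_sum a k :
  \sum_(u < k) \sum_(v < k) a (maxn u v) <= \sum_(v < k) 2 * v.+1%:R * a v -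
    \sum_(v < k) a v.
Proof.
elim: k => [|k IH]; first by rewrite !big_ord0 subrr.
rewrite big_ord_recr /=.
under eq_bigr do rewrite big_ord_recr /=.
rewrite big_split /= ![in leRHS]big_ord_recr /= big_ord_recr /=.
have e1 : \sum_(u < k) a (maxn u k) = k%:R * a k.
  rewrite (eq_bigr (fun=> a k)) => [|u _]; first by rewrite sumr_const card_ord mulr_natl.
  by rewrite (maxn_idPr _) // ltnW.
have e2 : \sum_(u < k) a (maxn k u) = k%:R * a k.
  rewrite (eq_bigr (fun=> a k)) => [|u _]; first by rewrite sumr_const card_ord mulr_natl.
  by rewrite (maxn_idPl _) // ltnW.
by rewrite e1 e2 maxnn -[k.+1%:R]natr1; lra.
Qed.

Lemma mul_sum_weight a k : (forall u v, (u <= v)%N -> a v <= a u) -> (0 < k)%N -> 0 <= a k ->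
  k%:R * a k <= (\sum_(v < k) 2 * v.+1%:R * a v) / k%:R.
Proof.
move=> adec k0 ak; rewrite ler_pdivlMr ?ltr0n //.
suff h m : (m <= k)%N -> m%:R * a k * m%:R <= \sum_(v < m) 2 * v.+1%:R * a v by exact: h.
elim: m => [|m IH mk]; first by rewrite big_ord0 mulr0.
rewrite big_ord_recr /= -[m.+1%:R]natr1; have := IH (ltnW mk).
have := adec _ _ (ltnW mk); have m0 : 0 <= m%:R :> R by [].
nra.
Qed.

Lemma geo_interpolation (s : nat -> nat) (m q : R) j0 :
  (forall i j, (i <= j)%N -> (s i <= s j)%N) -> 0 <= m -> 0 < q <= 1 ->
  (forall j, (j0 <= j)%N -> let k := (geo (1 + q) j)%:R in
    `|(s (geo (1 + q) j))%:R - k * m| <= 2 * q * k) ->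
  exists n0, forall n, (n0 <= n)%N -> `|(s n)%:R / n%:R - m| <= q * (2 * m + 6).
Proof.
move=> smono m0 /andP[q0 q1] hs; set rho := 1 + q.
have r1 : 1 < rho by rewrite /rho; lra.
exists (maxn (geo rho j0) (Num.bound q^-1)) => n.
rewrite geq_max => /andP[n1 n2].
have [j [jj0 jn nj]] : exists j, [/\ (j0 <= j)%N, (geo rho j <= n)%N & (n < geo rho j.+1)%N].
  have ex : exists j, (n < geo rho j.+1)%N.
    have [j hj] := geo_unbounded n r1; exists j; apply: (leq_trans hj).
    by apply: le_geo => //; exact: ltW.
  case: (ex_minnP ex) => j hj jmin; exists j.
  have j0j : (j0 <= j)%N.
    rewrite leqNgt; apply/negP => /(le_geo (ltW r1)) h.
    by have := leq_trans hj (leq_trans h n1); rewrite ltnn.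
  split => //; rewrite leqNgt; apply/negP => h; case: j => [|j] in h j0j jmin hj *.
    move: j0j; rewrite leqn0 => /eqP e.
    by have := leq_ltn_trans n1 h; rewrite e ltnn.
  by have := jmin j h; rewrite ltnn.
have [g1 _] := andP (geo_bounds j (ltW r1)).
have [_ g2] := andP (geo_bounds j.+1 (ltW r1)).
have np : (0 < n)%N by apply: leq_trans n1.
set N : R := n%:R; have N0 : 0 < N by rewrite ltr0n.
have qN : 1 <= q * N.
  rewrite mulrC -ler_pdivrMr // mul1r; apply: (@le_trans _ _ (Num.bound q^-1)%:R).
    by apply: ltW; apply: archi_boundP; rewrite invr_ge0 ltW.
  by rewrite ler_nat.
have hk := hs j jj0; have hk1 := hs j.+1 (leqW jj0); rewrite /= in hk hk1.
have sl : (s (geo rho j))%:R <= (s n)%:R :> R by rewrite ler_nat smono.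
have su : (s n)%:R <= (s (geo rho j.+1))%:R :> R by rewrite ler_nat smono // ltnW.
have kn : (geo rho j)%:R <= N by rewrite ler_nat.
have nk : N <= (geo rho j.+1)%:R by rewrite ler_nat ltnW.
move: hk hk1 sl su kn nk; rewrite -/rho.
have kk : (geo rho j.+1)%:R <= rho * (geo rho j)%:R + 1.
  by apply: (le_trans g2); rewrite exprS lerD2r ler_wpM2l // ltW // (lt_trans ltr01).
move: kk; set k : R := (geo rho j)%:R; set k1 : R := (geo rho j.+1)%:R.
set S0 : R := (s (geo rho j))%:R; set S1 : R := (s (geo rho j.+1))%:R; set Sn : R := (s n)%:R.
rewrite /rho !ler_norml => kk /andP[l0 u0] /andP[l1 u1] sl su kn nk.
have Sn0 : 0 <= Sn by [].
have k0 : 0 <= k by [].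
have NM : N != 0 by rewrite gt_eqF.
have -> : Sn / N - m = (Sn - N * m) / N by rewrite mulrBl [N * m]mulrC mulfK.
rewrite ler_pdivlMr // ler_pdivrMr //; apply/andP; split.
- have [hm|hm] := leP (2 * q) m; last by nra.
  have lo : N * (1 - 2 * q) <= k.
    have : N <= (1 + q) * k + q * N by lra.
    nra.
  have : k * (m - 2 * q) <= Sn by nra.
  have : N * (1 - 2 * q) * (m - 2 * q) <= k * (m - 2 * q) by apply: ler_wpM2r => //; lra.
  have : 0 <= N * q * m by rewrite !mulr_ge0 // ltW.
  have : 0 <= N * q * q by rewrite !mulr_ge0 // ltW.
  have : 0 < N * q by rewrite mulr_gt0.
  nra.
- have up : k1 <= N * (1 + 2 * q) by nra.
  have : Sn <= k1 * (m + 2 * q) by lra.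
  have : k1 * (m + 2 * q) <= N * (1 + 2 * q) * (m + 2 * q) by apply: ler_wpM2r => //; lra.
  have : N * q * q <= N * q by rewrite ler_piMr // mulr_ge0 // ltW.
  have : 0 < N * q by rewrite mulr_gt0.
  nra.
Qed.

End Geometric.

Section StrongLaw.
Context {R : realType} {d : measure_display} {T : measurableType d}.
Variables (mu : probability T R) (h : nat -> T -> nat) (a : nat -> R) (m : R).
Let tail i v := [set w | (v < h i w)%N].
Hypothesis mh : forall i v, measurable (tail i v).
Hypothesis pr_tail : forall i v, pr mu (tail i v) = a v.
Hypothesis pr_tailI : forall i j u v, i != j -> pr mu (tail i u `&` tail j v) = a u * a v.
Hypothesis sum_a : (fun n => \sum_(v < n) a v) @ \oo --> m.

Let a_ge0 v : 0 <= a v. Proof. by rewrite -(pr_tail 0) pr_ge0. Qed.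

Let a_dec u v : (u <= v)%N -> a v <= a u.
Proof.
move=> uv; rewrite -!(pr_tail 0); apply: le_pr => // w /= hv; exact: leq_ltn_trans hv.
Qed.

Let sum_a_le n : \sum_(v < n) a v <= m.
Proof.
rewrite -(cvg_lim _ sum_a) //; apply: (@nondecreasing_cvgn_le _ (fun n => \sum_(v < n) a v)).
  apply/nondecreasing_seqP => k; by rewrite big_ord_recr /= lerDl.
by apply/cvg_ex; exists m.
Qed.

Let dev k (del : R) :=
  [set w | del * k%:R <= `|(\sum_(i < k) h i w)%:R - k%:R * \sum_(v < k) a v|].

Lemma measurable_nat_fun (f : T -> nat) (P : set nat) :
  (forall v, measurable [set w | (v < f w)%N]) -> measurable (f @^-1` P).
Proof.
move=> mf; have me v : measurable [set w | f w = v].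
  case: v => [|v].
    rewrite (_ : [set _ | _] = ~` [set w | (0 < f w)%N]); first exact: measurableC.
    by apply/seteqP; split => w /=; lia.
  rewrite (_ : [set _ | _] = [set w | (v < f w)%N] `\` [set w | (v.+1 < f w)%N]).
    exact: measurableD.
  by apply/seteqP; split => w /=; lia.
rewrite (_ : f @^-1` P = \bigcup_(v in P) [set w | f w = v]).
  apply: bigcup_measurable => v _; exact: me.
by apply/seteqP; split => w /=; [move=> Pw; exists (f w)|move=> [v Pv /= ->]].
Qed.

Let measurable_dev k del : measurable (dev k del).
Proof.
apply: (measurable_nat_fun (f := fun w => (\sum_(i < k) h i w)%N)
  [set n | del * k%:R <= `|n%:R - k%:R * \sum_(v < k) a v|]) => v.
exact: measurable_nat_sum.
Qed.

Let pr_dev k (del : R) : (0 < k)%N -> 0 < del ->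
  pr mu (dev k del) <= (del ^- 2 + 1) * ((\sum_(v < k) 2 * v.+1%:R * a v) / k%:R).
Proof.
move=> k0 del0; set b := \sum_(v < k) _; have K0 : 0 < k%:R :> R by rewrite ltr0n.
pose mk := \sum_(v < k) a v; pose U := \bigcup_(i in `I_k) tail i k.
have mU : measurable U by apply: bigcup_measurable => i _.
have pU : pr mu U <= b / k%:R.
  apply: (le_trans (pr_bigcup_lt_le mu k (fun i => mh i k))).
  rewrite (eq_bigr (fun=> a k)) => [|i _]; last exact: pr_tail.
  by rewrite sumr_const card_ord -[leLHS]mulr_natl; apply: mul_sum_weight.
pose A := dev k del `\` U; have mA : measurable A by apply: measurableD.
pose B (iv : 'I_k * 'I_k) := tail iv.1 iv.2.
have mB iv : measurable (B iv) by exact: mh.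
have mk0 : 0 <= mk by apply: sumr_ge0.
have cnt w : A w -> (del * k%:R) ^+ 2 <= (\sum_iv \1_(B iv) w - k%:R * mk) ^+ 2.
  move=> [hd hU]; have -> : \sum_iv \1_(B iv) w = (\sum_(i < k) h i w)%:R :> R.
    rewrite (eq_bigr (fun iv : 'I_k * 'I_k => ((iv.2 < h iv.1 w)%N : nat)%:R)); last first.
      move=> iv _; rewrite indicE; congr (_ %:R); congr nat_of_bool.
      by apply/idP/idP; rewrite inE.
    rewrite -natr_sum -(pair_bigA _ (fun (i : 'I_k) (v : 'I_k) => (v < h i w)%N : nat)) /=.
    congr (_ %:R); apply: eq_bigr => i _; rewrite sum_lt_minn; apply/minn_idPl.
    by rewrite leqNgt; apply/negP => hi; apply: hU; exists i => /=.
  by rewrite -[leRHS]real_normK ?num_real //; apply: lerXn2r => //;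
    rewrite nnegrE ?mulr_ge0 ?(ltW del0).
have := chebyshev_count mu (mulr_ge0 (ltW K0) mk0) mA mB cnt.
have -> : \sum_iv pr mu (B iv) = k%:R * mk.
  rewrite (eq_bigr (fun iv : 'I_k * 'I_k => a iv.2)) => [|iv _]; last exact: pr_tail.
  rewrite -(pair_bigA _ (fun (i : 'I_k) (v : 'I_k) => a v)) /= sumr_const card_ord.
  by rewrite mulr_natl.
have pairs : \sum_iv \sum_jv pr mu (B iv `&` B jv) <= (k%:R * mk) ^+ 2 + k%:R * b.
  apply: (@le_trans _ _ (\sum_(iv : 'I_k * 'I_k) \sum_(jv : 'I_k * 'I_k)
     (a iv.2 * a jv.2 + (iv.1 == jv.1)%:R * a (maxn iv.2 jv.2)))).
    apply: ler_sum => -[i u] _; apply: ler_sum => -[j v] _ /=; rewrite /B /=.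
    case: (eqVneq i j) => [->|ij]; last by rewrite pr_tailI // mul0r addr0.
    rewrite mul1r -(pr_tail j (maxn u v)) -[leLHS]add0r lerD ?mulr_ge0 //.
    by apply: le_pr => //; [exact: measurableI|move=> w [/= h1 h2]; rewrite /tail /= gtn_max h1].
  rewrite -(pair_bigA _ (fun (i : 'I_k) (u : 'I_k) => \sum_(jv : 'I_k * 'I_k)
     (a u * a jv.2 + (i == jv.1)%:R * a (maxn u jv.2)))) /=.
  have row (i : 'I_k) : \sum_(u < k) \sum_(jv : 'I_k * 'I_k)
     (a u * a jv.2 + (i == jv.1)%:R * a (maxn u jv.2)) =
     k%:R * mk ^+ 2 + \sum_(u < k) \sum_(v < k) a (maxn u v).
    under eq_bigr do rewrite big_split /=.
    rewrite big_split /=; congr (_ + _).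
      rewrite (eq_bigr (fun u : 'I_k => a u * (k%:R * mk))) => [|u _].
        by rewrite -mulr_suml -/mk; ring.
      rewrite -mulr_sumr -(pair_bigA _ (fun (i : 'I_k) (v : 'I_k) => a v)) /=.
      by rewrite sumr_const card_ord mulr_natl.
    apply: eq_bigr => u _.
    rewrite -(pair_bigA _ (fun (j : 'I_k) (v : 'I_k) => (i == j)%:R * a (maxn u v))) /=.
    rewrite (bigD1 i) //= eqxx [X in _ + X]big1 ?addr0.
      by apply: eq_bigr => v _; rewrite mul1r.
    by move=> j ji; rewrite big1 // => v _; rewrite eq_sym (negbTE ji) mul0r.
  rewrite (eq_bigr _ (fun i _ => row i)) sumr_const card_ord -[leLHS]mulr_natl.
  rewrite mulrDr exprMn expr2 -mulrA lerD2l ler_wpM2l ?(ltW K0) //.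
  apply: (le_trans (double_max_sum a k)); rewrite -/b -/mk; lra.
move=> ch.
have pA : pr mu A <= del ^- 2 * (b / k%:R).
  have : (del * k%:R) ^+ 2 * pr mu A <= k%:R * b by nra.
  have dk : 0 < (del * k%:R) ^+ 2 by rewrite exprn_gt0 // mulr_gt0.
  rewrite -ler_pdivlMl // => /le_trans; apply.
  rewrite le_eqVlt; apply/orP; left; apply/eqP.
  by field; rewrite !gt_eqF.
apply: (@le_trans _ _ (pr mu (A `|` U))).
  apply: le_pr => //; first exact: measurableU.
  by move=> w hw; have [|] := pselect (U w); [right|left].
by apply: (le_trans (prU_le _ mA mU)); rewrite mulrDl mul1r lerD.
Qed.

Lemma strong_law : {ae mu, forall w,
  (fun n => (\sum_(i < n) h i w)%:R / n%:R : R) @ \oo --> m}.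
Proof.
have m0 : 0 <= m by have := sum_a_le 0; rewrite big_ord0.
pose q l : R := l.+1%:R^-1.
have q01 l : 0 < q l <= 1.
  by rewrite /q invr_gt0 ltr0n /= invf_le1 ?ler1n.
have bc l : {ae mu, forall w, exists j0, forall j, (j0 <= j)%N ->
    ~ dev (geo (1 + q l) j) (q l) w}.
  have [ql0 ql1] := andP (q01 l).
  have r1 : 1 < 1 + q l by lra.
  apply: (@borel_cantelli_bound _ _ _ mu _
    ((q l ^- 2 + 1) * (4 * ((1 + q l) / (1 + q l - 1)) * m))) => [j|n].
    exact: measurable_dev.
  have c0 : 0 <= q l ^- 2 + 1 by rewrite addr_ge0 // invr_ge0 sqr_ge0.
  apply: le_trans (ler_wpM2l c0 (geo_sum_bound n r1 a_ge0 sum_a_le)).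
  rewrite mulr_sumr; apply: ler_sum => j _; exact: pr_dev.
apply: filterS (ae_foralln bc) => w hw.
apply/cvgrPdist_le => e e0.
pose l := Num.bound ((2 * m + 6) / e).
have le : q l * (2 * m + 6) <= e.
  rewrite /q [leLHS]mulrC ler_pdivrMr // [leRHS]mulrC -ler_pdivrMr //.
  apply: (@le_trans _ _ l%:R); last by rewrite ler_nat.
  by apply: ltW; apply: archi_boundP; rewrite divr_ge0 ?(ltW e0) //; lra.
have [ql0 ql1] := andP (q01 l).
have r1 : 1 < 1 + q l by lra.
have [j1 hj1] := hw l.
have [k1 _ hk1] := (cvgrPdist_le _ _).1 sum_a (q l) ql0.
have [j2 hj2] := geo_unbounded k1 r1.
have [| |n0 hn0] := @geo_interpolation R (fun n => \sum_(i < n) h i w)%N m (q l) (maxn j1 j2)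
  _ m0 (q01 l) _.
- move=> i j ij; rewrite -(subnKC ij) big_split_ord /=; exact: leq_addr.
- move=> j; rewrite geq_max => /andP[hj1' hj2'] /=.
  have := hj1 j hj1'; rewrite /dev /= => /negP; rewrite -ltNge.
  have kj : (k1 <= geo (1 + q l) j)%N.
    by apply: leq_trans (le_geo (ltW r1) hj2'); exact: ltnW.
  have := hk1 _ kj; set k : R := (geo _ _)%:R; set mk := \sum_(v < _) a v; set s : R := (_)%:R.
  have k0 : 0 < k by rewrite ltr0n.
  rewrite ltr_norml !ler_norml => /andP[h1 h2] /andP[h3 h4]; apply/andP; split; nra.
exists n0 => // n /= hn; rewrite distrC; apply: le_trans le; exact: hn0.
Qed.

End StrongLaw.

Section CountLargeNumbers.
Context {R : realType} {d : measure_display} {T : measurableType d}.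
Variables (mu : probability T R) (S : set R) (X : nat -> T -> R)
  (F : nat -> set (set T)).
Hypotheses (hA0 : A0 mu S X F) (hA3 : A3 mu X) (hrec : recurrent mu X).
Let a v := pr mu (alive X v.+1).

Let mE := measurable_excursion hA0.
Let mlen i v : measurable [set w | (v < len X w i)%N].
Proof. exact: (mE i.+1 [set s | (v < size s)%N]). Qed.

Lemma pr_len_gtI i j u v : i != j ->
  pr mu ([set w | (u < len X w i)%N] `&` [set w | (v < len X w j)%N]) = a u * a v.
Proof.
move=> ij; pose B l := if l == i then [set s : seq R | (u < size s)%N]
  else if l == j then [set s | (v < size s)%N] else setT.
have ji : (j == i) = false by rewrite eq_sym (negbTE ij).
have ik : (i < (maxn i j).+1)%N by rewrite ltnS leq_maxl.
have jk : (j < (maxn i j).+1)%N by rewrite ltnS leq_maxr.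
have := excursion_indep hA0 hA3 hrec (maxn i j).+1 B.
rewrite (bigD1 (Ordinal ik)) //= (bigD1 (Ordinal jk)) /=; last first.
  by rewrite -val_eqE /= ji.
rewrite big1 => [|l /andP[li lj]]; last first.
  move: li lj; rewrite -!val_eqE /= /B => /negbTE -> /negbTE ->.
  by rewrite preimage_setT prT.
rewrite mulr1 {2 3}/B eqxx ji eqxx.
rewrite -[pr mu (excursion X i.+1 @^-1` _)]/(pr mu [set w | (u < len X w i)%N]).
rewrite -[pr mu (excursion X j.+1 @^-1` _)]/(pr mu [set w | (v < len X w j)%N]).
rewrite !(pr_len_gt hA0 hA3 hrec) => <-; congr (pr mu _).
apply/seteqP; split => w /=.
  move=> [h1 h2] l _ /=; rewrite /B; case: eqP => [->//|_]; by case: eqP => [->|].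
move=> h; split; first by have := h i ik; rewrite /B /= eqxx.
by have := h j jk; rewrite /B /= ji eqxx.
Qed.

Lemma measurable_eta1 : measurable_fun setT (eta_n X 1).
Proof.
move=> _ B mB; rewrite setTI.
have mN : measurable (~` [set w | tau X w 1 <> None]).
  by apply: measurableC; exact: (measurable_tau_fin hA0).
have -> : eta_n X 1 @^-1` B =
    (\bigcup_(b in [set b | B (((b - 1)%N%:R)%:E)]) [set w | tau X w 1 = Some b]) `|`
    (if `[< B +oo%E >] then ~` [set w | tau X w 1 <> None] else set0).
  have etaE w : eta_n X 1 w = if tau X w 1 is Some b then ((b - 1)%N%:R)%:E else +oo%E by [].
  apply/seteqP; split => w; rewrite /preimage /mkset etaE.
    case e : (tau X w 1) => [b|] h; first by left; exists b.
    by right; rewrite asboolT //; apply: contrapT => /(_ (fun k => k e)).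
  move=> [[b Bb ->]//|]; case: asboolP => // h.
  by move=> /contrapT ->.
apply: measurableU; last by case: ifP.
by apply: bigcup_measurable => b _; exact: (measurable_tau hA0).
Qed.

Lemma eta1_series w : N_infinite X w ->
  eta_n X 1 w = (\sum_(v <oo) (\1_[set w | (v < len X w 0)%N] w)%:E)%E.
Proof.
move=> Ow; rewrite eta1E //; apply/esym/cvg_lim => //.
apply: cvg_near_cst; exists (len X w 0) => // n /= hn.
rewrite big_mkord sumEFin; congr (_%:E); apply/esym.
rewrite -(minn_idPl hn) -sum_lt_minn natr_sum; apply: eq_bigr => v _.
rewrite indicE; congr (_ %:R); congr nat_of_bool.
by apply/idP/idP; rewrite inE.
Qed.

Lemma integral_eta1 : (\int[mu]_w eta_n X 1 w = \sum_(v <oo) (a v)%:E)%E.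
Proof.
have mI v : measurable_fun setT (fun w => (\1_[set w | (v < len X w 0)%N] w : R)%:E).
  by apply/measurable_EFinP; apply: measurable_indic.
transitivity (\int[mu]_w (\sum_(v <oo) (\1_[set w | (v < len X w 0)%N] w)%:E))%E.
  apply: ge0_ae_eq_integral => //.
  - exact: measurable_eta1.
  - apply: ge0_emeasurable_sum => // v w _ _; by rewrite lee_fin.
  - move=> w _; rewrite /eta_n; case: (tau X w 1.-1) => // s; case: (tau X w 1) => //.
  - by move=> w _; apply: nneseries_ge0 => v _ _; rewrite lee_fin.
  by apply: filterS (N_infinite_ae hA0 hA3 hrec) => w Ow _; exact: eta1_series.
rewrite integral_nneseries //.
apply: eq_eseriesr => v _; rewrite integral_indic // setIT.
by rewrite /a -(pr_len_gt hA0 hA3 hrec 0); exact: prE.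
Qed.

Lemma excursion_count_lln (K : R) : (forall n, \sum_(v < n) a v <= K) ->
  let Eeta1 := (\int[mu]_w eta_n X 1%N w)%E in
  [/\ (0 < Eeta1)%E, (Eeta1 < +oo)%E &
    {ae mu, forall w,
       (fun t : nat => fine (Ncount X t w) / t%:R) @ \oo --> (fine Eeta1)^-1}].
Proof.
move=> hK; rewrite integral_eta1 /=; set E := (\sum_(v <oo) _)%E.
have a0 v : 0 <= a v by exact: pr_ge0.
have cE : (fun n => \sum_(0 <= v < n) (a v)%:E)%E @ \oo --> E.
  by apply: is_cvg_nneseries => v _ _; rewrite lee_fin.
have E1 : (1%:E <= E)%E.
  have a1 : a 0 = 1.
    rewrite /a (_ : alive X 1 = setT) ?prT //; apply/seteqP; split => // w _ s.
    by case: s => [|[|s]].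
  rewrite /E (@nneseries_split _ _ 0 1) => [|v _]; last by rewrite lee_fin.
  rewrite big_nat1 a1 leeDl //; apply: nneseries_ge0 => v _ _; by rewrite lee_fin.
have EK : (E <= K%:E)%E.
  apply: lime_le; first by apply/cvg_ex; exists E.
  by apply: nearW => n; rewrite big_mkord sumEFin lee_fin.
have Efin : E \is a fin_num.
  by rewrite fin_numE -ltey -ltNye (lt_le_trans _ E1) ?ltNyr // (le_lt_trans EK) ?ltry.
set m := fine E; have mE' : E = m%:E by rewrite fineK.
have m1 : 1 <= m by rewrite -lee_fin -mE'.
split; first by rewrite mE' lte_fin; lra.
  by rewrite mE' ltry.
have sum_a : (fun n => \sum_(v < n) a v) @ \oo --> m.
  rewrite (_ : (fun n => _) = fine \o (fun n => \sum_(0 <= v < n) (a v)%:E)%E).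
    by apply: fine_cvg; rewrite -mE'.
  by apply/funext => n /=; rewrite big_mkord sumEFin.
have sl := strong_law mlen (pr_len_gt hA0 hA3 hrec) pr_len_gtI sum_a.
apply: filterS2 (N_infinite_ae hA0 hA3 hrec) sl => w Ow hw.
apply/cvgrPdist_le => e e0; have e2 : 0 < e / 2 by lra.
have [n0 _ hn0] := (cvgrPdist_le _ _).1 hw _ e2.
exists (maxn (tn X w n0.+1) (Num.bound ((1 + m + e / 2) / (e / 2)))) => // t /=.
rewrite geq_max => /andP[t1 t2].
have t1' : (tn X w 1 <= t)%N by apply: leq_trans t1; exact: le_tn.
have [N [N1 -> Nlo Nhi]] := NcountP Ow t1'.
have n0N : (n0 <= N)%N.
  rewrite leqNgt; apply/negP => h; have h' : (N.+1 <= n0.+1)%N by exact: leqW.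
  by have := leq_trans Nhi (leq_trans (le_tn Ow h') t1); rewrite ltnn.
have Nt : (N <= t)%N by apply: leq_trans Nlo; rewrite ltnW // tn_ge.
have b1 := hn0 N n0N; have b2 := hn0 N.+1 (leqW n0N).
move: Nlo Nhi; rewrite !tn_sum // !add1n.
rewrite -(ler_nat R) -(ltr_nat R) -[(\sum_(i < N) _).+1%:R]natr1 -[(\sum_(i < N.+1) _).+1%:R]natr1.
move: b1 b2; set s1 : R := (\sum_(i < N) _)%:R; set s2 : R := (\sum_(i < N.+1) _)%:R.
have NN0 : 0 < N%:R :> R by rewrite ltr0n.
have NS0 : 0 < N.+1%:R :> R by [].
have t0 : 0 < t%:R :> R by rewrite ltr0n (leq_trans N1).
have Nt' : N%:R <= t%:R :> R by rewrite ler_nat.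
have big : 1 + m + e / 2 <= e / 2 * t%:R.
  rewrite [leRHS]mulrC -ler_pdivrMr //; apply: (@le_trans _ _ (Num.bound ((1 + m + e / 2) / (e / 2)))%:R).
    by apply: ltW; apply: archi_boundP; rewrite divr_ge0 //; lra.
  by rewrite ler_nat.
have dist (x y z : R) : 0 < y -> `|m - x / y| <= z -> y * (m - z) <= x <= y * (m + z).
  move=> y0; rewrite ler_norml => /andP[h1 h2].
  have -> : x = y * (x / y) by rewrite mulrC divfK // gt_eqF.
  by rewrite !ler_pM2l //; apply/andP; split; lra.
move=> /(dist _ _ _ NN0)/andP[l1 u1] /(dist _ _ _ NS0)/andP[l2 u2] h1 h2.
move: l2 u2; rewrite -[N.+1%:R]natr1 => l2 u2.
have -> : m^-1 - fine (N%:R%:E) / t%:R = (t%:R - N%:R * m) / (t%:R * m).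
  by rewrite /=; field; apply/andP; split; rewrite gt_eqF //; lra.
have tm : 0 < t%:R * m by rewrite mulr_gt0 //; lra.
have et : e * t%:R <= e * (t%:R * m).
  by rewrite ler_pM2l // ler_peMr // ltW.
have eN : e / 2 * N%:R <= e / 2 * t%:R by rewrite ler_pM2l.
by rewrite normrM (gtr0_norm (x := (t%:R * m)^-1)) ?invr_gt0 // ler_pdivrMr //
  ler_norml; apply/andP; split; lra.
Qed.

End CountLargeNumbers.

Theorem theorem2p5 (R : realType) (d : measure_display) (T : measurableType d)
    (mu : probability T R) (S : set R) (X : nat -> T -> R)
    (F : nat -> set (set T)) (c s2 : R) :
  A0 mu S X F -> A1 mu S X F -> A2 mu X F c s2 -> A3 mu X ->
  let r := - 2 * c / s2 in
  ((-1 < r <= 1) -> (exists p : R, 2 < p /\ Mp mu X F p) ->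
     forall eps : R, 0 < eps ->
       {ae mu, forall w, exists t0 : nat, forall t : nat, (t0 <= t)%N ->
          ((t%:R `^ ((1 + r) / 2) * ln t%:R `^ (- 3 - r - eps))%R%:E
             <= Ncount X t w)%E /\
          (Ncount X t w
             <= (t%:R `^ ((1 + r) / 2) * ln t%:R `^ (1 + eps))%R%:E)%E}) /\
  ((1 < r) -> (exists p : R, 1 + r < p /\ Mp mu X F p) ->
     let Eeta1 := (\int[mu]_w eta_n X 1%N w)%E in
     [/\ (0 < Eeta1)%E, (Eeta1 < +oo)%E &
       {ae mu, forall w,
          (fun t : nat => fine (Ncount X t w) / t%:R) @ \oo --> (fine Eeta1)^-1}]).
Proof.
move=> hA0 hA1 hA2 hA3 r; have s20 : 0 < s2 by case: hA2.
have cE : c = - (1 + r - 1) * s2 / 2 by rewrite /r; field; rewrite gt_eqF.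
split => [/andP[r1 r2] [p [p2 hM]] eps eps0|r1 [p [pr1 hM]]].
  have g0 : 0 < 1 + r by lra.
  have g2 : 1 + r <= 2 by lra.
  have -> : - 3 - r - eps = - (2 + (1 + r) + eps) by lra.
  exact: (excursion_count_bounds hA0 hA1 hA2 p2 hM hA3 g0 g2 cE eps0).
have p2 : 2 < p by lra.
have g2 : 2 < 1 + r by lra.
have [K hK] := pos_estimates hA0 hA1 hA2 p2 hM cE g2.
have hrec := pos_recurrent hA0 hA1 hA2 p2 hM cE g2.
exact: (excursion_count_lln hA0 hA3 hrec hK).
Qed.
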